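(* Let $R$ be o-minimal and $Z$ arbitrary, and let $G$ be a group definable in the two-sorted structure $(Z,R)$ (so $G\subseteq Z^m\times R^n$ for some $m,n$). Then $G$ has a unique group topology (called the t-topology) which coincides with the ambient topology on some $R$-large open subset $V$ of $G$.
   Context: Let $\mathfrak C$ be a monster model, $Z,R$ definable subsets of $\mathfrak C$ which are stably embedded (subsets of $Z^n$, resp. $R^n$, definable with parameters from $\mathfrak C$ are definable with parameters from $Z$, resp. $R$) and fully orthogonal (for all $m,n$, every definable subset of $Z^m\times R^n$ is a finite union of sets $U\times V$ with $U\subseteq Z^m$, $V\subseteq R^n$ definable); so definable subsets of $Z^m\times R^n$ are those of the two-sorted structure $(Z,R)$ with no connection between the sorts. ''Definable'' means with parameters. Here $R$ (with its induced structure) is o-minimal. Ambient topology: $R$ carries the order topology, $Z$ the discrete topology, $Z^m\times R^n$ the product topology, and subsets the induced topology. For definable $X\subseteq Z^m\times R^n$, $\dim_R(X)$ is the o-minimal dimension of the projection of $X$ to $R^n$. A definable $Y\subseteq X$ is $R$-large in $X$ if $\dim_R(X\setminus Y)<\dim_R(X)$, with the convention that if $\dim_R(X)=0$ this means $Y=X$. *)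

(* Defs.v *)
From mathcomp Require Import all_boot all_order.
Set Implicit Arguments. Unset Strict Implicit. Unset Printing Implicit Defensive.
Import Order.TTheory.
Local Open Scope order_scope.

(* Structures in the sense of van den Dries (Tame Topology, Ch. 1):        *)
(* for every finite index type I, a collection D I of subsets of M^I,      *)
(* closed under boolean operations, cylinders/permutations/diagonals       *)
(* (preimages under reindexing) and projections (images under reindexing); *)
(* all points are definable (definability with parameters).               *)
Definition defsys (M : Type) := forall I : finType, ((I -> M) -> Prop) -> Prop.

Definition is_structure (M : Type) (D : defsys M) : Prop :=
  [/\ (forall I : finType, D I (fun _ => True)) /\
        (forall (I : finType) A, D I A -> D I (fun x => ~ A x)),
      (forall (I : finType) A B, D I A -> D I B -> D I (fun x => A x /\ B x)),
      (forall (I J : finType) (f : I -> J) A, D I A -> D J (fun x => A (x \o f))),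
      (forall (I J : finType) (f : I -> J) A,
          D J A -> D I (fun y => exists x, A x /\ y = x \o f)) &
      (forall c : M, D 'I_1 (fun x => x = (fun _ => c)))].

Definition in_oitv d (R : orderType d) (iv : option R * option R) (r : R) : bool :=
  (if iv.1 is Some a then a < r else true) && (if iv.2 is Some b then r < b else true).

Definition o_minimal d (R : orderType d) (D : defsys R) : Prop :=
  [/\ is_structure D /\ D 'I_2 (fun x => x ord0 < x ord_max),
      inhabited R,
      (forall x y : R, x < y -> exists z, x < z /\ z < y),
      (forall x : R, (exists y, y < x) /\ (exists y, x < y)) &
      (forall A : ('I_1 -> R) -> Prop, D 'I_1 A ->
         exists (ps : seq R) (ivs : seq (option R * option R)),
           forall r, A (fun _ => r) <-> (r \in ps) || has (fun iv => in_oitv iv r) ivs)].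

(* definable sets of the two-sorted structure (Z,R) with no connection      *)
(* between the sorts: finite unions of products U x V                      *)
Definition DefZR (Z : Type) d (R : orderType d) (DZ : defsys Z) (DR : defsys R)
    (I J : finType) (X : (I -> Z) * (J -> R) -> Prop) : Prop :=
  exists (k : nat) (U : 'I_k -> (I -> Z) -> Prop) (V : 'I_k -> (J -> R) -> Prop),
    (forall i, DZ I (U i) /\ DR J (V i)) /\
    (forall p, X p <-> exists i, U i p.1 /\ V i p.2).

Definition pt (Z : Type) d (R : orderType d) (m n : nat) :=
  (('I_m -> Z) * ('I_n -> R))%type.

Definition sel3 (T : Type) (x y w : T) (i : 'I_3) : T :=
  match val i with 0 => x | 1 => y | _ => w end.

Definition trip (Z : Type) d (R : orderType d) (m n : nat) (x y w : pt Z R m n)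
  : (('I_3 * 'I_m) -> Z) * (('I_3 * 'I_n) -> R) :=
  (fun ik => (sel3 x y w ik.1).1 ik.2, fun ik => (sel3 x y w ik.1).2 ik.2).

Definition mul_graph (Z : Type) d (R : orderType d) (m n : nat)
    (G : pt Z R m n -> Prop) (mul : pt Z R m n -> pt Z R m n -> pt Z R m n) :=
  fun p => exists x y, G x /\ G y /\ p = trip x y (mul x y).

Definition is_group (T : Type) (G : T -> Prop) (mul : T -> T -> T) (e : T) (inv : T -> T)
  : Prop :=
  [/\ G e /\ (forall x y, G x -> G y -> G (mul x y)),
      (forall x, G x -> G (inv x)),
      (forall x y z, G x -> G y -> G z -> mul (mul x y) z = mul x (mul y z)),
      (forall x, G x -> mul e x = x /\ mul x e = x) &
      (forall x, G x -> mul (inv x) x = e /\ mul x (inv x) = e)].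

Definition is_topology_on (T : Type) (G : T -> Prop) (tau : (T -> Prop) -> Prop) : Prop :=
  [/\ (forall U, tau U -> forall x, U x -> G x),
      tau G,
      (forall F : (T -> Prop) -> Prop, (forall U, F U -> tau U) ->
          tau (fun x => exists U, F U /\ U x)) &
      (forall U V, tau U -> tau V -> tau (fun x => U x /\ V x))].

Definition group_topology (T : Type) (G : T -> Prop) (mul : T -> T -> T) (inv : T -> T)
    (tau : (T -> Prop) -> Prop) : Prop :=
  [/\ is_topology_on G tau,
      (forall x y W, G x -> G y -> tau W -> W (mul x y) ->
         exists U V, [/\ tau U, tau V, U x, V y &
                         forall u v, U u -> V v -> W (mul u v)]) &
      (forall W, tau W -> tau (fun x => G x /\ W (inv x)))].

(* ambient topology on Z^m x R^n: Z discrete, R order topology, product *)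
Definition ambient_open (Z : Type) d (R : orderType d) (m n : nat)
    (U : pt Z R m n -> Prop) : Prop :=
  forall p, U p -> exists a b : 'I_n -> R,
    (forall j, a j < p.2 j < b j) /\
    (forall q : pt Z R m n, q.1 = p.1 -> (forall j, a j < q.2 j < b j) -> U q).

Definition coincide_on (Z : Type) d (R : orderType d) (m n : nat)
    (tau : (pt Z R m n -> Prop) -> Prop) (V : pt Z R m n -> Prop) : Prop :=
  forall W : pt Z R m n -> Prop,
    (exists U, tau U /\ forall x, W x <-> U x /\ V x) <->
    (exists U, ambient_open U /\ forall x, W x <-> U x /\ V x).

Definition dim_ge d (R : orderType d) (J : finType) (A : (J -> R) -> Prop) (k : nat)
  : Prop :=
  exists f : 'I_k -> J, injective f /\
    exists a b : 'I_k -> R, (forall i, a i < b i) /\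
      forall y : 'I_k -> R, (forall i, a i < y i < b i) ->
        exists x, A x /\ x \o f = y.

Definition projR (Z : Type) d (R : orderType d) (I J : finType)
    (X : (I -> Z) * (J -> R) -> Prop) : (J -> R) -> Prop :=
  fun r => exists z, X (z, r).

(* Y is R-large in X: dim_R (X \ Y) < dim_R X, where dim of the empty set  *)
(* is -oo (this includes the convention: if dim_R X = 0 then Y = X)        *)
Definition R_large (Z : Type) d (R : orderType d) (I J : finType)
    (X Y : (I -> Z) * (J -> R) -> Prop) : Prop :=
  (forall p, X p -> Y p) \/
  exists k, dim_ge (projR X) k /\ ~ dim_ge (projR (fun p => X p /\ ~ Y p)) k.

Definition t_topology (Z : Type) d (R : orderType d) (DZ : defsys Z) (DR : defsys R)
    (m n : nat) (G : pt Z R m n -> Prop) (mul : pt Z R m n -> pt Z R m n -> pt Z R m n)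
    (inv : pt Z R m n -> pt Z R m n) (tau : (pt Z R m n -> Prop) -> Prop) : Prop :=
  group_topology G mul inv tau /\
  exists V : pt Z R m n -> Prop,
    [/\ DefZR DZ DR V, (forall x, V x -> G x), R_large G V, tau V & coincide_on tau V].

(* Main.v *)
(** No cell decomposition is needed: a definable function on a box of R^n is
    continuous on a smaller box, and a box covered by two definable sets has a sub-box inside one
    of them. The two statements are proved by simultaneous induction on n from the monotonicity
    theorem in one variable. They yield a dimension (the largest rank of a coordinate projection
    with non-empty interior) that definable maps do not increase and that is superadditive over
    fibres, and show that the discontinuities of a definable function on X have smaller dimension
    than X. The sort Z is harmless because of orthogonality: a definable family indexed by Z has
    finitely many members.

    The group argument is due to Pillay. Let k = dim G. Multiplication is discontinuous on a set of
    dimension < 2k, so there is a large, relatively open V such that for v in V the pairs (d, v)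
    and (c, c^-1 v), and their mirror images, are continuity points for generic c and d. A
    translation x |-> a x between points of V factors as x |-> d x |-> c d x with a = c d and c, d
    generic, so it is continuous. Hence the sets U such that each gU meets V in a relatively open set form a
    group topology that extends the ambient one on V. Two such topologies agree near some point,
    since two large sets share an interior point, and therefore everywhere by translation. *)
Require Import Defs.
From mathcomp Require Import all_boot all_order.
From mathcomp Require Import boolp.
Set Implicit Arguments. Unset Strict Implicit. Unset Printing Implicit Defensive.
Import Order.TTheory.
Local Open Scope order_scope.

(** No group or field structure is given on [R], so definable choice can fail: in a pure dense order
    no definable function picks a point inside every interval. Selections are therefore made only on
    a smaller box ([choosable]), which is enough to test for non-empty interior. Generic points are
    found by discarding definable sets of small dimension. Hence continuity, interior and dimension
    of a fibre must all be definable in parameters, and neighbourhoods are given by the corners of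
    boxes. The pairs [(c, c^-1 v)] arise from the definable map [(c, w) |-> (c w, c)]: it cannot
    raise the dimension of the discontinuity set, so the image has small fibres over most [v].
    Testing openness on all translates avoids covering [G] by finitely many translates of [V]. Left
    translations are then harmless by construction, whereas right translations, products and
    inverses have to be moved to generic points, where ambient continuity is known. *)

(** * Definable sets in one sort *)

Section OneSorted.
Variables (M : Type) (D : defsys M).
Hypothesis HD : is_structure D.

Lemma D_ext (I : finType) (A B : (I -> M) -> Prop) :
  D A -> (forall x, A x <-> B x) -> D B.
Proof. by move=> DA AB; have -> : B = A by apply/funext => x; apply/propext; split=> /AB. Qed.

Lemma D_true (I : finType) : @D I (fun _ => True).
Proof. by case: HD => -[]. Qed.

Lemma D_not (I : finType) (A : (I -> M) -> Prop) : D A -> D (fun x => ~ A x).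
Proof. by case: HD => -[_ h] _ _ _ _; apply: h. Qed.

Lemma D_and (I : finType) (A B : (I -> M) -> Prop) :
  D A -> D B -> D (fun x => A x /\ B x).
Proof. by case: HD => _ h _ _ _; apply: h. Qed.

Lemma D_pre (I J : finType) (f : I -> J) (A : (I -> M) -> Prop) :
  D A -> D (fun x => A (x \o f)).
Proof. by case: HD => _ _ h _ _; apply: h. Qed.

Lemma D_img (I J : finType) (f : I -> J) (A : (J -> M) -> Prop) :
  D A -> D (fun y => exists x, A x /\ y = x \o f).
Proof. by case: HD => _ _ _ h _; apply: h. Qed.

Lemma D_eqc (I : finType) (i : I) (c : M) : D (fun x => x i = c).
Proof.
have Dc : @D 'I_1 (fun x => x = (fun _ => c)) by case: HD => _ _ _ _; apply.
apply: (D_ext (D_pre (fun _ => i) Dc)) => x; split=> [/(congr1 (fun f => f ord0))//|h].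
by apply/funext => j /=.
Qed.

(** The diagonal is the image of [unit -> M] under the reindexing [bool -> unit], which repeats the
    single coordinate; a preimage then places it at [i] and [j]. *)
Lemma D_eqv (I : finType) (i j : I) : D (fun x => x i = x j).
Proof.
have := D_pre (fun b : bool => if b then i else j) (D_img (fun _ : bool => tt) (D_true unit)).
move=> Dc; apply: (D_ext Dc) => x; split=> [[y [_ e]]|e].
  by have := congr1 (fun f => f true) e; have := congr1 (fun f => f false) e => /= -> ->.
by exists (fun _ => x i); split=> //; apply/funext => -[] /=.
Qed.

Lemma D_allseq (I : finType) (K : eqType) (s : seq K) (A : K -> (I -> M) -> Prop) :
  (forall k, D (A k)) -> D (fun x => forall k, k \in s -> A k x).
Proof.
move=> DA; elim: s => [|k s IH]; first by apply: (D_ext (D_true I)) => x; split.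
apply: (D_ext (D_and (DA k) IH)) => x; split=> [[h1 h2] k'|h].
  by rewrite in_cons => /orP[/eqP->|/h2].
by split=> [|k' k's]; apply: h; rewrite in_cons ?eqxx ?k's ?orbT.
Qed.

Lemma D_all (I K : finType) (A : K -> (I -> M) -> Prop) :
  (forall k, D (A k)) -> D (fun x => forall k, A k x).
Proof.
move=> DA; apply: (D_ext (D_allseq (enum K) DA)) => x; split=> h k; last by move=> _.
by apply: h; rewrite mem_enum.
Qed.

Definition simple (J : Type) (s : (J -> M) -> M) :=
  (exists j, s = fun x => x j) \/ (exists c, s = fun _ => c).

(** Reindexing cannot insert constants. The old and the new variables are therefore put side by side
    in [I + J], linked by definable equations, and the old ones are projected away. *)
Lemma D_simple (I J : finType) (A : (I -> M) -> Prop) (s : I -> (J -> M) -> M) :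
  D A -> (forall i, simple (s i)) -> D (fun x => A (fun i => s i x)).
Proof.
move=> DA hs.
have Ds : @D (I + J)%type (fun w => forall i, w (inl i) = s i (w \o inr)).
  by apply: D_all => i; case: (hs i) => -[j ->]; [apply: D_eqv | apply: D_eqc].
have := D_img (inr : J -> I + J) (D_and (D_pre (inl : I -> I + J) DA) Ds).
move=> Dc; apply: (D_ext Dc) => x; split=> [[w [[Aw sw] ->]]|Ax].
  by have <- : w \o inl = (fun i => s i (w \o inr)) by apply/funext.
exists (fun k => match k with inl i => s i x | inr j => x j end).
by split.
Qed.

End OneSorted.

(** * Definable sets in two sorts *)

Section TwoSorted.
Variables (Z : Type) (disp : Order.disp_t) (R : orderType disp).
Variables (DZ : defsys Z) (DR : defsys R).
Hypotheses (HZ : is_structure DZ) (HR : o_minimal DR).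

Lemma DR_structure : is_structure DR. Proof. by case: HR => -[]. Qed.

Notation DZR := (DefZR DZ DR).

Lemma DefZR_ext (I J : finType) (X Y : (I -> Z) * (J -> R) -> Prop) :
  DZR X -> (forall p, X p <-> Y p) -> DZR Y.
Proof. by move=> DX XY; have -> : Y = X by apply/funext => x; apply/propext; split=> /XY. Qed.

(** Frees the index type: sums and boolean functions index the unions below. *)
Lemma DefZR_union (I J K : finType) (U : K -> (I -> Z) -> Prop) (V : K -> (J -> R) -> Prop) :
  (forall k, DZ (U k) /\ DR (V k)) -> DZR (fun p => exists k, U k p.1 /\ V k p.2).
Proof.
move=> h; exists #|K|, (U \o enum_val), (V \o enum_val); split=> [i|p]; first exact: h.
split=> [[k hk]|[i hi]]; last by exists (enum_val i).
by exists (enum_rank k) => /=; rewrite enum_rankK.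
Qed.

Lemma DefZR_or (I J : finType) (X Y : (I -> Z) * (J -> R) -> Prop) :
  DZR X -> DZR Y -> DZR (fun p => X p \/ Y p).
Proof.
move=> [k [U [V [h hX]]]] [k' [U' [V' [h' hY]]]].
pose U2 (s : 'I_k + 'I_k') := match s with inl i => U i | inr i => U' i end.
pose V2 (s : 'I_k + 'I_k') := match s with inl i => V i | inr i => V' i end.
have /(@DefZR_union _ _ _ U2 V2) D : forall s, DZ (U2 s) /\ DR (V2 s) by case.
apply: (DefZR_ext D) => p; rewrite hX hY; split=> [[[i|i] hi]|[[i hi]|[i hi]]].
- by left; exists i.
- by right; exists i.
- by exists (inl i).
- by exists (inr i).
Qed.

Lemma DefZR_not (I J : finType) (X : (I -> Z) * (J -> R) -> Prop) :
  DZR X -> DZR (fun p => ~ X p).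
Proof.
move=> [k [U [V [h hX]]]].
(* A point outside all rectangles misses each of them in at least one of the two sorts; [s i] is
   true when the failure at [i] is charged to [U i], and false when it is charged to [V i]. *)
pose U2 (s : {ffun 'I_k -> bool}) x := forall i, if s i then ~ U i x else True.
pose V2 (s : {ffun 'I_k -> bool}) x := forall i, if s i then True else ~ V i x.
have /(@DefZR_union _ _ _ U2 V2) D : forall s, DZ (U2 s) /\ DR (V2 s).
  move=> s; split.
    apply: (D_all HZ) => i; case: (s i); last exact: D_true.
    by apply: D_not => //; case: (h i).
  apply: (D_all DR_structure) => i; case: (s i); first exact: (D_true DR_structure).
  by apply: (D_not DR_structure); case: (h i).
apply: (DefZR_ext D) => p; rewrite hX; split=> [[s [hU hV]] [i [Ui Vi]]|nX].
  by move: (hU i) (hV i); case: (s i).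
exists [ffun i => `[< ~ U i p.1 >]]; split=> i; rewrite ffunE; case: asboolP => // /contrapT Ui Vi.
by apply: nX; exists i.
Qed.

Lemma DefZR_and (I J : finType) (X Y : (I -> Z) * (J -> R) -> Prop) :
  DZR X -> DZR Y -> DZR (fun p => X p /\ Y p).
Proof.
move=> DX DY; apply: (DefZR_ext (DefZR_not (DefZR_or (DefZR_not DX) (DefZR_not DY)))) => p.
by split=> [/not_orP[]/contrapT X1 /contrapT|[? ?] []].
Qed.

Lemma DefZR_rect (I J : finType) (U : (I -> Z) -> Prop) (V : (J -> R) -> Prop) :
  DZ U -> DR V -> DZR (fun p => U p.1 /\ V p.2).
Proof.
move=> DU DV; have := @DefZR_union _ _ unit (fun _ => U) (fun _ => V) (fun _ => conj DU DV).
by move=> D; apply: (DefZR_ext D) => p; split=> [[]|h] //; exists tt.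
Qed.

Lemma DefZR_true (I J : finType) : DZR (fun _ : (I -> Z) * (J -> R) => True).
Proof. by apply: (DefZR_ext (DefZR_rect (D_true HZ I) (D_true DR_structure J))) => p; split. Qed.

Lemma DefZR_simple (I I' J J' : finType) (X : (I -> Z) * (J -> R) -> Prop)
    (s : I -> (I' -> Z) -> Z) (t : J -> (J' -> R) -> R) :
  DZR X -> (forall i, simple (s i)) -> (forall j, simple (t j)) ->
  DZR (fun p => X (s^~ p.1, t^~ p.2)).
Proof.
move=> [k [U [V [h hX]]]] hs ht.
exists k, (fun i z => U i (s^~ z)), (fun i z => V i (t^~ z)); split=> [i|p]; last exact: hX.
by case: (h i) => hU hV; split; [apply: (D_simple HZ hU)|apply: (D_simple DR_structure hV)].
Qed.

(** The reindexing acts on each sort separately, so the image of a rectangle is a rectangle. *)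
Lemma DefZR_img (I I' J J' : finType) (f : I -> I') (g : J -> J')
    (X : (I' -> Z) * (J' -> R) -> Prop) :
  DZR X -> DZR (fun p => exists q, X q /\ p = (q.1 \o f, q.2 \o g)).
Proof.
move=> [k [U [V [h hX]]]].
exists k, (fun i y => exists x, U i x /\ y = x \o f), (fun i y => exists x, V i x /\ y = x \o g).
split=> [i|p].
  by case: (h i) => hU hV; split; [apply: (D_img HZ)|apply: (D_img DR_structure)].
split=> [[q [/hX[i [Ui Vi]] ->]]|[i [[u [Uu e]] [v [Vv e']]]]].
  by exists i; split; [exists q.1|exists q.2].
exists (u, v); split; first by apply/hX; exists i.
by case: p e e' => ? ? /= -> ->.
Qed.

(* [zc], [rc] and [mk] identify [T] with [Z^zi * R^ri], so that definability can be stated on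
   products and powers without reindexing. *)
Class dty (T : Type) := Dty {
  zi : finType; ri : finType;
  zc : T -> zi -> Z; rc : T -> ri -> R;
  mk : (zi -> Z) -> (ri -> R) -> T;
  zcK : forall u v, zc (mk u v) = u;
  rcK : forall u v, rc (mk u v) = v;
  mkK : forall t, mk (zc t) (rc t) = t }.
Arguments zi T {_}. Arguments ri T {_}.

Lemma void_fun (U : Type) (u v : void -> U) : u = v.
Proof. by apply/funext; case. Qed.

#[local] Instance dtyR : dty R.
Proof.
apply: (@Dty R void unit (fun _ v => match v with end) (fun r _ => r) (fun _ v => v tt)) => //.
- by move=> *; apply: void_fun.
- by move=> _ v; apply/funext; case.
Defined.

#[local] Instance dtyRJ (J : finType) : dty (J -> R).
Proof.
apply: (@Dty (J -> R) void J (fun _ v => match v with end) (fun r => r) (fun _ v => v)) => //.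
by move=> *; apply: void_fun.
Defined.

#[local] Instance dtyZI (I : finType) : dty (I -> Z).
Proof.
apply: (@Dty (I -> Z) I void (fun z => z) (fun _ v => match v with end) (fun u _ => u)) => //.
by move=> *; apply: void_fun.
Defined.

#[local] Instance dtyP T U (dT : dty T) (dU : dty U) : dty (T * U).
Proof.
apply: (@Dty (T * U) (zi T + zi U)%type (ri T + ri U)%type
  (fun t i => match i with inl i => zc t.1 i | inr i => zc t.2 i end)
  (fun t i => match i with inl i => rc t.1 i | inr i => rc t.2 i end)
  (fun u v => (mk (u \o inl) (v \o inl), mk (u \o inr) (v \o inr)))).
- by move=> u v; apply/funext; case=> i; rewrite /= zcK.
- by move=> u v; apply/funext; case=> i; rewrite /= rcK.
- by move=> [t u] /=; congr pair; apply: mkK.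
Defined.

Lemma coord_ext T {dT : dty T} (x y : T) :
  zc x = zc y -> (forall j, rc x j = rc y j) -> x = y.
Proof. by move=> e /funext e'; rewrite -(mkK x) e e' mkK. Qed.

(** * First-order closure properties *)

Definition Def T {dT : dty T} (P : T -> Prop) := DZR (fun p => P (mk p.1 p.2)).

(** These maps serve twice: substitution along them preserves definability ([def_term]), and they
    are continuous at every point ([cont_term]). *)
Definition term T U {dT : dty T} {dU : dty U} (f : T -> U) :=
  (forall i, exists2 s, simple s & forall t, zc (f t) i = s (zc t)) /\
  (forall i, exists2 s, simple s & forall t, rc (f t) i = s (rc t)).

Section Closure.
Context {T U W : Type} {dT : dty T} {dU : dty U} {dW : dty W}.

Lemma def_ext (A B : T -> Prop) : Def A -> (forall x, A x <-> B x) -> Def B.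
Proof. by move=> DA AB; apply: (DefZR_ext DA) => p; apply: AB. Qed.

Lemma def_T (P : Prop) : Def (fun _ : T => P).
Proof.
have [h|h] := pselect P; first by apply: (DefZR_ext (DefZR_true _ _)) => p; split.
by apply: (DefZR_ext (DefZR_not (DefZR_true _ _))) => p; split=> // /(_ I).
Qed.

Lemma def_not (A : T -> Prop) : Def A -> Def (fun x => ~ A x).
Proof. exact: DefZR_not. Qed.

Lemma def_and (A B : T -> Prop) : Def A -> Def B -> Def (fun x => A x /\ B x).
Proof. exact: DefZR_and. Qed.

Lemma def_or (A B : T -> Prop) : Def A -> Def B -> Def (fun x => A x \/ B x).
Proof. exact: DefZR_or. Qed.

Lemma def_imp (A B : T -> Prop) : Def A -> Def B -> Def (fun x => A x -> B x).
Proof.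
move=> DA DB; apply: (def_ext (def_or (def_not DA) DB)) => x.
by split=> [[]//|h]; have [/h|] := pselect (A x); [right|left].
Qed.

Lemma def_iff (A B : T -> Prop) : Def A -> Def B -> Def (fun x => A x <-> B x).
Proof. by move=> DA DB; apply: def_and; apply: def_imp. Qed.

Lemma def_ex (Q : T -> U -> Prop) :
  Def (fun p => Q p.1 p.2) -> Def (fun x => exists y, Q x y).
Proof.
move=> /(DefZR_img inl inl) DQ; apply: (DefZR_ext DQ) => p; split=> [[q [Qq ->]]|[y Qy]].
  by eexists; apply: Qq.
exists (zc (mk p.1 p.2, y), rc (mk p.1 p.2, y)); split; last first.
  by case: p Qy => u v /= _; rewrite /comp /= zcK rcK.
by move: Qy; rewrite /comp /= !mkK.
Qed.

Lemma def_term (A : U -> Prop) (f : T -> U) : Def A -> term f -> Def (fun x => A (f x)).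
Proof.
move=> DA [hz hr].
have [s hs] := choice (fun i => let: ex_intro2 s a b := hz i in ex_intro _ s (conj a b)).
have [t ht] := choice (fun i => let: ex_intro2 s a b := hr i in ex_intro _ s (conj a b)).
have D := DefZR_simple DA (fun i => (hs i).1) (fun i => (ht i).1).
apply: (DefZR_ext D) => p /=.
suff -> : mk (s^~ p.1) (t^~ p.2) = f (mk p.1 p.2) by [].
rewrite -[RHS]mkK; congr mk; apply/funext => i.
  by rewrite (hs i).2 zcK.
by rewrite (ht i).2 rcK.
Qed.

Lemma term_id : term (fun x : T => x).
Proof. by split=> i; exists (fun x => x i) => //; left; exists i. Qed.

Lemma term_const (c : U) : term (fun x : T => c).
Proof.
split=> i; first by exists (fun _ => zc c i) => //; right; exists (zc c i).
by exists (fun _ => rc c i) => //; right; exists (rc c i).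
Qed.

Lemma term_fst (f : T -> U * W) : term f -> term (fun x => (f x).1).
Proof. by move=> [hz hr]; split=> i; [have := hz (inl i)|have := hr (inl i)]. Qed.

Lemma term_snd (f : T -> U * W) : term f -> term (fun x => (f x).2).
Proof. by move=> [hz hr]; split=> i; [have := hz (inr i)|have := hr (inr i)]. Qed.

Lemma term_pair (f : T -> U) (g : T -> W) : term f -> term g -> term (fun x => (f x, g x)).
Proof.
move=> [fz fr] [gz gr]; split; case=> i; [exact: fz|exact: gz|exact: fr|exact: gr].
Qed.

Lemma term_app (J : finType) (f : T -> J -> R) j : term f -> term (fun x => f x j).
Proof. by move=> [_ h]; split=> i; [case: i|apply: h]. Qed.

Lemma term_lam (J : finType) (f : T -> J -> R) :
  (forall j, term (fun x => f x j)) -> term f.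
Proof. by move=> h; split=> i; [case: i|case: (h i) => _ /(_ tt)]. Qed.

Lemma term_rc (f : T -> U) j : term f -> term (fun x => rc (f x) j).
Proof. by move=> [_ h]; split=> i; [case: i|apply: h]. Qed.

Lemma term_zc (f : T -> U) : term f -> term (fun x => zc (f x)).
Proof. by move=> [h _]; split=> i; [apply: h|case: i]. Qed.

End Closure.

Lemma def_all (T U : Type) (dT : dty T) (dU : dty U) (Q : T -> U -> Prop) :
  Def (fun p => Q p.1 p.2) -> Def (fun x => forall y, Q x y).
Proof.
move=> DQ; have D := def_not (def_ex (Q := fun x y => ~ Q x y) (def_not DQ)).
apply: (def_ext D) => x; split=> [h y|h []//].
by apply: contrapT => n; apply: h; exists y.
Qed.

Lemma term_comp (T U W : Type) (dT : dty T) (dU : dty U) (dW : dty W)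
    (f : T -> U) (g : U -> W) : term g -> term f -> term (fun x => g (f x)).
Proof.
move=> [gz gr] [fz fr]; split=> i.
  have [_ [[j ->]|[c ->]] hg] := gz i; last by exists (fun _ => c) => //; right; exists c.
  by have [s hs hf] := fz j; exists s => // t; rewrite hg hf.
have [_ [[j ->]|[c ->]] hg] := gr i; last by exists (fun _ => c) => //; right; exists c.
by have [s hs hf] := fr j; exists s => // t; rewrite hg hf.
Qed.

Section Atoms.
Context {T U : Type} {dT : dty T} {dU : dty U}.

Lemma def_eq (f g : T -> U) : term f -> term g -> Def (fun x => f x = g x).
Proof.
move=> hf hg.
have D : Def (fun p : U * U => p.1 = p.2); last first.
  exact: (def_term D (term_pair hf hg)).
pose proof (DefZR_rect (D_all HZ (fun i : zi U => D_eqv HZ (inl i : zi U + zi U) (inr i)))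
  (D_all DR_structure (fun i : ri U => D_eqv DR_structure (inl i : ri U + ri U) (inr i)))) as D.
apply: (DefZR_ext D) => -[u v] /=; split=> [[hz hr]|e].
  by congr mk; apply/funext => i /=.
split=> i.
  by have := congr1 (fun t => zc t i) e; rewrite !zcK.
by have := congr1 (fun t => rc t i) e; rewrite !rcK.
Qed.

Lemma def_lt (f g : T -> R) : term f -> term g -> Def (fun x => f x < g x).
Proof.
move=> hf hg.
have D : Def (fun p : R * R => p.1 < p.2); last first.
  exact: (def_term D (term_pair hf hg)).
have D : DR (fun x : 'I_2 -> R => x ord0 < x ord_max) by case: HR => -[].
have D' := D_pre DR_structure (fun i : 'I_2 => if i == ord0 then inl tt : unit + unit else inr tt) D.
by apply: (DefZR_ext (DefZR_rect (D_true HZ _) D')) => p; split=> [[]|].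
Qed.

Lemma def_andb (f g : T -> bool) :
  Def (fun x => f x) -> Def (fun x => g x) -> Def (fun x => f x && g x).
Proof. by move=> Df Dg; apply: (def_ext (def_and Df Dg)) => x; split=> [[-> ->]|/andP]. Qed.

Lemma def_allfin (K : finType) (A : K -> T -> Prop) :
  (forall k, Def (A k)) -> Def (fun x => forall k, A k x).
Proof.
move=> DA; have D : Def (fun x => forall k, k \in enum K -> A k x); last first.
  by apply: (def_ext D) => x; split=> h k; [apply: h; rewrite mem_enum|].
elim: (enum K) => [|k s IH]; first by apply: (def_ext (def_T True)).
apply: (def_ext (def_and (DA k) IH)) => x; split=> [[h1 h2] k'|h].
  by rewrite in_cons => /orP[/eqP->|/h2].
by split=> [|k' k's]; apply: h; rewrite in_cons ?eqxx ?k's ?orbT.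
Qed.

Lemma def_exfin (K : finType) (A : K -> T -> Prop) :
  (forall k, Def (A k)) -> Def (fun x => exists k, A k x).
Proof.
move=> DA; apply: (def_ext (def_not (def_allfin (fun k => def_not (DA k))))) => x.
by split=> [/existsNP[k /contrapT]|[k Ak] /(_ k)]; [exists k|].
Qed.

End Atoms.

(** * Definable functions *)

Definition dfn T U {dT : dty T} {dU : dty U} (f : T -> U) :=
  Def (fun p : T * U => p.2 = f p.1).

Section Dfn.
Context {T U W : Type} {dT : dty T} {dU : dty U} {dW : dty W}.

Lemma def_fun (A : U -> Prop) (f : T -> U) : Def A -> dfn f -> Def (fun x => A (f x)).
Proof.
move=> DA Df.
have D : Def (fun x => exists u, u = f x /\ A u).
  apply: (def_ex (Q := fun x u => u = f x /\ A u)); apply: def_and; first exact: Df.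
  exact: (def_term DA (term_snd term_id)).
by apply: (def_ext D) => x; split=> [[u [->]]|h] //; exists (f x).
Qed.

Lemma dfn_term (f : T -> U) : term f -> dfn f.
Proof.
move=> hf; apply: def_eq; first exact: term_snd term_id.
exact: (term_comp hf (term_fst term_id)).
Qed.

End Dfn.
Section Dfn1.
Context {T U W : Type} {dT : dty T} {dU : dty U} {dW : dty W}.

Lemma dfn_id : dfn (fun x : T => x).
Proof. by apply: dfn_term; apply: term_id. Qed.

Lemma dfn_const (c : U) : dfn (fun x : T => c).
Proof. by apply: dfn_term; apply: term_const. Qed.

End Dfn1.

Lemma dfn_comp T U W (dT : dty T) (dU : dty U) (dW : dty W) (f : T -> U) (g : U -> W) :
  dfn g -> dfn f -> dfn (fun x => g (f x)).
Proof.
move=> Dg Df.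
have D : Def (fun p : T * W => exists u, u = f p.1 /\ p.2 = g u).
  apply: (def_ex (Q := fun p u => u = f p.1 /\ p.2 = g u)); apply: def_and.
    apply: (def_term (A := fun p : T * U => p.2 = f p.1) (f := fun q : T * W * U => (q.1.1, q.2))) => //.
    exact: term_pair (term_fst (term_fst term_id)) (term_snd term_id).
  apply: (def_term (A := fun p : U * W => p.2 = g p.1) (f := fun q : T * W * U => (q.2, q.1.2))) => //.
  exact: term_pair (term_snd term_id) (term_snd (term_fst term_id)).
by apply: (def_ext D) => x; split=> [[u [->]]|h] //; exists (f x.1).
Qed.

Section Dfn2.
Context {T U W : Type} {dT : dty T} {dU : dty U} {dW : dty W}.

Lemma dfn_pair (f : T -> U) (g : T -> W) : dfn f -> dfn g -> dfn (fun x => (f x, g x)).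
Proof.
move=> Df Dg.
have D1 : Def (fun p : T * (U * W) => p.2.1 = f p.1).
  apply: (def_term (A := fun p : T * U => p.2 = f p.1) (f := fun q : T * (U * W) => (q.1, q.2.1))) => //.
  exact: term_pair (term_fst term_id) (term_fst (term_snd term_id)).
have D2' : Def (fun p : T * (U * W) => p.2.2 = g p.1).
  apply: (def_term (A := fun p : T * W => p.2 = g p.1) (f := fun q : T * (U * W) => (q.1, q.2.2))) => //.
  exact: term_pair (term_fst term_id) (term_snd (term_snd term_id)).
apply: (def_ext (def_and D1 D2')) => -[t [u w]] /=.
by split=> [[-> ->]|[-> ->]].
Qed.

End Dfn2.

Section Dfn3.
Context {T U W : Type} {dT : dty T} {dU : dty U} {dW : dty W}.

Lemma dfn_fst (f : T -> U * W) : dfn f -> dfn (fun x => (f x).1).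
Proof. by apply: (dfn_comp (g := fst)); apply: dfn_term; apply: term_fst; apply: term_id. Qed.

Lemma dfn_snd (f : T -> U * W) : dfn f -> dfn (fun x => (f x).2).
Proof. by apply: (dfn_comp (g := snd)); apply: dfn_term; apply: term_snd; apply: term_id. Qed.

Lemma dfn_app (J : finType) (f : T -> J -> R) j : dfn f -> dfn (fun x => f x j).
Proof. by apply: (dfn_comp (g := fun u => u j)); apply: dfn_term; exact (term_app j term_id). Qed.

Lemma dfn_rc (f : T -> U) j : dfn f -> dfn (fun x => rc (f x) j).
Proof. by apply: (dfn_comp (g := fun u => rc u j)); apply: dfn_term; exact (term_rc j term_id). Qed.

Lemma dfn_zc (f : T -> U) : dfn f -> dfn (fun x => zc (f x)).
Proof. by apply: (dfn_comp (g := fun u => zc u)); apply: dfn_term; exact (term_zc term_id). Qed.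

Lemma dfn_lam (J : finType) (f : T -> J -> R) :
  (forall j, dfn (fun x => f x j)) -> dfn f.
Proof.
move=> h.
have D : Def (fun p : T * (J -> R) => forall j, p.2 j = f p.1 j).
  apply: def_allfin => j.
  apply: (def_term (A := fun p : T * R => p.2 = f p.1 j) (f := fun q : T * (J -> R) => (q.1, q.2 j))).
    exact: h.
  exact: term_pair (term_fst term_id) (term_app _ (term_snd term_id)).
by apply: (def_ext D) => -[x y] /=; split=> [?|-> //]; apply/funext.
Qed.

Lemma def_feq (f g : T -> U) : dfn f -> dfn g -> Def (fun x => f x = g x).
Proof.
move=> Df Dg; apply: (def_fun (A := fun p : U * U => p.1 = p.2) (f := fun x => (f x, g x))).
  exact: def_eq (term_fst term_id) (term_snd term_id).
exact: dfn_pair.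
Qed.

Lemma def_flt (f g : T -> R) : dfn f -> dfn g -> Def (fun x => f x < g x).
Proof.
move=> Df Dg; apply: (def_fun (A := fun p : R * R => p.1 < p.2) (f := fun x => (f x, g x))).
  exact: def_lt (term_fst term_id) (term_snd term_id).
exact: dfn_pair.
Qed.

Lemma def_fle (f g : T -> R) : dfn f -> dfn g -> Def (fun x => f x <= g x).
Proof.
move=> Df Dg; apply: (def_ext (def_not (def_flt Dg Df))) => x.
by rewrite leNgt; split=> /negP.
Qed.

End Dfn3.

(** * Automatic proofs of definability *)

Ltac dfn_app_tac :=
  lazymatch goal with |- @dfn ?A _ _ _ ?F =>
    let h := constr:(fun x : A => ltac:(let b := eval cbv beta in (F x) in
      lazymatch b with ?h ?j => exact h end)) in
    let k := constr:(fun x : A => ltac:(let b := eval cbv beta in (F x) in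
      lazymatch b with ?h ?j => exact j end)) in
    lazymatch k with (fun _ => ?j) => refine (@dfn_app _ _ _ h j _) end
  end.

(* Hypotheses are matched syntactically because [assumption] would unfold [Def] while unifying. *)
Ltac dfn_auto := solve [ repeat (cbv beta; first
 [ match goal with H : dfn ?f |- dfn ?f => exact H end
 | exact dfn_id
 | exact (dfn_const _)
 | lazymatch goal with
   | |- dfn (fun x => (@?f x, @?g x)) => refine (@dfn_pair _ _ _ _ _ _ f g _ _)
   | |- dfn (fun x => fst (@?f x)) => refine (@dfn_fst _ _ _ _ _ _ f _)
   | |- dfn (fun x => snd (@?f x)) => refine (@dfn_snd _ _ _ _ _ _ f _)
   | |- dfn (fun x => rc (@?f x) ?j) => refine (@dfn_rc _ _ _ _ f j _)
   | |- dfn (fun x => zc (@?f x)) => refine (@dfn_zc _ _ _ _ f _)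
   | |- dfn (fun x j => @?f x j) => refine (@dfn_lam _ _ _ f _); intro
   end
 | dfn_app_tac
 | lazymatch goal with
   | |- dfn (fun x => ?g (@?f x)) => refine (@dfn_comp _ _ _ _ _ _ f g _ _);
      [match goal with H : dfn ?f |- dfn ?f => exact H end|]
   end
 | lazymatch goal with
   | |- dfn (fun x => ?g (@?f1 x) (@?f2 x)) =>
      refine (@dfn_comp _ _ _ _ _ _ (fun x => (f1 x, f2 x)) (fun p => g p.1 p.2) _ _);
      [match goal with H : dfn ?f |- dfn ?f => exact H end|]
   end ] ) ].

(** An extension point, redefined with [::=] once [nb], [contX], [cont], [dimS] and [dimge] are
    known to be definable in parameters. *)
Ltac df_hook := fail.

Ltac df_imp := lazymatch goal with |- Def (fun x => @?A x -> @?B x) =>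
  refine (@def_imp _ _ A B _ _) end.

Ltac df_all := lazymatch goal with |- Def (fun x => forall y, @?Q x y) =>
  first [ refine (@def_allfin _ _ _ (fun k x => Q x k) _); intro | refine (@def_all _ _ _ _ Q _) ] end.

Ltac def_auto := cbv beta; first [ match goal with H : Def ?A |- Def ?A => exact H end | df_hook | exact (def_T _)
 | df_imp; def_auto | df_all; def_auto |
 lazymatch goal with
 | |- Def (fun x => @?A x /\ @?B x) => refine (@def_and _ _ A B _ _); def_auto
 | |- Def (fun x => @?A x \/ @?B x) => refine (@def_or _ _ A B _ _); def_auto
 | |- Def (fun x => ~ @?A x) => refine (@def_not _ _ A _); def_auto
 | |- Def (fun x => @?A x <-> @?B x) => refine (@def_iff _ _ A B _ _); def_auto
 | |- Def (fun x => exists y, @?Q x y) =>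
    first [ refine (@def_exfin _ _ _ (fun k x => Q x k) _); intro | refine (@def_ex _ _ _ _ Q _) ]; def_auto
 | |- Def (fun x => exists2 y, @?P x y & @?Q x y) =>
    refine (@def_ext _ _ (fun x => exists y, P x y /\ Q x y) _ _ _);
    [ def_auto | intro; split; [intros [? [? ?]]; eexists; eassumption|intros [? ? ?]; eexists; split; eassumption]]
 | |- Def (fun x => is_true (@?f x && @?g x)) => refine (@def_andb _ _ f g _ _); def_auto
 | |- Def (fun x => is_true (Order.lt (@?f x) (@?g x))) => refine (@def_flt _ _ f g _ _); dfn_auto
 | |- Def (fun x => is_true (Order.le (@?f x) (@?g x))) => refine (@def_fle _ _ f g _ _); dfn_auto
 | |- Def (fun x => @?f x = @?g x) => refine (@def_feq _ _ _ _ f g _ _); dfn_auto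
 end
 | lazymatch goal with
   | |- Def (fun x => ?A (@?f x)) => refine (@def_fun _ _ _ _ A f _ _); [def_auto | dfn_auto]
   end
 | lazymatch goal with
   | |- Def (fun x => ?A (@?f x) (@?g x)) =>
     refine (@def_fun _ _ _ _ (fun p => A p.1 p.2) (fun x => (f x, g x)) _ _); [def_auto | dfn_auto]
   end ].

(** * Neighbourhoods and continuity *)

Lemma Rdense (x y : R) : x < y -> exists z, x < z < y.
Proof. by case: HR => _ _ h _ _ /h [z [? ?]]; exists z; apply/andP. Qed.

Lemma Rlow (x : R) : exists y, y < x.
Proof. by case: HR => _ _ _ /(_ x)[]. Qed.

Lemma Rup (x : R) : exists y, x < y.
Proof. by case: HR => _ _ _ /(_ x)[]. Qed.

(** The order topology on the [R]-coordinates times the discrete one on the [Z]-coordinates. The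
    corners range over a power of [R], so the condition is first-order in [x] and in the parameters
    of [N]. *)
Definition nb T {dT : dty T} (x : T) (N : T -> Prop) : Prop :=
  exists a b : ri T -> R, (forall j, a j < rc x j < b j) /\
    forall y, zc y = zc x -> (forall j, a j < rc y j < b j) -> N y.

Section Nb.
Context {T : Type} {dT : dty T}.
Implicit Types (x : T) (N : T -> Prop).

Lemma nb_self x N : nb x N -> N x.
Proof. by case=> a [b [h1 h2]]; apply: h2. Qed.

Lemma nb_mono x N N' : nb x N -> (forall y, N y -> N' y) -> nb x N'.
Proof. by case=> a [b [h1 h2]] h; exists a, b; split=> // y h3 h4; apply/h/h2. Qed.

Lemma nb_T x : nb x (fun _ => True).
Proof.
have [a ha] := choice (fun j => Rlow (rc x j)).
have [b hb] := choice (fun j => Rup (rc x j)).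
by exists a, b; split=> // j; rewrite ha hb.
Qed.

Lemma nb_and x N N' : nb x N -> nb x N' -> nb x (fun y => N y /\ N' y).
Proof.
move=> [a [b [h1 h2]]] [a' [b' [h1' h2']]].
exists (fun j => Order.max (a j) (a' j)), (fun j => Order.min (b j) (b' j)); split=> [j|y hz hy].
  by rewrite gt_max lt_min; have /andP[-> ->] := h1 j; have /andP[-> ->] := h1' j.
split; [apply: h2|apply: h2'] => // j; have := hy j; rewrite gt_max lt_min.
  by move=> /andP[/andP[-> _] /andP[-> _]].
by move=> /andP[/andP[_ ->] /andP[_ ->]].
Qed.

Lemma nb_all (K : finType) x (N : K -> T -> Prop) :
  (forall k, nb x (N k)) -> nb x (fun y => forall k, N k y).
Proof.
move=> h; have h' : nb x (fun y => forall k, k \in enum K -> N k y).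
  elim: (enum K) => [|k s IH]; first by apply: (nb_mono (nb_T x)).
  apply: (nb_mono (nb_and (h k) IH)) => y [h1 h2] k'.
  by rewrite in_cons => /orP[/eqP->|/h2].
by apply: (nb_mono h') => y + k; apply; rewrite mem_enum.
Qed.

Lemma nb_open x N : nb x N -> nb x (fun y => nb y N).
Proof.
move=> [a [b [h1 h2]]]; exists a, b; split=> // y hy h; exists a, b; split=> // y' hy'.
by apply: h2; rewrite hy'.
Qed.

Lemma nb_zc x : nb x (fun y => zc y = zc x).
Proof. by have [a [b [h1 h2]]] := nb_T x; exists a, b. Qed.

Lemma nb_rc x j (a b : R) : a < rc x j < b -> nb x (fun y => a < rc y j < b).
Proof.
have [u [v [h1 h2]]] := nb_T x; move=> h.
exists (fun i => if i == j then a else u i), (fun i => if i == j then b else v i); split.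
  by move=> i; case: eqP => [->|].
by move=> y _ /(_ j); rewrite eqxx.
Qed.

Definition big (A : T -> Prop) := exists x, nb x A.

Lemma big_mono (A B : T -> Prop) : big A -> (forall x, A x -> B x) -> big B.
Proof. by move=> [x /nb_mono h] /h; exists x. Qed.

End Nb.

Lemma nbR (x : R) N : nb x N <-> exists a b, a < x < b /\ forall y, a < y < b -> N y.
Proof.
split=> [[a [b [/= h1 h2]]]|[a [b [h1 h2]]]].
  exists (a tt), (b tt); split=> [|y hy]; first exact: h1.
  by apply: h2; [apply: void_fun|case].
by exists (fun _ => a), (fun _ => b); split=> // y _ /(_ tt); apply: h2.
Qed.

Lemma nb_itv (a b x : R) : a < x < b -> nb x (fun y => a < y < b).
Proof. by move=> h; apply/nbR; exists a, b. Qed.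

Definition contX T U {dT : dty T} {dU : dty U} (X : T -> Prop) (f : T -> U) (x : T) :=
  forall N, nb (f x) N -> nb x (fun y => X y -> N (f y)).

Definition cont T U {dT : dty T} {dU : dty U} (f : T -> U) (x : T) :=
  forall N, nb (f x) N -> nb x (fun y => N (f y)).

Section Cont.
Context {T U W : Type} {dT : dty T} {dU : dty U} {dW : dty W}.

(** [contX] quantifies over arbitrary sets [N]; with boxes in their place continuity becomes a
    first-order condition, which is what [def_contX] needs. *)
Lemma contXE (X : T -> Prop) (f : T -> U) x : contX X f x <->
  forall a b : ri U -> R, (forall j, a j < rc (f x) j < b j) ->
  nb x (fun y => X y -> zc (f y) = zc (f x) /\ forall j, a j < rc (f y) j < b j).
Proof.
split=> [h a b hab|h N [a [b [hab hN]]]].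
  by apply: (h (fun z => zc z = zc (f x) /\ forall j, a j < rc z j < b j)); exists a, b.
by apply: (nb_mono (h _ _ hab)) => y hy Xy; have [? ?] := hy Xy; apply: hN.
Qed.

Lemma cont_coord (f : T -> U) x : nb x (fun y => zc (f y) = zc (f x)) ->
  (forall j, cont (fun y => rc (f y) j) x) -> cont f x.
Proof.
move=> hz hr N [a [b [hab hN]]].
have h j : nb x (fun y => a j < rc (f y) j < b j) by apply: (hr j (fun r => a j < r < b j)); apply: nb_itv.
by apply: (nb_mono (nb_and hz (nb_all h))) => y []; apply: hN.
Qed.

Lemma nb_pair (x : T) (y : U) N : nb (x, y) N <->
  exists N1 N2, [/\ nb x N1, nb y N2 & forall u v, N1 u -> N2 v -> N (u, v)].
Proof.
split=> [[a [b [h1 h2]]]|[N1 [N2 [[a [b [h1 h2]]] [a' [b' [h1' h2']]] h]]]].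
  exists (fun u => zc u = zc x /\ forall j, a (inl j) < rc u j < b (inl j)),
         (fun u => zc u = zc y /\ forall j, a (inr j) < rc u j < b (inr j)); split.
  - by exists (fun j => a (inl j)), (fun j => b (inl j)); split=> // j; apply: (h1 (inl j)).
  - by exists (fun j => a (inr j)), (fun j => b (inr j)); split=> // j; apply: (h1 (inr j)).
  - move=> u v [hu1 hu2] [hv1 hv2]; apply: h2; last by case.
    by apply/funext; case=> i /=; rewrite ?hu1 ?hv1.
exists (fun j => match j with inl j => a j | inr j => a' j end),
       (fun j => match j with inl j => b j | inr j => b' j end); split; first by case.
move=> [u v] hz hr; apply: h.
  apply: h2; last by move=> j; apply: (hr (inl j)).
  by apply/funext => i; have := congr1 (fun f => f (inl i)) hz.
apply: h2'; last by move=> j; apply: (hr (inr j)).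
by apply/funext => i; have := congr1 (fun f => f (inr i)) hz.
Qed.

End Cont.

Lemma def_nb T U (dT : dty T) (dU : dty U) (g : T -> U) (N : T -> U -> Prop) :
  dfn g -> Def (fun p => N p.1 p.2) -> Def (fun x => nb (g x) (N x)).
Proof. by move=> Dg DN; rewrite /nb; def_auto. Qed.

Ltac df_hook ::=
  lazymatch goal with
  | |- Def (fun x => nb (@?g x) (@?N x)) => refine (@def_nb _ _ _ _ g N _ _); [dfn_auto | def_auto]
  end.

Lemma def_contX V T U (dV : dty V) (dT : dty T) (dU : dty U)
  (X : V -> T -> Prop) (f : V -> T -> U) (g : V -> T) :
  dfn g -> Def (fun p => X p.1 p.2) -> dfn (fun p => f p.1 p.2) ->
  Def (fun v => contX (X v) (f v) (g v)).
Proof.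
move=> Dg DX Df; apply: (def_ext _ (fun v => iff_sym (contXE (X v) (f v) (g v)))).
def_auto.
Qed.

Lemma contXT T U (dT : dty T) (dU : dty U) (f : T -> U) x :
  cont f x <-> contX (fun _ => True) f x.
Proof.
by split=> h N hN; apply: (nb_mono (h N hN)) => y; auto.
Qed.

Lemma def_cont V T U (dV : dty V) (dT : dty T) (dU : dty U)
  (f : V -> T -> U) (g : V -> T) :
  dfn g -> dfn (fun p => f p.1 p.2) -> Def (fun v => cont (f v) (g v)).
Proof.
move=> Dg Df; have D : Def (fun v => contX (fun _ => True) (f v) (g v)).
  by apply: (def_contX (X := fun _ _ => True)) => //; def_auto.
by apply: (def_ext D) => v; rewrite contXT.
Qed.

Ltac df_hook ::=
  lazymatch goal with
  | |- Def (fun x => nb (@?g x) (@?N x)) => refine (@def_nb _ _ _ _ g N _ _); [dfn_auto | def_auto]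
  | |- Def (fun x => contX (@?X x) (@?f x) (@?g x)) =>
    refine (@def_contX _ _ _ _ _ _ X f g _ _ _); [dfn_auto | def_auto | dfn_auto]
  | |- Def (fun x => cont (@?f x) (@?g x)) => refine (@def_cont _ _ _ _ _ _ f g _ _); dfn_auto
  | |- Def (fun x => big (@?N x)) => rewrite /big; def_auto
  end.

(** * Definable subsets of the line *)

Lemma def_slice (I J : finType) (X : (I -> Z) * (J -> R) -> Prop) (z : I -> Z) :
  DZR X -> DR (fun r => X (z, r)).
Proof.
move=> [k [U [V [h hX]]]].
have D : DR (fun r => forall i, ~ (U i z /\ V i r)).
  apply: (D_all DR_structure) => i; apply: (D_not DR_structure); apply: (D_and DR_structure); last by case: (h i).
  have [Uz|nUz] := pselect (U i z); first by apply: (D_ext (D_true DR_structure _)) => x; split.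
  by apply: (D_ext (D_not DR_structure (D_true DR_structure _))) => x; split=> // /(_ I).
apply: (D_ext (D_not DR_structure D)) => r; rewrite hX; split=> [/existsNP[i /contrapT]|[i hi] /(_ i)//].
by exists i.
Qed.

(** O-minimality as an induction principle. It is applied to dichotomies, such as finite or with
    interior, because a disjunction of this kind passes to unions where one alternative alone would
    not decide enough. *)
Lemma tame_ind (Phi : (R -> Prop) -> Prop) :
  (forall A B, (forall x, A x <-> B x) -> Phi A -> Phi B) ->
  Phi (fun _ => False) -> (forall A B, Phi A -> Phi B -> Phi (fun x => A x \/ B x)) ->
  (forall c, Phi (fun x => x = c)) -> (forall iv, Phi (fun x => in_oitv iv x)) ->
  forall A, Def A -> Phi A.
Proof.
move=> hE h0 hU hp hi A DA.
case: HR => _ _ _ _ /(_ (fun x => A (x ord0))) [].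
  have D := D_pre DR_structure (fun _ : unit => ord0 : 'I_1) (def_slice (@of_void Z) DA).
  exact: (D_ext D).
move=> ps [ivs h]; apply: (hE _ _ (fun x => iff_sym (h x))) => {h}.
have h1 : Phi (fun x => x \in ps).
  elim: ps => [|c ps IH]; first by apply: (hE _ _ _ h0).
  apply: (hE _ _ _ (hU _ _ (hp c) IH)) => x; rewrite in_cons.
  by split=> [[/eqP->|->]|/orP[/eqP|]]; rewrite ?orbT; auto.
have h2 : Phi (fun x => has (fun iv => in_oitv iv x) ivs).
  elim: ivs => [|c ivs IH]; first by apply: (hE _ _ _ h0).
  apply: (hE _ _ _ (hU _ _ (hi c) IH)) => x /=.
  by split=> [[->|->]|/orP[]]; rewrite ?orbT; auto.
by apply: (hE _ _ _ (hU _ _ h1 h2)) => x; split=> [[->|->]|/orP]; rewrite ?orbT.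
Qed.

(** A definable set is decided on a small interval to the right of every point: this holds for
    points and intervals, and a union contains the germ as soon as one of its members does. *)
Lemma germ_right (A : R -> Prop) c : Def A ->
  (exists d, c < d /\ forall x, c < x -> x < d -> A x) \/
  (exists d, c < d /\ forall x, c < x -> x < d -> ~ A x).
Proof.
move: A; apply: tame_ind => [A B AB []||A B|a|[oa ob]].
- by move=> [d [cd h]]; left; exists d; split=> // x h1 h2; apply/AB/h.
- by move=> [d [cd h]]; right; exists d; split=> // x h1 h2 /AB; apply: h.
- by have [d cd] := Rup c; right; exists d; split=> // ? ? ? [].
- move=> [[d [cd h]] _|[d [cd h]] []].
  + by left; exists d; split=> // x h1 h2; left; apply: h.
  + by move=> [e [ce h']]; left; exists e; split=> // x h1 h2; right; apply: h'.
  + move=> [e [ce h']]; right; exists (Order.min d e); rewrite lt_min cd ce; split=> // x cx.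
    by rewrite lt_min => /andP[xd xe] [/(h _ cx xd)|/(h' _ cx xe)].
- right; have [ca|ac] := ltP c a.
    by exists a; split=> // x _ xa e; rewrite e ltxx in xa.
  have [d cd] := Rup c; exists d; split=> // x cx _ xa.
  by rewrite xa ltNge ac in cx.
- case: (boolP (if oa is Some a then a <= c else true)) => ha; last first.
    case: oa ha => // a; rewrite -ltNge => ca; right; exists a; split=> // x _ xa.
    by rewrite /in_oitv /= => /andP[/(lt_trans xa)]; rewrite ltxx.
  have ha' x : c < x -> if oa is Some a then a < x else true.
    by case: oa ha => // a; apply: le_lt_trans.
  case: ob => [b|]; last first.
    by have [d cd] := Rup c; left; exists d; split=> // x cx _; rewrite /in_oitv /= ha'.
  have [cb|bc] := ltP c b.
    by left; exists b; split=> // x cx xb; rewrite /in_oitv /= ha'.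
  have [d cd] := Rup c; right; exists d; split=> // x cx _.
  by rewrite /in_oitv /= => /andP[_ /(lt_trans cx)]; rewrite ltNge bc.
Qed.

Lemma germ_left (A : R -> Prop) c : Def A ->
  (exists d, d < c /\ forall x, d < x -> x < c -> A x) \/
  (exists d, d < c /\ forall x, d < x -> x < c -> ~ A x).
Proof.
move: A; apply: tame_ind => [A B AB []||A B|a|[oa ob]].
- by move=> [d [cd h]]; left; exists d; split=> // x h1 h2; apply/AB/h.
- by move=> [d [cd h]]; right; exists d; split=> // x h1 h2 /AB; apply: h.
- by have [d cd] := Rlow c; right; exists d; split=> // ? ? ? [].
- move=> [[d [cd h]] _|[d [cd h]] []].
  + by left; exists d; split=> // x h1 h2; left; apply: h.
  + by move=> [e [ce h']]; left; exists e; split=> // x h1 h2; right; apply: h'.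
  + move=> [e [ce h']]; right; exists (Order.max d e); rewrite gt_max cd ce; split=> // x + cx.
    by rewrite gt_max => /andP[xd xe] [/(h _ xd cx)|/(h' _ xe cx)].
- right; have [ac|ca] := ltP a c.
    by exists a; split=> // x ax _ e; rewrite e ltxx in ax.
  have [d cd] := Rlow c; exists d; split=> // x _ cx xa.
  by rewrite xa ltNge ca in cx.
- case: (boolP (if ob is Some b then c <= b else true)) => hb; last first.
    case: ob hb => // b; rewrite -ltNge => bc; right; exists b; split=> // x bx _.
    by rewrite /in_oitv /= => /andP[_ /(lt_trans bx)]; rewrite ltxx.
  have hb' x : x < c -> if ob is Some b then x < b else true.
    by case: ob hb => // b + xc; apply: lt_le_trans.
  case: oa => [a|]; last first.
    by have [d cd] := Rlow c; left; exists d; split=> // x _ cx; rewrite /in_oitv /= hb'.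
  have [ac|ca] := ltP a c.
    by left; exists a; split=> // x ax cx; rewrite /in_oitv /= ax hb'.
  have [d cd] := Rlow c; right; exists d; split=> // x _ cx.
  by rewrite /in_oitv /= => /andP[/lt_trans/(_ cx)]; rewrite ltNge ca.
Qed.

Lemma germ_minf (A : R -> Prop) : Def A ->
  (exists d, forall x, x < d -> A x) \/ (exists d, forall x, x < d -> ~ A x).
Proof.
move=> DA; have [x0] : inhabited R by case: HR.
move: DA.
move: A; apply: tame_ind => [A B AB []||A B|a|[oa ob]].
- by move=> [d h]; left; exists d => x h1; apply/AB/h.
- by move=> [d h]; right; exists d => x h1 /AB; apply: h.
- by right; exists x0 => ? ? [].
- move=> [[d h] _|[d h] []].
  + by left; exists d => x h1; left; apply: h.
  + by move=> [e h']; left; exists e => x h1; right; apply: h'.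
  + move=> [e h']; right; exists (Order.min d e) => x.
    by rewrite lt_min => /andP[xd xe] [/(h _ xd)|/(h' _ xe)].
- by right; exists a => x + e; rewrite e ltxx.
- case: oa => [a|].
    by right; exists a => x xa; rewrite /in_oitv /= => /andP[/(lt_trans xa)]; rewrite ltxx.
  case: ob => [b|]; first by left; exists b => x.
  by left; exists x0.
Qed.

Definition fin (A : R -> Prop) := exists s : seq R, forall x, A x -> x \in s.

Lemma fin_or (A B : R -> Prop) : fin A -> fin B -> fin (fun x => A x \/ B x).
Proof.
move=> [s hs] [t ht]; exists (s ++ t) => x; rewrite mem_cat.
by move=> [/hs->|/ht->]; rewrite ?orbT.
Qed.

Lemma fin_mono (A B : R -> Prop) : fin A -> (forall x, B x -> A x) -> fin B.
Proof. by move=> [s hs] h; exists s => x /h/hs. Qed.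

Lemma fin_union (A : R -> Prop) (B : R -> R -> Prop) : fin A -> (forall x, A x -> fin (B x)) ->
  fin (fun y => exists x, A x /\ B x y).
Proof.
move=> [s hs] hB.
have h : fin (fun y => exists x, [/\ x \in s, A x & B x y]).
  elim: s {hs} => [|c s IH]; first by exists [::] => x [y []].
  have hc : fin (fun y => A c /\ B c y).
    have [/hB h|n] := pselect (A c); first by apply: (fin_mono h) => x [].
    by exists [::] => x [].
  apply: (fin_mono (fin_or hc IH)) => y [x []]; rewrite in_cons => /orP[/eqP->|xs] Ax Bx.
    by left.
  by right; exists x.
by apply: (fin_mono h) => y [x [Ax Bx]]; exists x; split=> //; apply: hs.
Qed.

Lemma itv_avoid (s : seq R) a b : a < b ->
  exists c e, [/\ a <= c, e <= b, c < e & forall x, c < x < e -> x \notin s].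
Proof.
elim: s a b => [|h s IH] a b ab; first by exists a, b; split.
have [c [e [ac eb ce hx]]] := IH _ _ ab.
have [/andP[ch he]|n] := boolP (c < h < e).
  exists h, e; split=> //; first exact: le_trans (ltW ch).
  move=> x /andP[hx' xe]; rewrite in_cons (gt_eqF hx') /=.
  by apply: hx; rewrite (lt_trans ch).
exists c, e; split=> // x hx'; rewrite in_cons negb_or hx // andbT.
by apply: contraNneq n => <-.
Qed.

Lemma itv_infinite a b : a < b -> ~ fin (fun x => a < x < b).
Proof.
move=> ab [s hs]; have [c [e [ac eb ce hx]]] := itv_avoid s ab.
have [z hz] := Rdense ce.
suff zs : z \in s by have := hx _ hz; rewrite zs.
by apply: hs; case/andP: hz => h1 h2; rewrite (le_lt_trans ac) ?(lt_le_trans h2).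
Qed.

Lemma bigRP (A : R -> Prop) : big A <-> exists a b, a < b /\ forall x, a < x < b -> A x.
Proof.
split=> [[x /nbR[a [b [/andP[h1 h2] h]]]]|[a [b [/Rdense[x hx] h]]]].
  by exists a, b; split=> //; apply: lt_trans h2.
by exists x; apply/nbR; exists a, b.
Qed.

Lemma big_notfin (A : R -> Prop) : big A -> ~ fin A.
Proof. by move=> /bigRP[a [b [/itv_infinite h hA]]] /fin_mono/(_ hA). Qed.

Lemma fin_or_big (A : R -> Prop) : Def A -> fin A \/ big A.
Proof.
move: A; apply: tame_ind => [A B AB []||A B|a|[oa ob]].
- by move=> h; left; apply: (fin_mono h) => x /AB.
- by move=> h; right; apply: (big_mono h) => x /AB.
- by left; exists [::].
- move=> [hA|hA] [hB|hB]; first by left; apply: fin_or.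
  + by right; apply: (big_mono hB) => x; right.
  + by right; apply: (big_mono hA) => x; left.
  + by right; apply: (big_mono hA) => x; left.
- by left; exists [:: a] => x ->; rewrite inE.
- have [[x hx]|/forallNP n] := pselect (exists x, in_oitv (oa, ob) x); last first.
    by left; exists [::] => x /n.
  right; exists x.
  have h1 : nb x (fun y => if oa is Some a then a < y else true).
    case: oa hx => [a|] hx; last exact: (nb_mono (nb_T x)).
    have [c xc] := Rup x; apply: (nb_mono (@nb_itv a c x _)) => [|y /andP[]//].
    by rewrite xc andbT; case/andP: hx.
  have h2 : nb x (fun y => if ob is Some a then y < a else true).
    case: ob hx => [a|] hx; last exact: (nb_mono (nb_T x)).
    have [c xc] := Rlow x; apply: (nb_mono (@nb_itv c a x _)) => [|y /andP[]//].
    by rewrite xc /=; case/andP: hx.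
  by apply: (nb_mono (nb_and h1 h2)) => y [];
    case: (oa) (ob) => [?|] [?|] /= h3 h4; rewrite /in_oitv /= ?h3 ?h4.
Qed.

Lemma big_orR (A B : R -> Prop) : Def A -> Def B -> big (fun x => A x \/ B x) -> big A \/ big B.
Proof.
move=> DA DB h; have [fA|] := fin_or_big DA; last by left.
have [fB|] := fin_or_big DB; last by right.
by have := big_notfin h (fin_or fA fB).
Qed.

Definition lub (A : R -> Prop) s :=
  (forall x, A x -> x <= s) /\ forall t, t < s -> exists x, A x /\ t < x.
Definition glb (A : R -> Prop) s :=
  (forall x, A x -> s <= x) /\ forall t, s < t -> exists x, A x /\ x < t.

(** Definable completeness. The order of [R] need not be complete, but suprema of points and
    intervals are visible and a union takes the larger one. *)
Lemma lub_cases (A : R -> Prop) : Def A ->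
  [\/ forall x, ~ A x, forall x, exists y, A y /\ x < y | exists s, lub A s].
Proof.
move: A; apply: tame_ind => [A B AB []||A B|a|[oa ob]].
- by move=> h; apply: Or31 => x /AB; apply: h.
- by move=> h; apply: Or32 => x; have [y [/AB ? ?]] := h x; exists y.
- move=> [s [h1 h2]]; apply: Or33; exists s; split=> [x /AB/h1//|t /h2[x [/AB ? ?]]].
  by exists x.
- by apply: Or31 => ? [].
- move=> [hA|hA|[s [h1 h2]]].
  + case=> [hB|hB|[s [h1 h2]]].
    * by apply: Or31 => x [/hA|/hB].
    * by apply: Or32 => x; have [y []] := hB x; exists y; auto.
    * apply: Or33; exists s; split=> [x [/hA|/h1]//|t /h2[x [? ?]]].
      by exists x; auto.
  + by move=> _; apply: Or32 => x; have [y []] := hA x; exists y; auto.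
  + case=> [hB|hB|[s' [h1' h2']]].
    * by apply: Or33; exists s; split=> [x [/h1|/hB]//|t /h2[x [? ?]]]; exists x; auto.
    * by apply: Or32 => x; have [y []] := hB x; exists y; auto.
    * apply: Or33; exists (Order.max s s'); split=> [x [/h1|/h1'] h|t].
      - by rewrite le_max h.
      - by rewrite le_max h orbT.
      by rewrite lt_max => /orP[/h2|/h2'] [x [? ?]]; exists x; auto.
- apply: Or33; exists a; split=> [x ->//|t ta]; by exists a.
- have [[r hr]|/forallNP n] := pselect (exists x, in_oitv (oa, ob) x); last exact: Or31.
  case: ob hr => [b|] /andP[/= ha hb]; last first.
    apply: Or32 => x; have [y xy] := Rup (Order.max x r); exists y; move: xy.
    rewrite gt_max => /andP[xy ry]; split=> //; rewrite /in_oitv /= andbT.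
    by case: (oa) ha => // a /lt_trans; apply.
  apply: Or33; exists b; split=> [x /andP[_ /ltW]//|t tb].
  have [|z /andP[hz1 hz2]] := @Rdense (Order.max t r) b; first by rewrite gt_max tb.
  move: hz1; rewrite gt_max => /andP[tz rz]; exists z; split=> //; rewrite /in_oitv /= hz2 andbT.
  by case: (oa) ha => // a /lt_trans; apply.
Qed.

(** The infimum is the supremum of the set of lower bounds. The degenerate cases cross over: no
    lower bound means unbounded below, and arbitrarily large lower bounds mean that [A] is empty. *)
Lemma glb_cases (A : R -> Prop) : Def A ->
  [\/ forall x, ~ A x, forall x, exists y, A y /\ y < x | exists s, glb A s].
Proof.
move=> DA; have DB : Def (fun x => forall y, A y -> x <= y) by def_auto.
have [hB|hB|[s [h1 h2]]] := lub_cases DB.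
- apply: Or32 => x; have /existsNP[y /not_implyP[Ay /negP]] := hB x.
  by rewrite -ltNge; exists y.
- by apply: Or31 => x Ax; have [y [/(_ _ Ax) yx]] := hB x; rewrite ltNge yx.
- apply: Or33; exists s; split=> [x Ax|t st].
    rewrite leNgt; apply/negP => xs; have [y [/(_ _ Ax) yx]] := h2 _ xs.
    by rewrite ltNge yx.
  apply: contrapT => /forallNP n.
  suff /h1 : forall y, A y -> t <= y by rewrite leNgt st.
  by move=> y Ay; rewrite leNgt; apply/negP => yt; apply: (n y).
Qed.

(** * Monotonicity *)

(* No definable strict order on an interval has every point as a strict local minimum. The
   argument is run in both directions of the interval, whence the abstract order [L]. *)
Section LocalMinima.
Variables (L P : R -> R -> Prop).
Hypotheses (Ltr : forall x y z, L x y -> L y z -> L x z) (Lirr : forall x, ~ L x x)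
  (Ltot : forall x y, x <> y -> L x y \/ L y x)
  (Ldense : forall x y, L x y -> exists z, L x z /\ L z y)
  (DL : Def (fun p => L p.1 p.2))
  (Lgerm : forall A c, Def A ->
     (exists e, L e c /\ forall x, L e x -> L x c -> A x) \/
     (exists e, L e c /\ forall x, L e x -> L x c -> ~ A x))
  (Lglb : forall A m, Def A -> (exists x, A x) -> (forall x, A x -> L m x) ->
     exists s, (forall x, A x -> ~ L x s) /\ forall t, L s t -> exists x, A x /\ L x t)
  (DP : Def (fun p => P p.1 p.2)).

Definition Lmax x y := if pselect (L x y) then y else x.

Lemma Lmax_lt x y z : L x z -> L y z -> L (Lmax x y) z.
Proof. by rewrite /Lmax; case: pselect. Qed.

Lemma lt_Lmax x y z : L (Lmax x y) z -> L x z /\ L y z.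
Proof.
rewrite /Lmax; case: pselect => [xy yz|nxy xz]; split=> //; first exact: Ltr yz.
have [<-//|/Ltot[//|yx]] := pselect (x = y); exact: Ltr xz.
Qed.

Variables a b : R.
Notation I x := (L a x /\ L x b).
Hypotheses (Lab : L a b)
  (Ptr : forall x y z, I x -> I y -> I z -> P x y -> P y z -> P x z)
  (Pasym : forall x y, I x -> I y -> P x y -> ~ P y x)
  (Ptot : forall x y, I x -> I y -> x <> y -> P x y \/ P y x)
  (Pl : forall x, I x -> exists e, L e x /\ forall y, I y -> L e y -> L y x -> P x y)
  (Pr : forall x, I x -> exists e, L x e /\ forall y, I y -> L x y -> L y e -> P x y).

(** Read [P] as a second order in which every point is a local minimum. Near the end [b], each [x]
    has a level [c] that lies below the points just before [x] and above those just after [x]. The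
    reverse direction yields the opposite inequalities, whence the contradiction in
    [no_local_min]. *)
Lemma local_min_separated : exists a', [/\ L a' b, a' = a \/ L a a' &
  forall x, L a' x -> L x b -> exists c, [/\ I c,
    exists e, L e x /\ forall y, L e y -> L y x -> I y -> P c y &
    exists e, L x e /\ forall y, L x y -> L y e -> I y -> P y c]].
Proof.
pose B x := forall y, I y -> L x y -> P x y.
have DB : Def B by rewrite /B; def_auto.
(* If [B] held on a final segment, take there [y] just before [x]: minimality of [x] gives [P x y],
   and [B y] gives [P y x]. *)
have [a1 [a1b nB]] : exists a1, L a1 b /\ forall x, L a1 x -> L x b -> ~ B x.
  have [[e [eb he]]|//] := Lgerm b DB; exfalso.
  have [x [/lt_Lmax[ax ex] xb]] := Ldense (Lmax_lt Lab eb).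
  have [e' [e'x hx]] := Pl (conj ax xb).
  have [y [/lt_Lmax[/lt_Lmax[ay ey] e'y] yx]] := Ldense (Lmax_lt (Lmax_lt ax ex) e'x).
  have yb := Ltr yx xb.
  apply: (@Pasym x y) => //; first exact: hx.
  exact: he.
pose a2 := Lmax a a1; have a2b : L a2 b by apply: Lmax_lt.
(* Every [c] beyond [a2] is below a final segment or above one; the germ at [b] decides which. *)
have key c : L a2 c -> L c b -> exists t, [/\ L c t, L t b & forall y, L t y -> L y b -> P y c].
  move=> /lt_Lmax[ac a1c] cb.
  have DA : Def (fun y => P c y) by def_auto.
  have [[e [eb he]]|[e [eb he]]] := Lgerm b DA; last first.
    have h : L (Lmax c e) b by apply: Lmax_lt.
    have [t [/lt_Lmax[ct et] tb]] := Ldense h.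
    exists t; split=> // y ty yb.
    have cy := Ltr ct ty.
    have [//||e1|h1|//] := @Ptot c y; first by split=> //; apply: Ltr cy.
      by apply: (@Lirr c); rewrite {2}e1.
    by case: (he y (Ltr et ty) yb).
  exfalso.
  pose S t := [/\ L c t, L t b & forall y, L t y -> L y b -> P c y].
  have DS : Def S.
    have D : Def (fun t => L c t /\ (L t b /\ forall y, L t y -> L y b -> P c y)) by def_auto.
    by apply: (def_ext D) => t; split=> [[? []]|[]].
  have S0 : exists t, S t.
    have [t [/lt_Lmax[ct et] tb]] := Ldense (Lmax_lt cb eb).
    by exists t; split=> // y ty; apply: he; apply: Ltr ty.
  have [//|s [h1 h2]] := Lglb (m := c) DS S0 _; first by move=> x [].
  have hs y : L s y -> L y b -> P c y.
    by move=> /h2[t [[_ _ ht] ty]]; apply: ht.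
  have sb : L s b.
    case: S0 => t [ct tb ht]; have [<-//|/Ltot[ts|st]] := pselect (t = s).
      by case: (h1 t (And3 ct tb ht)).
    exact: Ltr tb.
  have [sc|/Ltot[sc|cs]] := pselect (s = c).
  - apply: (nB c) => // y [ay yb] cy; apply: hs => //; by rewrite sc.
  - case: S0 => t [ct tb ht].
    have DT : Def (fun t => L t c) by def_auto.
    have [t' [[ct' _ _] t'c]] := h2 _ sc.
    by apply: (@Lirr c); apply: Ltr t'c.
  have as_ := Ltr ac cs.
  have a1s := Ltr a1c cs.
  have [//|//|e1|Pcs|Psc] := @Ptot c s.
  - by apply: (@Lirr c); rewrite {2}e1.
  - have [e' [e's he']] := Pl (conj as_ sb).
    have [t [/lt_Lmax[ct e't] ts]] := Ldense (Lmax_lt cs e's).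
    have tb := Ltr ts sb; have at_ := Ltr ac ct.
    apply: (h1 t) => //; split=> // y ty yb.
    have ay := Ltr at_ ty.
    have [ys|/Ltot[ys|sy]] := pselect (y = s); [by rewrite ys| |exact: hs].
    by apply: (@Ptr c s y) => //; apply: he' => //; apply: Ltr ty.
  - apply: (nB s) => // y [ay yb] sy.
    by apply: (@Ptr s c y) => //; apply: hs.
(* The desired separation property, again decided by its germ at [b]; it remains to refute that it
   fails on a final segment. *)
pose Psi x := exists c, [/\ I c,
    exists e, L e x /\ forall y, L e y -> L y x -> I y -> P c y &
    exists e, L x e /\ forall y, L x y -> L y e -> I y -> P y c].
have DPsi : Def Psi.
  have D : Def (fun x => exists c, I c /\
    ((exists e, L e x /\ forall y, L e y -> L y x -> I y -> P c y) /\
    (exists e, L x e /\ forall y, L x y -> L y e -> I y -> P y c))) by def_auto.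
  by apply: (def_ext D) => x; split=> [[c [? []]]|[c []]]; exists c.
have [[e [eb he]]|[e [eb he]]] := Lgerm b DPsi.
  exists (Lmax a e); split; first exact: Lmax_lt.
    by rewrite /Lmax; case: pselect; auto.
  by move=> x /lt_Lmax[_ ex]; apply: he.
exfalso.
have [c [/lt_Lmax[a2c ec] cb]] := Ldense (Lmax_lt a2b eb).
have [ac a1c] := lt_Lmax a2c.
pose S t := [/\ L c t, L t b & forall y, L t y -> L y b -> P y c].
have DS : Def S.
  have D : Def (fun t => L c t /\ (L t b /\ forall y, L t y -> L y b -> P y c)) by def_auto.
  by apply: (def_ext D) => t; split=> [[? []]|[]].
have S0 : exists t, S t by have [t ht] := key _ a2c cb; exists t.
have [|s [h1 h2]] := Lglb (m := c) DS S0 _; first by move=> x [].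
have hs y : L s y -> L y b -> P y c.
  by move=> /h2[t [[_ _ ht] ty]]; apply: ht.
have sb : L s b.
  case: S0 => t [ct tb ht]; have [<-//|/Ltot[ts|st]] := pselect (t = s).
    by case: (h1 t (And3 ct tb ht)).
  exact: Ltr tb.
have [e1 [ce1 he1]] := Pr (conj ac cb).
have cs : L c s.
  have ns : forall t, S t -> ~ L t e1.
    move=> t [ct tb ht] te1.
    have [y [ty ye]] : exists y, L t y /\ (L y e1 /\ L y b).
      have [e1b|nb_] := pselect (L e1 b).
        by have [y [ty ye]] := Ldense te1; exists y; do !split=> //; apply: Ltr e1b.
      have [y [ty yb]] := Ldense tb; exists y; do !split=> //.
      by have [<-//|/Ltot[be|//]] := pselect (b = e1); apply: Ltr be.
    case: ye => ye yb; have cy := Ltr ct ty; have ay := Ltr ac cy.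
    by apply: (@Pasym c y) => //; [apply: he1|apply: ht].
  have [<-//|/Ltot[e1s|se1]] := pselect (e1 = s); first exact: Ltr e1s.
  by have [t [/ns]] := h2 _ se1.
have as_ := Ltr ac cs.
apply: (he s) => //; first exact: Ltr cs.
exists c; split=> //; last by exists b; split=> // y sy yb _; apply: hs.
(* [c] separates at the infimum [s] unless points just before [s] are also below [c]. In that case
   [P c s] contradicts minimality at [s], and [P s c] lets the segment below [c] start before
   [s]. *)
have DA : Def (fun y => P c y) by def_auto.
have [[e2 [e2s he2]]|[e2 [e2s he2]]] := Lgerm s DA.
  by exists e2; split=> // y h3 h4 _; apply: he2.
exfalso.
have Pyc y : L c y -> L e2 y -> L y s -> P y c.
  move=> cy ey ys; have yb := Ltr ys sb; have ay := Ltr ac cy.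
  have [//|//|e3|h3|//] := @Ptot c y; last by case: (he2 _ ey ys).
  by case: (@Lirr c); rewrite {2}e3.
have [//|//|e3|Pcs|Psc] := @Ptot c s.
- by case: (@Lirr c); rewrite {2}e3.
- have [e' [e's he']] := Pl (conj as_ sb).
  have [t [/lt_Lmax[/lt_Lmax[ct e't] e2t] ts]] := Ldense (Lmax_lt (Lmax_lt cs e's) e2s).
  have tb := Ltr ts sb; have at_ := Ltr ac ct.
  apply: (@Pasym c t) => //; last exact: Pyc.
  by apply: (@Ptr c s t) => //; apply: he'.
- have [t [/lt_Lmax[ct e2t] ts]] := Ldense (Lmax_lt cs e2s).
  have tb := Ltr ts sb.
  apply: (h1 t) => //; split=> // y ty yb.
  have cy := Ltr ct ty.
  have [ys|/Ltot[ys|sy]] := pselect (y = s); [by rewrite ys| |exact: hs].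
  by apply: Pyc => //; apply: Ltr ty.
Qed.

End LocalMinima.

Notation between a b x := (is_true (a < x) /\ is_true (x < b)).

Lemma lt_total (x y : R) : x <> y -> x < y \/ y < x.
Proof. by case: (ltgtP x y); auto. Qed.

Lemma glb_exists (A : R -> Prop) m : Def A -> (exists x, A x) -> (forall x, A x -> m < x) ->
  exists s, glb A s.
Proof.
move=> DA [x Ax] hm; have [h|h|//] := glb_cases DA; first by case: (h x).
by have [y [/hm my /lt_trans /(_ my)]] := h m; rewrite ltxx.
Qed.

Lemma lub_exists (A : R -> Prop) m : Def A -> (exists x, A x) -> (forall x, A x -> x < m) ->
  exists s, lub A s.
Proof.
move=> DA [x Ax] hm; have [h|h|//] := lub_cases DA; first by case: (h x).
by have [y [/hm my /lt_trans /(_ my)]] := h m; rewrite ltxx.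
Qed.

(** The levels [c] and [c'] obtained from the two directions at a common [x] close a cycle of [P]:
    from [c] to [y] just left of [x], to [c'], to [z] just right of [x], and back to [c]. *)
Lemma no_local_min (P : R -> R -> Prop) a b : Def (fun p => P p.1 p.2) -> a < b ->
  (forall x y z, between a b x -> between a b y -> between a b z -> P x y -> P y z -> P x z) ->
  (forall x y, between a b x -> between a b y -> P x y -> ~ P y x) ->
  (forall x y, between a b x -> between a b y -> x <> y -> P x y \/ P y x) ->
  (forall x, between a b x -> nb x (fun y => between a b y -> y <> x -> P x y)) -> False.
Proof.
move=> DP ab Ptr Pas Pto Pmin.
have Pl x : between a b x -> exists e, e < x /\ forall y, between a b y -> e < y -> y < x -> P x y.
  move=> /Pmin/nbR[e [e' [/andP[h1 h2] h]]]; exists e; split=> // y Iy h3 h4.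
  by apply: h Iy _; [rewrite h3 (lt_trans h4)|move=> e1; rewrite e1 ltxx in h4].
have Pr x : between a b x -> exists e, x < e /\ forall y, between a b y -> x < y -> y < e -> P x y.
  move=> /Pmin/nbR[e [e' [/andP[h1 h2] h]]]; exists e'; split=> // y Iy h3 h4.
  by apply: h Iy _; [rewrite h4 (lt_trans h1)|move=> e1; rewrite e1 ltxx in h3].
have Lden x y : x < y -> exists z : R, x < z /\ z < y.
  by move=> /Rdense[z /andP[]]; exists z.
have [|||||||a' [a'b aa' h1]] := @local_min_separated (fun x y => x < y) P _ _ _ _ _ _ _ DP a b ab Ptr Pas Pto Pl Pr.
- by move=> x y z; apply: lt_trans.
- by move=> x; rewrite ltxx.
- exact: lt_total.
- exact: Lden.
- by def_auto.
- by move=> A c /(germ_left c).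
- move=> A m DA A0 hm; have [s [h1 h2]] := glb_exists DA A0 hm.
  by exists s; split=> // x /h1; rewrite leNgt => /negP.
have sub x : between a' b x -> between a b x.
  by case=> ax xb; split=> //; case: aa' => [<-//|/lt_trans]; apply.
(* The reversed run starts at [b] and ends at [a'], inside the segment of the first run, so that
   both conclusions hold at one point. *)
have [||||||||||||a2 [a2a aa2 h2]] := @local_min_separated (fun x y => y < x) P _ _ _ _ _ _ _ DP b a' a'b.
- by move=> x y z xy yz; apply: lt_trans xy.
- by move=> x; rewrite ltxx.
- by move=> x y /lt_total[]; auto.
- by move=> x y /Lden[z []]; exists z.
- by def_auto.
- by move=> A c /(germ_right c)[[e [ce he]]|[e [ce he]]]; [left|right]; exists e; split=> // x ? ?; apply: he.
- move=> A m DA A0 hm; have [s [h3 h4]] := lub_exists DA A0 hm.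
  by exists s; split=> // x /h3; rewrite leNgt => /negP.
- by move=> x y z [? ?] [? ?] [? ?]; apply: Ptr; apply: sub.
- by move=> x y [? ?] [? ?]; apply: Pas; apply: sub.
- by move=> x y [? ?] [? ?]; apply: Pto; apply: sub.
- by move=> x [h3 h4]; have [e [xe he]] := Pr x (sub _ (conj h4 h3)); exists e; split=> // y [h5 h6] h7 h8; apply: he => //; apply: sub.
- by move=> x [h3 h4]; have [e [xe he]] := Pl x (sub _ (conj h4 h3)); exists e; split=> // y [h5 h6] h7 h8; apply: he => //; apply: sub.
have [x [a'x xa2]] := Lden _ _ a2a.
have xb : x < b by case: aa2 => [<-//|]; apply: lt_trans.
have [c [Ic [e1 [e1x he1]] [e2 [e2x he2]]]] := h1 x a'x xb.
have [c' [[c'1 c'2] [e3 [e3x he3]] [e4 [e4x he4]]]] := h2 x xa2 a'x.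
have Ic' : between a b c' by apply: sub.
have [y [hy yx]] : exists y, (a' < y /\ (e1 < y /\ e4 < y)) /\ y < x.
  have [|y []] := Lden (Order.max a' (Order.max e1 e4)) x; first by rewrite !gt_max a'x e1x.
  by rewrite !gt_max => /and3P[? ? ?]; exists y.
have [z [hz xz]] : exists y, (y < b /\ (y < e2 /\ y < e3)) /\ x < y.
  have [|w []] := Lden x (Order.min b (Order.min e2 e3)); first by rewrite !lt_min xb e2x.
  by rewrite !lt_min => ? /and3P[? ? ?]; exists w.
case: hy => a'y [e1y e4y]; case: hz => zb [ze2 ze3].
have yb := lt_trans yx xb; have a'z := lt_trans a'x xz.
have Iy : between a b y by apply: sub.
have Iz : between a b z by apply: sub.
apply: (@Pas c c') => //.
  by apply: (@Ptr c y c') => //; [apply: he1|apply: he4].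
by apply: (@Ptr c' z c) => //; [apply: he3|apply: he2].
Qed.

(** Connectedness by definable completeness: let [s0] be the supremum of the [t] such that [P x]
    holds up to [t]. The local relation left of [s0] reaches [s0], and the one right of [s0] passes
    it. Only transitivity of [P] enters, so equality of values is covered as well. *)
Lemma local_global (P : R -> R -> Prop) a b : Def (fun p => P p.1 p.2) ->
  (forall x y z, between a b x -> between a b y -> between a b z -> P x y -> P y z -> P x z) ->
  (forall x, between a b x ->
     nb x (fun y => between a b y -> (y < x -> P y x) /\ (x < y -> P x y))) ->
  forall x y, a < x -> x < y -> y < b -> P x y.
Proof.
move=> DP Ptr hloc x y ax xy yb.
apply: contrapT => nP.
have Ix : between a b x by split=> //; apply: lt_trans yb.
have Iy : between a b y by split=> //; apply: lt_trans xy.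
pose B t := [/\ x < t, t < y & forall s, x < s -> s < t -> P x s].
have DB : Def B.
  have D : Def (fun t => x < t /\ (t < y /\ forall s, x < s -> s < t -> P x s)) by def_auto.
  by apply: (def_ext D) => t; split=> [[? []]|[]].
have B0 : exists t, B t.
  have /nbR[e1 [e2 [/andP[e1x xe2] he]]] := hloc _ Ix.
  have [|t /andP[xt]] := @Rdense x (Order.min y e2); first by rewrite lt_min xy xe2.
  rewrite lt_min => /andP[ty te2]; exists t; split=> // s xs st.
  apply: (he s _ _).2 => //; first by rewrite (lt_trans e1x xs) (lt_trans st te2).
  by split; [apply: lt_trans xs|apply: lt_trans yb; apply: lt_trans ty].
have [|s0 [h1 h2]] := @lub_exists B y DB B0; first by move=> t [].
have xs0 : x < s0 by case: B0 => t Bt; apply: (lt_le_trans _ (h1 _ Bt)); case: Bt.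
have s0y : s0 <= y by rewrite leNgt; apply/negP => /h2[t [[_ ty _] /(lt_trans ty)]]; rewrite ltxx.
have Is0 : between a b s0 by split; [apply: lt_trans xs0|apply: le_lt_trans yb].
have hB s : x < s -> s < s0 -> P x s by move=> xs /h2[t [[_ _ h] st]]; apply: h.
have /nbR[e1 [e2 [/andP[e1s se2] he]]] := hloc _ Is0.
have Ps0 : P x s0.
  have [|u /andP[]] := @Rdense (Order.max x e1) s0; first by rewrite gt_max xs0.
  rewrite gt_max => /andP[xu e1u] us0.
  have Iu : between a b u by split; [apply: lt_trans xu|apply: lt_trans us0 _; case: Is0].
  apply: (Ptr x u) => //; first exact: hB.
  by apply: (he u _ _).1 => //; rewrite e1u (lt_trans us0).
have {}s0y : s0 < y by rewrite lt_neqAle s0y andbT; apply/eqP => e; apply: nP; rewrite -e.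
have [|u /andP[su]] := @Rdense s0 (Order.min y e2); first by rewrite lt_min s0y.
rewrite lt_min => /andP[uy ue2].
suff /h1 : B u by rewrite leNgt su.
split=> //; first exact: lt_trans su.
move=> s xs su'.
have [ss0|s0s|->//] := ltgtP s s0; first exact: hB.
have Is : between a b s by split; [apply: lt_trans xs|apply: lt_trans yb; apply: lt_trans uy].
apply: (Ptr x s0) => //; apply: (he s _ _).2 => //.
by rewrite (lt_trans e1s s0s) (lt_trans su').
Qed.

Lemma big_itv a b (Q : R -> Prop) : big (fun x => between a b x /\ Q x) ->
  exists c e, [/\ a <= c, c < e, e <= b & forall x, c < x -> x < e -> Q x].
Proof.
move=> /bigRP[c [e [ce h]]]; exists c, e; split=> //.
- rewrite leNgt; apply/negP => ca.
  have [|x /andP[cx]] := @Rdense c (Order.min a e); first by rewrite lt_min ca.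
  rewrite lt_min => /andP[xa xe]; have [|[ax _] _] := h x; first by rewrite cx.
  by have := lt_trans xa ax; rewrite ltxx.
- rewrite leNgt; apply/negP => ca.
  have [|x /andP[]] := @Rdense (Order.max c b) e; first by rewrite gt_max ce.
  rewrite gt_max => /andP[cx bx] xe; have [|[_ xb] _] := h x; first by rewrite cx.
  by have := lt_trans bx xb; rewrite ltxx.
- by move=> x cx xe; have [|_] := h x; first by rewrite cx.
Qed.

(** The germs of [P] on either side of a point give four types of points, and one type fills a
    subinterval. Local minima and local maxima of [P] are excluded by [no_local_min]; the other two
    types are locally monotone, hence monotone by [local_global]. *)
Lemma order_monotone (P : R -> R -> Prop) a b : Def (fun p => P p.1 p.2) -> a < b ->
  (forall x y z, between a b x -> between a b y -> between a b z -> P x y -> P y z -> P x z) ->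
  (forall x y, between a b x -> between a b y -> P x y -> ~ P y x) ->
  (forall x y, between a b x -> between a b y -> x <> y -> P x y \/ P y x) ->
  exists c e, [/\ a <= c, c < e, e <= b &
    (forall x y, c < x -> x < y -> y < e -> P x y) \/
    (forall x y, c < x -> x < y -> y < e -> P y x)].
Proof.
move=> DP ab Ptr Pas Pto.
pose Lp x := exists e, e < x /\ forall y, e < y -> y < x -> P y x.
pose Ln x := exists e, e < x /\ forall y, e < y -> y < x -> P x y.
pose Rp x := exists e, x < e /\ forall y, x < y -> y < e -> P x y.
pose Rn x := exists e, x < e /\ forall y, x < y -> y < e -> P y x.
have DLp : Def Lp by rewrite /Lp; def_auto.
have DLn : Def Ln by rewrite /Ln; def_auto.
have DRp : Def Rp by rewrite /Rp; def_auto.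
have DRn : Def Rn by rewrite /Rn; def_auto.
have cov x : between a b x -> (Lp x /\ Rp x \/ Lp x /\ Rn x) \/ (Ln x /\ Rp x \/ Ln x /\ Rn x).
  move=> Ix; have DA : Def (fun y => P x y) by def_auto.
  have hl : Lp x \/ Ln x.
    have [h|[e [ex he]]] := germ_left x DA; first by right.
    left; exists (Order.max a e); case: Ix => ax xb; rewrite gt_max ax; split=> // y.
    rewrite gt_max => /andP[ay ey] yx; have [|||//|] := Pto y x; rewrite ?ay ?(lt_trans yx xb) //.
    - by move=> e1; rewrite e1 ltxx in yx.
    - by move=> /(he _ ey yx).
  have hr : Rp x \/ Rn x.
    have [h|[e [ex he]]] := germ_right x DA; first by left.
    right; exists (Order.min b e); case: Ix => ax xb; rewrite lt_min xb; split=> // y xy.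
    rewrite lt_min => /andP[yb ye]; have [|||//|] := Pto y x; rewrite ?yb ?(lt_trans ax xy) //.
    - by move=> e1; rewrite e1 ltxx in xy.
    - by move=> /(he _ xy ye).
  by tauto.
have hbig : big (fun x => (Lp x /\ Rp x \/ Lp x /\ Rn x) \/ (Ln x /\ Rp x \/ Ln x /\ Rn x)).
  by apply/bigRP; exists a, b; split=> // x /andP[? ?]; apply: cov.
have key (Q1 Q2 : R -> Prop) : big (fun x => between a b x /\ (Q1 x /\ Q2 x)) ->
    exists c e, [/\ a <= c, c < e, e <= b & forall x, c < x -> x < e -> Q1 x /\ Q2 x].
  exact: big_itv.
have hbig' : big (fun x => (between a b x /\ (Lp x /\ Rp x) \/ between a b x /\ (Lp x /\ Rn x)) \/
   (between a b x /\ (Ln x /\ Rp x) \/ between a b x /\ (Ln x /\ Rn x))).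
  apply/bigRP; exists a, b; split=> // x /andP[ax xb].
  by have := cov x (conj ax xb); tauto.
have sub c e x : a <= c -> e <= b -> between c e x -> between a b x.
  by move=> ac eb [cx xe]; split; [apply: le_lt_trans cx|apply: lt_le_trans eb].
have sLt c e (P' : R -> R -> Prop) : Def (fun p => P' p.1 p.2) ->
    (forall x y z, between c e x -> between c e y -> between c e z ->
       P' x y -> P' y z -> P' x z) ->
    (forall x, c < x -> x < e -> (exists e, e < x /\ forall y, e < y -> y < x -> P' y x) /\
       (exists e, x < e /\ forall y, x < y -> y < e -> P' x y)) ->
    forall x y, c < x -> x < y -> y < e -> P' x y.
  move=> DP' tr h x y cx xy ye; apply: (@local_global P' c e) => // t It.
  have [[e1 [e1t h1]] [e2 [te2 h2]]] := h _ It.1 It.2.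
  apply/nbR; exists e1, e2; rewrite e1t te2; split=> // s /andP[? ?] _.
  by split=> ?; [apply: h1|apply: h2].
have sMin c e (P' : R -> R -> Prop) : Def (fun p => P' p.1 p.2) -> c < e ->
    (forall x y z, between c e x -> between c e y -> between c e z ->
       P' x y -> P' y z -> P' x z) ->
    (forall x y, between c e x -> between c e y -> P' x y -> ~ P' y x) ->
    (forall x y, between c e x -> between c e y -> x <> y -> P' x y \/ P' y x) ->
    (forall x, c < x -> x < e -> (exists e, e < x /\ forall y, e < y -> y < x -> P' x y) /\
       (exists e, x < e /\ forall y, x < y -> y < e -> P' x y)) -> False.
  move=> DP' ce tr as_ to_ h; apply: (@no_local_min P' c e) => // t It.
  have [[e1 [e1t h1]] [e2 [te2 h2]]] := h _ It.1 It.2.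
  apply/nbR; exists e1, e2; rewrite e1t te2; split=> // s /andP[? ?] _ /lt_total[] ?.
    exact: h1.
  exact: h2.
have [h|h] := big_orR (A := fun x => between a b x /\ (Lp x /\ Rp x) \/ between a b x /\ (Lp x /\ Rn x))
  (B := fun x => between a b x /\ (Ln x /\ Rp x) \/ between a b x /\ (Ln x /\ Rn x))
  ltac:(def_auto) ltac:(def_auto) hbig'.
- have [/key|/key] := big_orR (A := fun x => between a b x /\ (Lp x /\ Rp x))
    (B := fun x => between a b x /\ (Lp x /\ Rn x)) ltac:(def_auto) ltac:(def_auto) h.
  + move=> [c [e [ac ce eb h']]]; exists c, e; split=> //; left; apply: sLt => //.
    by move=> x y z hx hy hz; apply: Ptr; apply: (sub _ _ _ ac eb).
  + move=> [c [e [ac ce eb h']]]; exfalso; apply: (sMin c e (fun x y => P y x)) => //.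
    * by def_auto.
    * by move=> x y z hx hy hz h1 h2; apply: (Ptr z y x) => //; apply: (sub _ _ _ ac eb).
    * by move=> x y hx hy; apply: Pas; apply: (sub _ _ _ ac eb).
    * by move=> x y hx hy xy; case: (Pto x y) => //; [exact: (sub _ _ _ ac eb)|exact: (sub _ _ _ ac eb)|right|left].
- have [/key|/key] := big_orR (A := fun x => between a b x /\ (Ln x /\ Rp x))
    (B := fun x => between a b x /\ (Ln x /\ Rn x)) ltac:(def_auto) ltac:(def_auto) h.
  + move=> [c [e [ac ce eb h']]]; exfalso; apply: (sMin c e P) => //.
    * by move=> x y z hx hy hz; apply: Ptr; apply: (sub _ _ _ ac eb).
    * by move=> x y hx hy; apply: Pas; apply: (sub _ _ _ ac eb).
    * by move=> x y hx hy xy; apply: Pto => //; apply: (sub _ _ _ ac eb).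
  + move=> [c [e [ac ce eb h']]]; exists c, e; split=> //; right.
    apply: (sLt c e (fun x y => P y x)) => //; first by def_auto.
    by move=> x y z hx hy hz h1 h2; apply: (Ptr z y x) => //; apply: (sub _ _ _ ac eb).
Qed.

Lemma fin_min (A : R -> Prop) x0 : fin A -> A x0 -> exists m, A m /\ forall x, A x -> m <= x.
Proof.
move=> [s]; elim: s A x0 => [|h s IH] A x0 hA Ax0; first by have := hA _ Ax0.
have [[x1 [Ax1 x1h]]|/forallNP n] := pselect (exists x, A x /\ x <> h); last first.
  exists x0; split=> // x Ax.
  have e y : A y -> y = h by move=> Ay; apply: contrapT => ne; apply: (n y).
  by rewrite (e _ Ax) (e _ Ax0).
have [||m [[Am mh] hm]] := IH (fun x => A x /\ x <> h) x1 _ _ => //.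
  by move=> x [/hA + /eqP/negPf ne]; rewrite in_cons ne.
have [Ah|nAh] := pselect (A h); last first.
  exists m; split=> // x Ax; apply: hm; split=> // e; by rewrite e in Ax.
exists (Order.min h m); split; first by rewrite /Order.min; case: ifP.
move=> x Ax; rewrite ge_min; have [->|xh] := pselect (x = h); first by rewrite lexx.
by rewrite (hm x) ?orbT.
Qed.

(** If no fibre contains an interval, all fibres are finite, and the set [X0] of least points of
    fibres is infinite, since otherwise the interval would be a finite union of finite fibres. On an
    interval inside [X0] the map is injective. *)
Lemma const_or_injective (f : R -> R) a b : dfn f -> a < b ->
  exists c e, [/\ a <= c, c < e, e <= b &
    (forall x y, between c e x -> between c e y -> f x = f y) \/
    (forall x y, between c e x -> between c e y -> f x = f y -> x = y)].
Proof.
move=> Df ab.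
have [[y hy]|/forallNP n] := pselect (exists y, big (fun x => between a b x /\ f x = y)).
  have [c [e [ac ce eb h]]] := big_itv hy; exists c, e; split=> //; left.
  by move=> x x' [? ?] [? ?]; rewrite !h.
have ffin y : fin (fun x => between a b x /\ f x = y).
  by have [||/n] := @fin_or_big (fun x => between a b x /\ f x = y) => //; def_auto.
pose X0 x := between a b x /\ forall x', between a b x' -> x' < x -> f x' <> f x.
have DX0 : Def X0 by rewrite /X0; def_auto.
have X0m x : between a b x -> exists x', X0 x' /\ f x' = f x.
  move=> Ix; have [m [[Im fm] hm]] := fin_min (ffin (f x)) (conj Ix erefl).
  exists m; split=> //; split=> // x' Ix' x'm e.
  by have := hm _ (conj Ix' (etrans e fm)); rewrite leNgt x'm.
have [f0|b0] := fin_or_big DX0.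
  case: (@itv_infinite a b) => //.
  apply: (fin_mono (fin_union (B := fun x y => between a b y /\ f y = f x) f0 _)).
    by move=> x _; apply: ffin.
  by move=> x /andP[ax xb]; have [x' [h e]] := X0m _ (conj ax xb); exists x'; split.
have [c [e [ac ce eb h]]] := big_itv b0; exists c, e; split=> //; right.
have Ic x : between c e x -> between a b x.
  by move=> [? ?]; split; [apply: le_lt_trans ac _|apply: lt_le_trans eb].
move=> x y hx hy fxy; case: (ltgtP x y) => // xy.
  by have := h y hy.1 hy.2 x (Ic _ hx) xy.
by have := h x hx.1 hx.2 y (Ic _ hy) xy; rewrite fxy.
Qed.

(** The three monotonicity types, constant, increasing and decreasing, as one transitive relation to
    which [local_global] applies uniformly. *)
Definition rel3 (i : option bool) (x y : R) : Prop :=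
  match i with None => x = y | Some true => x < y | Some false => y < x end.

Lemma rel3_trans i x y z : rel3 i x y -> rel3 i y z -> rel3 i x z.
Proof.
case: i => [[]|] /=; [exact: lt_trans| |exact: etrans].
by move=> h1 h2; apply: lt_trans h1.
Qed.

Lemma monotone3 (f : R -> R) a b : dfn f -> a < b ->
  exists i c e, [/\ a <= c, c < e, e <= b &
    forall x y, c < x -> x < y -> y < e -> rel3 i (f x) (f y)].
Proof.
move=> Df ab; have [c [e [ac ce eb [h|h]]]] := const_or_injective Df ab.
  exists None, c, e; split=> // x y cx xy ye; apply: h; split=> //; [exact: lt_trans ye|exact: lt_trans xy].
have [|||||c' [e' [cc' ce' ee' h']]] := @order_monotone (fun x y => f x < f y) c e.
- by def_auto.
- by [].
- by move=> x y z _ _ _; apply: lt_trans.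
- by move=> x y _ _ xy yx; have := lt_trans xy yx; rewrite ltxx.
- by move=> x y hx hy xy; apply: lt_total => /(h _ _ hx hy).
have ac' := le_trans ac cc'; have eb' := le_trans ee' eb.
by case: h' => h'; [exists (Some true), c', e'|exists (Some false), c', e'].
Qed.

(** A strictly monotone definable map has an infinite image, which contains an interval; a monotone
    map that attains all values of an interval is continuous where its values lie inside it. *)
Lemma monotone_cont (f : R -> R) a b : dfn f -> a < b ->
  exists i c e, [/\ a <= c, c < e, e <= b,
    forall x y, c < x -> x < y -> y < e -> rel3 i (f x) (f y) &
    forall x, c < x -> x < e -> cont f x].
Proof.
move=> Df ab; have [i [c [e [ac ce eb h]]]] := monotone3 Df ab.
case: i h => [i|] h; last first.
  exists None, c, e; split=> // x cx xe N hN; have fN := nb_self hN.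
  apply/nbR; exists c, e; rewrite cx xe; split=> // y /andP[cy ye].
  suff -> : f y = f x by [].
  by case: (ltgtP x y) => [xy|xy|->//]; [rewrite (h x y)|rewrite (h y x)].
pose Y y := exists x, between c e x /\ f x = y.
have DY : Def Y by rewrite /Y; def_auto.
have inj x y : between c e x -> between c e y -> f x = f y -> x = y.
  move=> [cx xe] [cy ye] fxy; case: (ltgtP x y) => // xy.
    by have := h x y cx xy ye; rewrite fxy; case: (i) => /=; rewrite ltxx.
  by have := h y x cy xy xe; rewrite fxy; case: (i) => /=; rewrite ltxx.
have bY : big Y.
  have [fY|//] := fin_or_big DY; case: (@itv_infinite c e) => //.
  apply: (fin_mono (fin_union (B := fun y x => between c e x /\ f x = y) fY _)).
    move=> y [x [Ix fx]]; exists [:: x] => x' [Ix' fx'].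
    by rewrite inE; apply/eqP; apply: inj => //; rewrite fx.
  by move=> x /andP[cx xe]; exists (f x); split=> //; exists x.
have /bigRP[r0 [s0 [rs0 hY]]] := bY.
(* Chosen strictly inside the interval of attained values, so that the bounds [max al r] and
   [min be s] used below are themselves attained. *)
have [r /andP[r0r rs]] := Rdense rs0; have [s /andP[rs' ss0]] := Rdense rs.
have [|u [[cu ue] fu]] := hY r; first by rewrite r0r.
have [|v [[cv ve] fv]] := hY s; first by rewrite (lt_trans r0r).
(* Treats both directions at once: [x] lies between [p] and [q] in one of the two possible orders,
   and all points between them have values between [f p] and [f q]. *)
have sand p q x : between c e p -> between c e q -> between c e x -> f p < f x -> f x < f q ->
    exists p' q', [/\ p' < x, x < q', c <= p', q' <= e &
      forall y, p' < y -> y < q' -> f p < f y /\ f y < f q].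
  move=> [cp pe] [cq qe] [cx xe] px xq.
  have npx : p != x by apply: contraTneq px => ->; rewrite ltxx.
  have nqx : q != x by apply: contraTneq xq => ->; rewrite ltxx.
  case: (i) h => /= h.
    exists p, q; have {}npx : p < x.
      by case: (ltgtP p x) npx => // xp _; have := lt_trans px (h _ _ cx xp pe); rewrite ltxx.
    have {}nqx : x < q.
      by case: (ltgtP q x) nqx => // xp _; have := lt_trans xq (h _ _ cq xp xe); rewrite ltxx.
    split=> //; [exact: ltW|exact: ltW|move=> y py yq].
    by split; apply: h => //; [apply: lt_trans qe|apply: lt_trans py].
  exists q, p; have {}npx : x < p.
    by case: (ltgtP p x) npx => // xp _; have := lt_trans px (h _ _ cp xp xe); rewrite ltxx.
  have {}nqx : q < x.
    by case: (ltgtP q x) nqx => // xp _; have := lt_trans xq (h _ _ cx xp qe); rewrite ltxx.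
  split=> //; [exact: ltW|exact: ltW|move=> y py yq].
  by split; apply: h => //; [apply: lt_trans py|apply: lt_trans pe].
have [w [Iw /andP[rw ws]]] : exists w, between c e w /\ r < f w < s.
  have [w hw] := Rdense rs'; have [|x [Ix fx]] := hY w; last by exists x; rewrite fx.
  by case/andP: hw => h1 h2; rewrite (lt_trans r0r) ?(lt_trans h2).
have [|||||p0 [q0 [p0w wq0 cp0 qe0 hpq]]] := sand u v w; rewrite ?fu ?fv //.
exists (Some i), p0, q0; split.
- exact: le_trans cp0.
- exact: lt_trans wq0.
- exact: le_trans eb.
- by move=> x y p0x xy yq0; apply: h => //; [apply: le_lt_trans p0x|apply: lt_le_trans qe0].
move=> x p0x xq0 N /nbR[al [be [/andP[alx xbe] hN]]].
have [] := hpq x p0x xq0; rewrite fu fv => rx xs.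
have Ix : between c e x by split; [apply: le_lt_trans p0x|apply: lt_le_trans qe0].
have [|p [Ip fp]] := hY (Order.max al r).
  rewrite lt_max r0r orbT gt_max (lt_trans alx) ?(lt_trans xs) //=; exact: lt_trans ss0.
have [|q [Iq fq]] := hY (Order.min be s).
  rewrite gt_min ss0 orbT lt_min (lt_trans _ xbe) ?(lt_trans r0r) //=; exact: lt_trans rs'.
have [|||||p' [q' [p'x xq' _ _ h']]] := sand p q x; rewrite ?fp ?fq ?gt_max ?lt_min ?alx ?rx ?xbe //.
apply/nbR; exists p', q'; rewrite p'x xq'; split=> // y /andP[py yq].
have [] := h' y py yq; rewrite fp fq gt_max lt_min => /andP[h1 _] /andP[h2 _].
by apply: hN; rewrite h1.
Qed.

(** * Boxes in powers of the line *)

Definition big_splits T {dT : dty T} := forall A B : T -> Prop, Def A -> Def B ->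
  big (fun x => A x \/ B x) -> big A \/ big B.

Definition big_continuity T {dT : dty T} := forall f : T -> R, dfn f -> forall A, big A ->
  big (fun x => A x /\ cont f x).

Definition tame T {dT : dty T} := [/\ big_splits (T := T), big_continuity (T := T) & (zi T -> False)].

(** Partial definable functions, such as suprema and minima of fibres, are made total with the
    default [u0], since [dfn] speaks of total functions. *)
Lemma dfn_of_graph T U (dT : dty T) (dU : dty U) (G : T -> U -> Prop) (u0 : U) :
  Def (fun p => G p.1 p.2) -> (forall x u v, G x u -> G x v -> u = v) ->
  exists f : T -> U, dfn f /\ forall x u, G x u -> f x = u.
Proof.
move=> DG fG.
pose f x := match pselect (exists u, G x u) with left h => projT1 (cid h) | right _ => u0 end.
have hf x u : G x u -> f x = u.
  rewrite /f => Gxu; case: pselect => [h|[]]; last by exists u.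
  by case: cid => v Gv /=; apply: fG Gxu.
exists f; split=> //.
have D : Def (fun p : T * U => G p.1 p.2 \/ (~ exists u, G p.1 u) /\ p.2 = u0) by def_auto.
apply: (def_ext D) => -[x u] /=; split=> [[/hf//|[n ->]]|->].
  by rewrite /f; case: pselect.
have [[v Gv]|n] := pselect (exists u, G x u); first by left; rewrite (hf _ _ Gv).
by right; split=> //; rewrite /f; case: pselect.
Qed.

Lemma lub_unique (A : R -> Prop) s t : lub A s -> lub A t -> s = t.
Proof.
move=> [h1 h2] [h3 h4]; case: (ltgtP s t) => // [/h4|/h2] [w [Aw]]; rewrite ltNge.
  by rewrite h1.
by rewrite h3.
Qed.

Lemma glb_unique (A : R -> Prop) s t : glb A s -> glb A t -> s = t.
Proof.
move=> [h1 h2] [h3 h4]; case: (ltgtP s t) => // [/h2|/h4] [w [Aw]]; rewrite ltNge.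
  by rewrite h3.
by rewrite h1.
Qed.

(** A set with interior may be arbitrary, whereas splitting asks for definable sets; this passes to
    a box inside it. *)
Lemma nb_def T (dT : dty T) (x : T) N : nb x N ->
  exists D, [/\ Def D, nb x D & forall y, D y -> N y].
Proof.
move=> [a [b [h1 h2]]].
exists (fun y => zc y = zc x /\ forall j, a j < rc y j < b j); split; first by def_auto.
  by exists a, b.
by move=> y []; apply: h2.
Qed.

Lemma cont_gt T (dT : dty T) (f : T -> R) x c : cont f x -> c < f x -> nb x (fun y => c < f y).
Proof.
move=> cf cfx; have [e fe] := Rup (f x).
apply: (cf (fun r => c < r)); apply: (nb_mono (@nb_itv c e _ _)) => [|y /andP[]//].
by rewrite cfx.
Qed.

Lemma cont_lt T (dT : dty T) (f : T -> R) x c : cont f x -> f x < c -> nb x (fun y => f y < c).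
Proof.
move=> cf cfx; have [e fe] := Rlow (f x).
apply: (cf (fun r => r < c)); apply: (nb_mono (@nb_itv e c _ _)) => [|y /andP[]//].
by rewrite cfx fe.
Qed.

Lemma nb_point T U (dT : dty T) (dU : dty U) (x : T) (y : U) (N : T * U -> Prop) N1 N2 :
  nb x N1 -> nb y N2 -> (forall u v, N1 u -> N2 v -> N (u, v)) -> nb (x, y) N.
Proof. by move=> h1 h2 h; apply/nb_pair; exists N1, N2. Qed.

Lemma big_exfin T (dT : dty T) (K : finType) (A : K -> T -> Prop) : big_splits (T := T) -> (forall k, Def (A k)) ->
  big (fun x => exists k, A k x) -> exists k, big (A k).
Proof.
move=> hF1 DA hA.
have h : forall s : seq K, big (fun x => exists2 k, k \in s & A k x) -> exists k, big (A k).
  elim=> [|k s IH] [x hx]; first by case: (nb_self hx).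
  have [|| |hk|/IH//] := hF1 (A k) (fun x => exists2 k, k \in s & A k x); last by exists k.
  - exact: DA.
  - have D : Def (fun x => exists k, (k \in s) /\ A k x).
      by apply: def_exfin => k'; apply: def_and; [apply: def_T|apply: DA].
    by apply: (def_ext D) => y; split=> [[k' []]|[k']]; exists k'.
  - exists x; apply: (nb_mono hx) => y [k']; rewrite in_cons => /orP[/eqP->|ks] h; first by left.
    by right; exists k'.
apply: (h (enum K)); apply: (big_mono hA) => x [k Ak]; exists k => //; exact: mem_enum.
Qed.

Section Step.
Context {T : Type} {dT : dty T}.
Hypotheses (hF1 : big_splits (T := T)) (hF2 : big_continuity (T := T)).

(** The right end [g y] of an interval of [C y] that starts at [a y] can be chosen definably. Where
    [a] and [g] are both continuous, the strip between them contains a box. *)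
Lemma big_right_of (a : T -> R) (C : T -> R -> Prop) : dfn a -> Def (fun p => C p.1 p.2) ->
  big (fun y => exists e, a y < e /\ forall s, a y < s -> s < e -> C y s) ->
  big (fun p => C p.1 p.2).
Proof.
move=> Da DC hbig.
have [y1 hy1] := hF2 Da hbig; have [_ cay1] := nb_self hy1; have [d ad] := Rup (a y1).
have hb : big (fun y => (exists e, a y < e /\ forall s, a y < s -> s < e -> C y s) /\ a y < d).
  exists y1; apply: (nb_mono (nb_and hy1 (cont_lt cay1 ad))) => y [[]]; auto.
(* The cap [d] ensures that the supremum exists; by continuity of [a] it stays above [a y] near
   [y1]. *)
pose E y e := a y < e /\ (e < d /\ forall s, a y < s -> s < e -> C y s).
have DE : Def (fun p => E p.1 p.2) by rewrite /E; def_auto.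
have DL : Def (fun p : T * R => lub (E p.1) p.2) by rewrite /lub; def_auto.
have [g [Dg hg]] := dfn_of_graph (G := fun y => lub (E y)) d DL (fun y => @lub_unique (E y)).
have gP y : (exists e, a y < e /\ forall s, a y < s -> s < e -> C y s) /\ a y < d ->
    a y < g y /\ forall s, a y < s -> s < g y -> C y s.
  move=> [[e [ae he]] ayd].
  have [|e' /andP[ae' ]] := @Rdense (a y) (Order.min d e); first by rewrite lt_min ayd.
  rewrite lt_min => /andP[e'd e'e].
  have Ee' : E y e' by split=> //; split=> // s h1 h2; apply: he => //; apply: lt_trans e'e.
  have DEy : Def (E y) by rewrite /E; def_auto.
  have [||s hs] := @lub_exists (E y) d DEy; first by exists e'.
    by move=> x [_ []].
  rewrite (hg _ _ hs); case: hs => h1 h2; split; first exact: lt_le_trans (h1 _ Ee').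
  by move=> t at_ /h2[u [[_ [_ hu]] tu]]; apply: hu.
have hb2 := hF2 Da (hF2 Dg hb).
have [y2 hy2] := hb2; have [[Iy2 cg] ca] := nb_self hy2.
have [ag _] := gP _ Iy2.
have [t /andP[at_ tg]] := Rdense ag.
have [p /andP[ap pt]] := Rdense at_; have [q /andP[tq qg]] := Rdense tg.
exists (y2, t); apply: (nb_point (nb_and hy2 (nb_and (cont_lt ca ap) (cont_gt cg qg))) (@nb_itv p q t _)).
  by rewrite pt.
move=> y s [[[Iy _] _] [ay gy]] /andP[ps sq] /=.
by have [_] := gP _ Iy; apply; [apply: lt_trans ps|apply: lt_trans gy].
Qed.

(** At a fixed height [t], the germ just above [t] lies in [A] or in [B] on each vertical line.
    Splitting the base accordingly leaves a strip above the constant function [t]. *)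
Lemma big_splits_prod : big_splits (T := T * R).
Proof.
move=> A B DA DB [[x t] /nb_pair[N1 [N2 [h1 /nbR[a [b [/andP[at_ tb] hN2]]] h]]]].
pose UA y := exists e, t < e /\ forall s, t < s -> s < e -> A (y, s).
pose UB y := exists e, t < e /\ forall s, t < s -> s < e -> B (y, s).
have DUA : Def UA by rewrite /UA; def_auto.
have DUB : Def UB by rewrite /UB; def_auto.
have hb : big (fun y => UA y \/ UB y).
  exists x; apply: (nb_mono h1) => y N1y.
  have DAy : Def (fun s => A (y, s)) by def_auto.
  have [hA|[e [te he]]] := germ_right t DAy; [by left|right].
  exists (Order.min e b); rewrite lt_min te tb; split=> // s ts.
  rewrite lt_min => /andP[se sb]; have [|hA|//] := h y s N1y; last by case: (he _ ts se).
  by apply: hN2; rewrite sb (lt_trans at_).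
have DA' : Def (fun p : T * R => A (p.1, p.2)) by def_auto.
have DB' : Def (fun p : T * R => B (p.1, p.2)) by def_auto.
have [hA|hB] := hF1 DUA DUB hb; [left|right].
  apply: (big_mono (big_right_of (C := fun y s => A (y, s)) (dfn_const t) DA' hA)).
  by case.
apply: (big_mono (big_right_of (C := fun y s => B (y, s)) (dfn_const t) DB' hB)).
by case.
Qed.

(* The fibres either are bounded below, and then right of their infimum, or contain a
   half-line at minus infinity. *)
Lemma big_fibres (C : T -> R -> Prop) : Def (fun p => C p.1 p.2) ->
  big (fun y => big (C y)) -> big (fun p => C p.1 p.2).
Proof.
(* The interior of the fibre replaces the fibre, because an isolated point of [C y] could be its
   infimum without an interval of [C y] to the right of it. *)
move=> DC hb; pose I y t := @nb R dtyR t (C y).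
have DI : Def (fun p => I p.1 p.2) by rewrite /I; def_auto.
pose B1 y := (exists t, I y t) /\ exists m, forall t, I y t -> m < t.
pose B2 y := forall m, exists t, I y t /\ t < m.
have DB1 : Def B1 by rewrite /B1; def_auto.
have DB2 : Def B2 by rewrite /B2; def_auto.
have [|h|h] := hF1 DB1 DB2.
- apply: (big_mono hb) => y [t It].
  have [h|/forallNP n] := pselect (exists m, forall t, I y t -> m < t).
    by left; split=> //; exists t.
  right=> m; have [m' mm'] := Rlow m.
  have /existsNP[t' /not_implyP[It' /negP]] := n m'.
  by rewrite -leNgt => t'm; exists t'; split=> //; apply: le_lt_trans mm'.
- have [y0 _] := hb.
  have [r0] : inhabited R by case: HR.
  have DG : Def (fun p : T * R => glb (I p.1) p.2) by rewrite /glb; def_auto.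
  have [a [Da ha]] := dfn_of_graph (G := fun y => glb (I y)) r0 DG (fun y => @glb_unique (I y)).
  apply: (big_right_of Da DC); apply: (big_mono h) => y [I0 [m hm]].
  have DIy : Def (I y) by rewrite /I; def_auto.
  have [s hs] := glb_exists DIy I0 hm; rewrite (ha _ _ hs); case: hs => h1 h2.
  have [[e [se he]]|[e [se he]]] := germ_right s DIy.
    by exists e; split=> // t st te; apply: nb_self (he _ st te).
  have [t [It te]] := h2 _ se; have /nbR[p [q [/andP[pt tq] hpq]]] := nb_open It.
  have [|w /andP[tw]] := @Rdense t (Order.min q e); first by rewrite lt_min tq.
  rewrite lt_min => /andP[wq we]; case: (he w _ we); first exact: le_lt_trans (h1 _ It) _.
  by apply: hpq; rewrite wq (lt_trans pt).
have [c0] : inhabited R by case: HR.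
(* The cap [c0] gives the half-lines a supremum even when the fibre is the whole line. *)
pose E y e := e < c0 /\ forall s, s < e -> C y s.
have DE : Def (fun p => E p.1 p.2) by rewrite /E; def_auto.
have DL : Def (fun p : T * R => lub (E p.1) p.2) by rewrite /lub; def_auto.
have [g [Dg hg]] := dfn_of_graph (G := fun y => lub (E y)) c0 DL (fun y => @lub_unique (E y)).
have gP y : B2 y -> forall s, s < g y -> C y s.
  move=> hy; have DIy : Def (I y) by rewrite /I; def_auto.
  have [[d hd]|[d hd]] := germ_minf DIy; last by have [t [It /hd]] := hy d.
  have [e] := Rlow (Order.min d c0); rewrite lt_min => /andP[ed ec].
  have Ee : E y e by split=> // s se; apply: nb_self (hd _ (lt_trans se ed)).
  have DEy : Def (E y) by rewrite /E; def_auto.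
  have [||s hs] := @lub_exists (E y) c0 DEy; [by exists e|by move=> x []|].
  by rewrite (hg _ _ hs); case: hs => h1 h2 t /h2[u [[_ hu] tu]]; apply: hu.
have [y1 hy1] := hF2 Dg h; have [_ cg] := nb_self hy1.
have [q qg] := Rlow (g y1); have [t tq] := Rlow q; have [p pt] := Rlow t.
exists (y1, t); apply: (nb_point (nb_and hy1 (cont_gt cg qg)) (@nb_itv p q t _)).
  by rewrite pt.
by move=> y s [[By _] gy] /andP[_ sq] /=; apply: gP => //; apply: lt_trans gy.
Qed.

End Step.

(** On a sub-box, [f] has one monotonicity type in the last variable and is separately continuous in
    both. Points where this fails cannot fill a box: [monotone_cont] applies on a vertical line and
    the induction hypothesis on a horizontal slice. Separate continuity together with monotonicity
    gives joint continuity. *)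
Lemma big_continuity_prod T (dT : dty T) : big_splits (T := T) -> big_continuity (T := T) -> big_continuity (T := T * R).
Proof.
move=> hF1 hF2 f Df A [[x0 t0] hA].
have hF1' := big_splits_prod hF1 hF2.
have [D [DD nD DA]] := nb_def hA.
pose good i (p : T * R) := @nb R dtyR p.2 (fun s => (s < p.2 -> rel3 i (f (p.1, s)) (f p)) /\
                              (p.2 < s -> rel3 i (f p) (f (p.1, s)))).
have Dg i : Def (good i).
  have D1 : Def (fun p : T * R => nb p.2 (fun s =>
      (s < p.2 -> rel3 i (f (p.1, s)) (f (p.1, p.2))) /\
      (p.2 < s -> rel3 i (f (p.1, p.2)) (f (p.1, s))))).
    by case: i => [[]|] /=; def_auto.
  by apply: (def_ext D1) => -[].
pose c1 (p : T * R) := @cont R R dtyR dtyR (fun s => f (p.1, s)) p.2.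
pose c2 (p : T * R) := @cont T R dT dtyR (fun y => f (y, p.2)) p.1.
have Dc1 : Def c1 by rewrite /c1; def_auto.
have Dc2 : Def c2 by rewrite /c2; def_auto.
pose H i p := D p /\ (good i p /\ (c1 p /\ c2 p)).
have DH i : Def (H i) by apply: def_and => //; apply: def_and => //; apply: def_and.
pose B1 p := ~ ((exists i, good i p) /\ c1 p).
pose B2 p := ~ c2 p.
have DB2 : Def B2 by apply: def_not.
have DB1 : Def B1.
  by apply: def_not; apply: def_and => //; apply: def_exfin.
have [|||h|hB] := @hF1' (fun p => exists i, H i p) (fun p => B1 p \/ B2 p).
- exact: def_exfin.
- exact: def_or.
- exists (x0, t0); apply: (nb_mono nD) => p Dp; rewrite /B1 /B2.
  have [h2|] := pselect (c2 p); last by auto.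
  have [[[i hi] h1]|] := pselect ((exists i, good i p) /\ c1 p); last by auto.
  by left; exists i.
- have [i hi] := big_exfin hF1' DH h.
  case: hi => -[y t] hH; exists (y, t); apply: (nb_mono (nb_open hH)) => -[{hH}y {}t] hH.
  split; first by apply: DA; case: (nb_self hH).
  have /nb_pair[N1 [N2 [h1 /nbR[a [b [/andP[at_ tb] hN2]]] hN]]] := hH.
  have mono v s s' : N1 v -> a < s -> s < s' -> s' < b -> rel3 i (f (v, s)) (f (v, s')).
    move=> N1v; apply: (@local_global (fun s s' => rel3 i (f (v, s)) (f (v, s')))).
    - by case: (i) => [[]|] /=; def_auto.
    - by move=> ? ? ? _ _ _; apply: rel3_trans.
    - move=> u [au ub]; have [|_ [gu _]] := hN v u N1v; first by apply: hN2; rewrite au.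
      exact: (nb_mono gu).
  have [_ [_ [c1t c2t]]] := nb_self hH.
  move=> N /nbR[al [be [hab hNab]]].
  have /nbR[p [q [/andP[pt tq] hpq]]] : nb t (fun s => al < f (y, s) < be).
    by apply: (c1t (fun r => al < r < be)); apply: nb_itv.
  (* Continuity in [y] is used only at the two heights [t1] and [t2] around [t]; monotonicity
     squeezes all values in between. *)
  have [|t1 /andP[]] := @Rdense (Order.max a p) t; first by rewrite gt_max at_.
  rewrite gt_max => /andP[at1 pt1] t1t.
  have [|t2 /andP[tt2]] := @Rdense t (Order.min b q); first by rewrite lt_min tb.
  rewrite lt_min => /andP[t2b t2q].
  have cc s : a < s -> s < b -> p < s -> s < q -> nb y (fun v => al < f (v, s) < be).
    move=> as_ sb ps sq; have [||_ [_ [_ c2s]]] := hN y s; first exact: nb_self h1.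
      by apply: hN2; rewrite as_.
    by apply: (c2s (fun r => al < r < be)); apply: nb_itv; apply: hpq; rewrite ps.
  have n1 := cc _ at1 (lt_trans t1t tb) pt1 (lt_trans t1t tq).
  have n2 := cc _ (lt_trans at_ tt2) t2b (lt_trans pt tt2) t2q.
  apply: (nb_point (nb_and h1 (nb_and n1 n2)) (@nb_itv t1 t2 t _)); first by rewrite t1t.
  move=> v s [N1v [/andP[v1 v2] /andP[v3 v4]]] /andP[t1s st2]; apply: hNab.
  have m1 := mono v _ _ N1v at1 t1s (lt_trans st2 t2b).
  have m2 := mono v _ _ N1v (lt_trans at1 t1s) st2 t2b.
  case: (i) m1 m2 => [[]|] /= m1 m2.
  + by rewrite (lt_trans v1 m1) (lt_trans m2).
  + by rewrite (lt_trans v3 m2) (lt_trans m1).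
  + by rewrite -m1 v1 v2.
- exfalso; have [hB1|hB2] := hF1' _ _ DB1 DB2 hB.
  + case: hB1 => -[x t] /nb_pair[N1 [N2 [h1 /nbR[a [b [/andP[at_ tb] hN2]]] hN]]].
    have Dfx : dfn (fun s => f (x, s)) by dfn_auto.
    have [i [c [e [ac ce eb hm hc]]]] := monotone_cont Dfx (lt_trans at_ tb).
    have [s /andP[cs se]] := Rdense ce.
    apply: (hN x s); first exact: nb_self h1.
      by apply: hN2; rewrite (le_lt_trans ac cs) (lt_le_trans se eb).
    split; last exact: hc.
    exists i; apply/nbR; exists c, e; rewrite cs se; split=> // u /andP[cu ue] /=.
    by split=> ?; apply: hm.
  + case: hB2 => -[x t] /nb_pair[N1 [N2 [h1 h2 hN]]].
    have Dfx : dfn (fun y => f (y, t)) by dfn_auto.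
    have [|y hy] := hF2 _ Dfx N1; first by exists x.
    by have [N1y cy] := nb_self hy; apply: (hN y t N1y (nb_self h2)).
Qed.

Lemma cont_term T U (dT : dty T) (dU : dty U) (f : T -> U) x : term f -> cont f x.
Proof.
move=> [hz hr]; apply: cont_coord.
  apply: (nb_mono (nb_zc x)) => y e; apply/funext => i.
  by have [s _ hs] := hz i; rewrite !hs e.
move=> j; have [s [[k ->]|[c ->]] hs] := hr j; move=> N; rewrite hs.
  move=> /nbR[a [b [hab hN]]]; apply: (nb_mono (nb_rc hab)) => y hy.
  by rewrite hs; apply: hN.
by move=> Nc; apply: (nb_mono (nb_T x)) => y _; rewrite hs; apply: nb_self Nc.
Qed.

Lemma cont_dfn_comp T U W (dT : dty T) (dU : dty U) (dW : dty W) (f : T -> U) (g : U -> W) x :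
  cont f x -> cont g (f x) -> cont (fun y => g (f y)) x.
Proof. by move=> hf hg N /hg/hf. Qed.

Lemma tame_iso T U (dT : dty T) (dU : dty U) (phi : T -> U) (psi : U -> T) :
  term phi -> term psi -> cancel phi psi -> cancel psi phi ->
  big_splits (T := U) /\ big_continuity (T := U) -> big_splits (T := T) /\ big_continuity (T := T).
Proof.
move=> tphi tpsi K1 K2 [h1 h2].
have bigT A : big A -> big (fun u => A (psi u)).
  move=> [x]; rewrite -{1}(K1 x) => hA; exists (phi x).
  exact: (cont_term (x := phi x) tpsi hA).
have bigU A : big A -> big (fun x => A (phi x)).
  move=> [u]; rewrite -{1}(K2 u) => hA; exists (psi u).
  exact: (cont_term (x := psi u) tphi hA).
split=> [A B DA DB /bigT h|f Df A /bigT hA].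
  have [||hA|hB] := h1 _ _ _ _ h.
  - exact: def_term DA tpsi.
  - exact: def_term DB tpsi.
  - by left; apply: (big_mono (bigU _ hA)) => x; rewrite K1.
  - by right; apply: (big_mono (bigU _ hB)) => x; rewrite K1.
have Df' : dfn (fun u => f (psi u)) by apply: dfn_comp => //; apply: dfn_term.
apply: (big_mono (bigU _ (h2 _ Df' _ hA))) => x [Ax cx].
rewrite K1 in Ax; split=> //.
move: (cont_dfn_comp (cont_term (x := x) tphi) cx).
by have -> : (fun y => f (psi (phi y))) = f by apply/funext => y; rewrite K1.
Qed.

Section Powers.
Variables (K : finType) (n : nat).
Hypothesis hK : #|K| = n.+1.

Lemma card_option_ord : #|K| = #|{: option 'I_n}|.
Proof. by rewrite hK card_option card_ord. Qed.

Definition to_opt (k : K) : option 'I_n := enum_val (cast_ord card_option_ord (enum_rank k)).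
Definition of_opt (o : option 'I_n) : K :=
  enum_val (cast_ord (esym card_option_ord) (enum_rank o)).

Lemma to_optK : cancel to_opt of_opt.
Proof. by move=> k; rewrite /to_opt /of_opt enum_valK cast_ordK enum_rankK. Qed.

Lemma of_optK : cancel of_opt to_opt.
Proof. by move=> k; rewrite /to_opt /of_opt enum_valK cast_ordKV enum_rankK. Qed.

Definition split_pow (x : K -> R) : ('I_n -> R) * R :=
  (fun i => x (of_opt (Some i)), x (of_opt None)).
Definition join_pow (p : ('I_n -> R) * R) : K -> R :=
  fun k => match to_opt k with Some i => p.1 i | None => p.2 end.

Lemma split_powK : cancel split_pow join_pow.
Proof.
move=> x; apply/funext => k; rewrite /join_pow /split_pow /=.
by rewrite -{2}(to_optK k); case: (to_opt k).
Qed.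

Lemma join_powK : cancel join_pow split_pow.
Proof.
move=> [u r]; rewrite /join_pow /split_pow /= of_optK; congr pair.
by apply/funext => i; rewrite of_optK.
Qed.

Lemma term_split : term split_pow.
Proof.
apply: (term_pair (f := fun x i => x (of_opt (Some i))) (g := fun x => x (of_opt None))).
  by apply: term_lam => i; apply: (@term_app _ _ K (fun x => x)); apply: term_id.
by apply: (@term_app _ _ K (fun x => x)); apply: term_id.
Qed.

Lemma term_join : term join_pow.
Proof.
apply: term_lam => k; rewrite /join_pow; case: (to_opt k) => [i|].
  by apply: (@term_app _ _ _ (fun x => x.1)); apply: term_fst; apply: term_id.
by apply: term_snd; apply: term_id.
Qed.

End Powers.

Lemma big_splits_continuity_pow (K : finType) : big_splits (T := K -> R) /\ big_continuity (T := K -> R).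
Proof.
move: {2}#|K| (erefl #|K|) => n; elim: n K => [|n IH] K hK.
  have e (x y : K -> R) : x = y.
    by apply/funext => k; have := fintype0 k hK.
  split=> [A B DA DB [x hx]|f Df A [x hA]].
    have [h|h] := nb_self hx.
  - by left; exists x; apply: (nb_mono (nb_T x)) => y _; rewrite (e y x).
  - by right; exists x; apply: (nb_mono (nb_T x)) => y _; rewrite (e y x).
  exists x; apply: (nb_mono hA) => y Ay; split=> // N hN.
  by apply: (nb_mono (nb_T y)) => y' _; rewrite (e y' y); apply: nb_self hN.
apply: (tame_iso (term_split hK) (term_join hK) (split_powK hK) (join_powK hK)).
have [h1 h2] := IH 'I_n (card_ord n).
by split; [apply: big_splits_prod|apply: big_continuity_prod].
Qed.

Lemma tame_pow (K : finType) : tame (T := K -> R).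
Proof. by have [? ?] := big_splits_continuity_pow K; split=> // -[]. Qed.

(* Full orthogonality. *)
Lemma orthogonal T (dT : dty T) (I : finType) (C : T -> (I -> Z) -> Prop) : (zi T -> False) ->
  Def (fun p => C p.1 p.2) ->
  exists k (V : 'I_k -> T -> Prop) (U : 'I_k -> (I -> Z) -> Prop), (forall i, Def (V i)) /\
    forall y z, C y z <-> exists i, U i z /\ V i y.
Proof.
move=> z0 [k [U [V [h hX]]]].
pose f (j : @ri T dT + void) : @ri T dT := match j with inl j => j | inr v => match v with end end.
pose g (z : I -> Z) (i : @zi T dT + I) : Z :=
  match i with inl j => False_rect _ (z0 j) | inr i => z i end.
exists k, (fun i y => V i (rc y \o f)), (fun i z => U i (g z)); split=> [i|y z].
  pose proof (DefZR_rect (D_true HZ (zi T)) (D_pre DR_structure f (h i).2)) as D.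
  by apply: (DefZR_ext D) => p; rewrite rcK; split=> [[]|].
pose dd := dtyP dT (dtyZI I).
have zE : @zc _ dd (y, z) = g z by apply/funext; case=> // j; case: (z0 j).
have rE : @rc _ dd (y, z) = rc y \o f by apply/funext; case.
have mE : @mk _ dd (g z) (rc y \o f) = (y, z) by rewrite -zE -rE mkK.
by have := hX (g z, rc y \o f); rewrite [mk _ _]mE.
Qed.

Section PowerDomain.
Variable K : finType.
Notation T := (K -> R).

Let hF1 : big_splits (T := T). Proof. by case: (tame_pow K). Qed.
Let hF2 : big_continuity (T := T). Proof. by case: (tame_pow K). Qed.

(** The graph of [g] is a finite union of rectangles. Where a factor [V i] contains a box and [U i]
    has a point [z], the value of [g] must be [z] throughout. *)
Lemma big_const (I : finType) (g : T -> I -> Z) (A : T -> Prop) : dfn g -> big A ->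
  big (fun x => A x /\ nb x (fun y => g y = g x)).
Proof.
move=> Dg [x0 hA]; have [D [DD nD DA]] := nb_def hA.
have DG : Def (fun p : T * (I -> Z) => p.2 = g p.1) by [].
have [|k [V [U [DV hVU]]]] := orthogonal (C := fun y z => z = g y) _ DG; first by case.
have [|| i [x hx]] := @big_exfin _ _ _ (fun i y => D y /\ (V i y /\ exists z, U i z)) hF1.
- by move=> i; apply: def_and => //; apply: def_and => //; apply: def_T.
- exists x0; apply: (nb_mono nD) => y Dy.
  by have [/(_ erefl)[i [Ui Vi]] _] := hVU y (g y); exists i; split=> //; split=> //; exists (g y).
exists x; apply: (nb_mono (nb_open hx)) => y hy; have [Dy [Vy [z Uz]]] := nb_self hy.
split; first exact: DA.
apply: (nb_mono hy) => y' [_ [Vy' _]].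
by rewrite -((hVU y' z).2 (ex_intro _ i (conj Uz Vy'))) ((hVU y z).2 (ex_intro _ i (conj Uz Vy))).
Qed.

Lemma big_cont U (dU : dty U) (f : T -> U) (A : T -> Prop) : dfn f -> big A ->
  big (fun x => A x /\ cont f x).
Proof.
move=> Df hA.
have Dz : dfn (fun x => zc (f x)) by dfn_auto.
have h : forall s : seq (ri U), big (fun x => (A x /\ nb x (fun y => zc (f y) = zc (f x))) /\
    forall j, j \in s -> cont (fun y => rc (f y) j) x).
  elim=> [|j s IH]; first by apply: (big_mono (big_const Dz hA)) => x ?; split.
  have Dj : dfn (fun x => rc (f x) j) by dfn_auto.
  apply: (big_mono (hF2 Dj IH)) => x [[? h] hj]; split=> // j'.
  by rewrite in_cons => /orP[/eqP->|/h].
apply: (big_mono (h (enum (ri U)))) => x [[? hz] hr]; split=> //.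
by apply: cont_coord => // j; apply: hr; rewrite mem_enum.
Qed.

End PowerDomain.

(** * Definable choice on a smaller box *)

Definition choosable U {dU : dty U} := forall (K : finType) (C : (K -> R) -> U -> Prop),
  Def (fun p => C p.1 p.2) -> big (fun y => exists u, C y u) ->
  exists s, dfn s /\ big (fun y => C y (s y)).

(** Either the fibres have interior over a box, and [big_fibres] makes a constant choice possible on
    a smaller one, or they are finite over a box, and the least element is definable. *)
Lemma choosable_R : choosable (U := R).
Proof.
move=> K C DC hb; have [hF1 hF2 _] := tame_pow K.
have DB1 : Def (fun y => big (C y)) by def_auto.
have DB2 : Def (fun y => (exists u, C y u) /\ ~ big (C y)) by def_auto.
have [|h|h] := hF1 _ _ DB1 DB2.
- by apply: (big_mono hb) => y h; have [?|?] := pselect (big (C y)); [left|right].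
- have [[y t] /nb_pair[N1 [N2 [h1 h2 hN]]]] := big_fibres hF1 hF2 DC h.
  exists (fun _ => t); split; first exact: dfn_const.
  by exists y; apply: (nb_mono h1) => v N1v; apply: hN => //; apply: nb_self h2.
have [r0] : inhabited R by case: HR.
have DG : Def (fun p : (K -> R) * R => C p.1 p.2 /\ forall v, C p.1 v -> p.2 <= v) by def_auto.
have [|s [Ds hs]] := dfn_of_graph (G := fun y u => C y u /\ forall v, C y v -> u <= v) r0 DG.
  by move=> x u v [Cu hu] [Cv hv]; apply: le_anti; rewrite hu //= hv.
exists s; split=> //; apply: (big_mono h) => y [[u Cu] nb_].
have DCy : Def (fun t => C y t) by def_auto.
have [fC|//] := fin_or_big DCy.
by have [m [Cm hm]] := fin_min fC Cu; rewrite (hs y m).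
Qed.

Lemma choosable_prod U W (dU : dty U) (dW : dty W) :
  choosable (U := U) -> choosable (U := W) -> choosable (U := U * W).
Proof.
move=> hU hW K C DC hb.
have D1 : Def (fun p : (K -> R) * U => exists w, C p.1 (p.2, w)) by def_auto.
have [|s1 [Ds1 h1]] := hU K (fun y u => exists w, C y (u, w)) D1.
  by apply: (big_mono hb) => y [[u w] ?]; exists u, w.
have D2' : Def (fun p : (K -> R) * W => C p.1 (s1 p.1, p.2)) by def_auto.
have [s2 [Ds2 h2]] := hW K (fun y w => C y (s1 y, w)) D2' h1.
by exists (fun y => (s1 y, s2 y)); split=> //; apply: dfn_pair.
Qed.

(** Nothing has to be chosen inside [Z]: by orthogonality only finitely many fibres occur, so a
    single point of [Z^I] works on a box. *)
Lemma choosable_Z (I : finType) : choosable (U := I -> Z).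
Proof.
move=> K C DC hb; have [hF1 _ z0] := tame_pow K.
have [k [V [U [DV hVU]]]] := orthogonal z0 DC.
have [|| i hi] := @big_exfin _ _ _ (fun i y => V i y /\ exists z, U i z) hF1.
- by move=> i; apply: def_and => //; apply: def_T.
- apply: (big_mono hb) => y [z /hVU[i [Ui Vi]]]; exists i; split=> //; by exists z.
have [y1 [_ [z Uz]]] : exists y, V i y /\ exists z, U i z by case: hi => y hy; exists y; apply: nb_self hy.
exists (fun _ => z); split; first exact: dfn_const.
by apply: (big_mono hi) => y [Vy _]; apply/hVU; exists i.
Qed.

Lemma choosable_onto U W (dU : dty U) (dW : dty W) (phi : U -> W) (psi : W -> U) :
  term phi -> cancel psi phi -> choosable (U := U) -> choosable (U := W).
Proof.
move=> tphi K1 hU K C DC hb.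
have Dphi := dfn_term tphi.
have D1 : Def (fun p : (K -> R) * U => C p.1 (phi p.2)) by def_auto.
have [|s [Ds h]] := hU K (fun y u => C y (phi u)) D1.
  by apply: (big_mono hb) => y [w Cw]; exists (psi w); rewrite K1.
exists (fun y => phi (s y)); split=> //; exact: dfn_comp.
Qed.

Lemma choosable_pow (J : finType) : choosable (U := J -> R).
Proof.
move: {2}#|J| (erefl #|J|) => n; elim: n J => [|n IH] J hJ.
  have e (x y : J -> R) : x = y by apply/funext => k; have := fintype0 k hJ.
  move=> K C DC hb; have [y0 hy0] := hb; have [u0 _] := nb_self hy0.
  exists (fun _ => u0); split; first exact: dfn_const.
  by apply: (big_mono hb) => y [u]; rewrite (e u u0).
apply: (choosable_onto (term_join hJ) (split_powK hJ)).
by apply: choosable_prod; [apply: IH; rewrite card_ord|apply: choosable_R].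
Qed.

(** A point of the fibre and the corners of a box around it are chosen as functions of [y]. Where
    they are continuous, a slightly smaller fixed box stays inside the moving one. *)
Lemma big_box_fibres (K L : finType) (C : (K -> R) -> (L -> R) -> Prop) :
  Def (fun p => C p.1 p.2) -> big (fun y => big (C y)) -> big (fun p => C p.1 p.2).
Proof.
move=> DC hb.
pose Q y (u : (L -> R) * ((L -> R) * (L -> R))) :=
  (forall j, u.2.1 j < u.1 j < u.2.2 j) /\
  forall w : L -> R, (forall j, u.2.1 j < w j < u.2.2 j) -> C y w.
have DQ : Def (fun p => Q p.1 p.2) by rewrite /Q; def_auto.
have cL := @choosable_pow L.
have [|s [Ds hs]] := choosable_prod cL (choosable_prod cL cL) DQ.
  apply: (big_mono hb) => y [x [a [b [h1 h2]]]]; exists (x, (a, b)); split=> // w hw.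
  by apply: h2 => //; apply: void_fun.
have [y hy] := big_cont Ds hs; have [[h1 _] cy] := nb_self hy.
have [a ha] := choice (fun j => Rdense (andP (h1 j)).1).
have [b hb'] := choice (fun j => Rdense (andP (h1 j)).2).
have n1 j : nb y (fun v => (s v).2.1 j < a j).
  apply: (@cont_lt _ _ (fun v => (s v).2.1 j)); last by case/andP: (ha j).
  apply: (cont_dfn_comp (g := fun u => u.2.1 j) cy); apply: cont_term.
  by apply: (term_app (f := fun u => u.2.1)); apply: term_fst; apply: term_snd; apply: term_id.
have n2 j : nb y (fun v => b j < (s v).2.2 j).
  apply: (@cont_gt _ _ (fun v => (s v).2.2 j)); last by case/andP: (hb' j).
  apply: (cont_dfn_comp (g := fun u => u.2.2 j) cy); apply: cont_term.
  by apply: (term_app (f := fun u => u.2.2)); do 2!apply: term_snd; apply: term_id.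
have nx : nb (s y).1 (fun w => forall j, a j < w j < b j).
  by exists a, b; split=> // j; have /andP[_ ->] := ha j; have /andP[-> _] := hb' j.
exists (y, (s y).1); apply: (nb_point (nb_and hy (nb_and (nb_all n1) (nb_all n2))) nx).
move=> v w [[[_ hC] _] [hl hr]] hw; apply: hC => j; have /andP[h3 h4] := hw j.
by rewrite (lt_trans (hl j) h3) (lt_trans h4 (hr j)).
Qed.

(** * Dimension *)

Definition pr T {dT : dty T} (K : Type) (f : K -> ri T) (x : T) : K -> R := fun k => rc x (f k).

Lemma term_pr T (dT : dty T) (K : finType) (f : K -> ri T) : term (pr f).
Proof. by apply: term_lam => k; exact (term_rc (f k) term_id). Qed.

Lemma dfn_pr T (dT : dty T) (K : finType) (f : K -> ri T) : dfn (pr f).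
Proof. by apply: dfn_term; apply: term_pr. Qed.

Definition dimS T {dT : dty T} (K : finType) (X : T -> Prop) (f : K -> ri T) : Prop :=
  big (fun y : K -> R => exists x, X x /\ pr f x = y).

(** Dimension at least [k]; for [k = 0] this says that [X] is non-empty. Injectivity of [f] need not
    be required, as it follows from the interior ([dimS_injective]). *)
Definition dimge T {dT : dty T} (X : T -> Prop) (k : nat) := exists f : 'I_k -> ri T, dimS X f.

Lemma def_dimS V T (dV : dty V) (dT : dty T) (K : finType) (f : K -> ri T) (X : V -> T -> Prop) :
  Def (fun p => X p.1 p.2) -> Def (fun v => dimS (X v) f).
Proof.
move=> DX; pose proof (dfn_pr f) as Dpr_f.
by rewrite /dimS; def_auto.
Qed.

(** There are only finitely many coordinate projections. This makes dimension definable in families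
    and lets one projection be fixed on a box by [big_exfin]. *)
Lemma dimge_ffun T (dT : dty T) (X : T -> Prop) k :
  dimge X k <-> exists f : {ffun 'I_k -> ri T}, dimS X f.
Proof.
split=> [[f hf]|[f hf]]; last by exists f.
by exists (finfun f); have -> : (finfun f : 'I_k -> ri T) = f by apply/funext => i; rewrite ffunE.
Qed.

Lemma def_dimge V T (dV : dty V) (dT : dty T) k (X : V -> T -> Prop) :
  Def (fun p => X p.1 p.2) -> Def (fun v => dimge (X v) k).
Proof.
move=> DX; have D : Def (fun v => exists f : {ffun 'I_k -> ri T}, dimS (X v) f).
  by apply: def_exfin => f; apply: def_dimS.
by apply: (def_ext D) => v; rewrite dimge_ffun.
Qed.

Ltac df_hook ::=
  lazymatch goal with
  | |- Def (fun x => nb (@?g x) (@?N x)) => refine (@def_nb _ _ _ _ g N _ _); [dfn_auto | def_auto]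
  | |- Def (fun x => contX (@?X x) (@?f x) (@?g x)) =>
    refine (@def_contX _ _ _ _ _ _ X f g _ _ _); [dfn_auto | def_auto | dfn_auto]
  | |- Def (fun x => cont (@?f x) (@?g x)) => refine (@def_cont _ _ _ _ _ _ f g _ _); dfn_auto
  | |- Def (fun x => big (@?N x)) => rewrite /big; def_auto
  | |- Def (fun x => dimS (@?X x) ?f) => refine (@def_dimS _ _ _ _ _ f X _); def_auto
  | |- Def (fun x => dimge (@?X x) ?k) => refine (@def_dimge _ _ _ _ k X _); def_auto
  end.

Lemma dimge_mono T (dT : dty T) (X Y : T -> Prop) k :
  (forall x, X x -> Y x) -> dimge X k -> dimge Y k.
Proof.
move=> XY [f hf]; exists f; apply: (big_mono hf) => y [x [Xx e]]; exists x; auto.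
Qed.

Lemma dimge_or T (dT : dty T) (X Y : T -> Prop) k : Def X -> Def Y ->
  dimge (fun x => X x \/ Y x) k -> dimge X k \/ dimge Y k.
Proof.
move=> DX DY [f hf]; have [hF1 _ _] := tame_pow 'I_k.
have D (X' : T -> Prop) : Def X' -> Def (fun y : 'I_k -> R => exists x, X' x /\ pr f x = y).
  move=> DX'; pose proof (dfn_pr f) as Dpr_f.
  def_auto.
have [|h|h] := hF1 _ _ (D X DX) (D Y DY).
- apply: (big_mono hf) => y [x [[Xx|Yx] e]]; [left|right]; by exists x.
- by left; exists f.
- by right; exists f.
Qed.

(** Coordinate projections are open: a nearby [w] is lifted by keeping the coordinates of [y]
    outside the range of [g]. *)
Lemma nb_comp_inj (K L : finType) (g : L -> K) (y : K -> R) N : injective g -> nb y N ->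
  nb (y \o g) (fun w => exists y', N y' /\ y' \o g = w).
Proof.
move=> ginj [a [b [h1 h2]]]; exists (a \o g), (b \o g); split=> [j|w _ hw]; first exact: h1.
pose y' k := if [pick l | g l == k] is Some l then w l else y k.
exists y'; split; last first.
  apply/funext => l; rewrite /y' /=; case: pickP => [l' /eqP/ginj->//|/(_ l)].
  by rewrite eqxx.
apply: h2 => [|k]; first exact: void_fun.
rewrite /= /y'; case: pickP => [l /eqP <-|_]; [exact: hw|exact: h1].
Qed.

Lemma dimS_reindex T (dT : dty T) (K L : finType) (X : T -> Prop) (f : K -> ri T) (g : L -> K) :
  injective g -> dimS X f -> dimS X (f \o g).
Proof.
move=> ginj [y hy]; exists (y \o g); apply: (nb_mono (nb_comp_inj ginj hy)).
by move=> w [y' [[x [Xx <-]] <-]]; exists x.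
Qed.

Lemma dimS_dimge T (dT : dty T) (K : finType) (X : T -> Prop) (f : K -> ri T) k :
  (k <= #|K|)%N -> dimS X f -> dimge X k.
Proof.
move=> hk hf; exists (f \o (enum_val \o widen_ord hk : 'I_k -> K)); apply: dimS_reindex hf.
by move=> i j /= /enum_val_inj /(congr1 val) /= e; apply: val_inj.
Qed.

Lemma dimge_le T (dT : dty T) (X : T -> Prop) k l : (l <= k)%N -> dimge X k -> dimge X l.
Proof. by move=> lk [f hf]; apply: dimS_dimge hf; rewrite card_ord. Qed.

Lemma big_cont_preimage T U (dT : dty T) (dU : dty U) (f : T -> U) (g : U -> T) (A : U -> Prop) :
  term f -> cancel g f -> big A -> big (fun x => A (f x)).
Proof.
move=> tf gK [u hu]; exists (g u); apply: (cont_term (x := g u) tf).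
by rewrite gK.
Qed.

Lemma dimS_option T (dT : dty T) (K : finType) (X : T -> Prop) (f : K -> ri T) j :
  big (fun p : (K -> R) * R => exists x, X x /\ (pr f x = p.1 /\ rc x j = p.2)) ->
  dimS X (fun o : option K => if o is Some k then f k else j).
Proof.
pose phi (y : option K -> R) := (y \o Some, y None).
pose psi (p : (K -> R) * R) := fun o => if o is Some k then p.1 k else p.2.
have tphi : term phi.
  apply: (term_pair (f := fun x k => x (Some k)) (g := fun x => x None)).
    by apply: term_lam => i; apply: (@term_app _ _ _ (fun x => x)); apply: term_id.
  by apply: (@term_app _ _ _ (fun x => x)); apply: term_id.
move=> /(big_cont_preimage tphi (g := psi)) h; apply: (big_mono (h _)).
  by case=> u r; congr pair; apply/funext.
move=> y [x [Xx [e1 e2]]]; exists x; split=> //; apply/funext; case=> [k|] //.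
by have := congr1 (fun u => u k) e1.
Qed.

Lemma dimS_sum T (dT : dty T) (K L : finType) (X : T -> Prop) (f : K -> ri T) (g : L -> ri T) :
  big (fun p : (K -> R) * (L -> R) => exists x, X x /\ (pr f x = p.1 /\ pr g x = p.2)) ->
  dimS X (fun o : K + L => match o with inl k => f k | inr l => g l end).
Proof.
pose phi (y : K + L -> R) := (y \o inl, y \o inr).
pose psi (p : (K -> R) * (L -> R)) := fun o => match o with inl k => p.1 k | inr l => p.2 l end.
have tphi : term phi.
  apply: (term_pair (f := fun x k => x (inl k)) (g := fun x l => x (inr l))).
    by apply: term_lam => i; apply: (@term_app _ _ _ (fun x => x)); apply: term_id.
  by apply: term_lam => i; apply: (@term_app _ _ _ (fun x => x)); apply: term_id.
move=> /(big_cont_preimage tphi (g := psi)) h; apply: (big_mono (h _)).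
  by case=> u r; congr pair; apply/funext.
move=> y [x [Xx [e1 e2]]]; exists x; split=> //; apply/funext; case=> [k|k] //.
  by have := congr1 (fun u => u k) e1.
by have := congr1 (fun u => u k) e2.
Qed.

(** * Exchange and invariance of dimension *)

(** Pigeonhole, one coordinate at a time: were [S] infinite, an infinite part of it would have
    points that agree in all coordinates, hence one common point, although distinct [t] share no
    point. *)
Lemma finite_coordinates T (dT : dty T) (S : R -> Prop) (Q : R -> T -> Prop) z :
  (forall t, S t -> exists x, Q t x) -> (forall t t' x, Q t x -> Q t' x -> t = t') ->
  (forall t x, Q t x -> zc x = z) ->
  (forall j, fin (fun u => exists t x, Q t x /\ rc x j = u)) -> fin S.
Proof.
move=> hS hQ hz hfin; apply: contrapT => nS.
have h : forall s : seq (ri T), exists (S' : R -> Prop) (v : ri T -> R), ~ fin S' /\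
    forall t, S' t -> exists x, Q t x /\ forall j, j \in s -> rc x j = v j.
  elim=> [|j s [S' [v [nS' h]]]].
    have [r0] : inhabited R by case: HR.
    by exists S, (fun _ => r0); split=> // t /hS[x Qx]; exists x.
  pose A u t := S' t /\ exists x, [/\ Q t x, forall j, j \in s -> rc x j = v j & rc x j = u].
  have [[u nu]|/forallNP n] := pselect (exists u, ~ fin (A u)).
    exists (A u), (fun i => if i == j then u else v i); split=> // t [_ [x [Qx hx e]]].
    exists x; split=> // i; rewrite in_cons; case: eqP => [->//|_] /=; exact: hx.
  case: nS'; apply: (fin_mono (fin_union (B := A) (hfin j) _)).
    by move=> u _; apply: contrapT; apply: n.
  move=> t St; have [x [Qx hx]] := h t St; exists (rc x j); split; first by exists t, x.
  by split=> //; exists x.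
have [S' [v [nS' hS']]] := h (enum (ri T)).
case: nS'; have [[t0 St0]|/forallNP n] := pselect (exists t, S' t); last by exists [::] => t /n.
exists [:: t0] => t St; rewrite inE; apply/eqP.
have [x [Qx hx]] := hS' _ St; have [x0 [Qx0 hx0]] := hS' _ St0.
suff e : x = x0 by apply: (hQ _ _ x) => //; rewrite e.
apply: coord_ext => [|j]; first by rewrite (hz _ _ Qx) (hz _ _ Qx0).
by rewrite hx ?mem_enum // hx0 ?mem_enum.
Qed.

(** [E] is the converse of a partial map from [T] to [W] whose image has interior; the claim is that
    its domain has dimension at least [k]. Fixing the [Z]-coordinates to [z] leaves only real
    coordinates to distinguish points. *)
Definition exchange W {dW : dty W} k := forall T (dT : dty T) (E : W -> T -> Prop) z,
  Def (fun p => E p.1 p.2) -> (forall x y y', E y x -> E y' x -> y = y') ->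
  (forall y x, E y x -> zc x = z) -> big (fun y => exists x, E y x) ->
  dimge (fun x => exists y, E y x) k.

(** By induction each slice at height [t] has [k] independent coordinates [f], the same ones for [t]
    in an interval. Over a fixed value [w] of these, different [t] give different points, so a
    further coordinate [j] takes infinitely many values and contributes the missing dimension. *)
Lemma exchange_step k : exchange (W := 'I_k -> R) k -> exchange (W := ('I_k -> R) * R) k.+1.
Proof.
move=> IH T dT E z DE Esv Ez hb.
have DEt t : Def (fun p : ('I_k -> R) * T => E (p.1, t) p.2) by def_auto.
have hF1R : big_splits (T := R) by exact: big_orR.
have [[y0 t0] /nb_pair[N1 [N2 [h1 h2 hN]]]] := hb.
have DXt (f : {ffun 'I_k -> ri T}) : Def (fun t => dimS (fun x => exists y, E (y, t) x) f).
  by apply: (@def_dimS _ _ _ _ _ f (fun t x => exists y, E (y, t) x)); def_auto.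
have [|f [t1 ht1]] := big_exfin hF1R DXt.
  exists t0; apply: (nb_mono h2) => t N2t; apply/dimge_ffun.
  apply: (IH _ _ (fun y x => E (y, t) x) z) => //.
  - by move=> x y y' hy hy'; have [] := Esv _ _ _ hy hy'.
  - by move=> y x; apply: Ez.
  - by exists y0; apply: (nb_mono h1) => y N1y; apply: hN.
pose proof (dfn_pr f) as Dpr_f.
pose C t w := exists x, (exists y, E (y, t) x) /\ pr f x = w.
(* The line is written as the power [unit -> R] because [big_box_fibres] is stated for powers. *)
have DC : Def (fun p : (unit -> R) * ('I_k -> R) => C (p.1 tt) p.2) by rewrite /C; def_auto.
have [|[tau w] /nb_pair[M1 [M2 [g1 g2 hM]]]] := big_box_fibres (C := fun tau w => C (tau tt) w) DC.
  exists (fun _ => t1); apply: (cont_term (f := fun tau : unit -> R => tau tt)) ht1.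
  by apply: (term_app (f := fun x => x)); apply: term_id.
have g1' : nb (tau tt) (fun t => M1 (fun _ => t)).
  apply: (cont_term (f := fun (t : R) (_ : unit) => t)); first by apply: term_lam => _; apply: term_id.
  by have -> : (fun _ => tau tt) = tau by apply/funext; case.
pose X x := exists y, E y x.
pose Cj j w u := exists x, X x /\ (pr f x = w /\ @rc T dT x j = u).
have DX : Def X by rewrite /X; def_auto.
have DCj j : Def (fun p : ('I_k -> R) * R => Cj j p.1 p.2) by rewrite /Cj; def_auto.
have [hF1 hF2 _] := tame_pow 'I_k.
have DbCj j : Def (fun w => big (Cj j w)).
  have D1 := DCj j; by def_auto.
have [|j hj] := big_exfin hF1 DbCj.
  exists w; apply: (nb_mono g2) => v M2v; apply: contrapT => /forallNP n.
  have [p [q [/andP[pt tq] hpq]]] := (nbR _ _).1 g1'.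
  apply: (itv_infinite (lt_trans pt tq)).
  apply: (@finite_coordinates T dT _ (fun t x => (exists y, E (y, t) x) /\ pr f x = v) z).
  - by move=> t hpt; have := hM (fun _ => t) v (hpq t hpt) M2v; rewrite /C /=.
  - by move=> t t' x [[y Ey] _] [[y' Ey'] _]; have [] := Esv _ _ _ Ey Ey'.
  - by move=> t x [[y Ey] _]; apply: Ez Ey.
  move=> j; have DCjv : Def (fun u => Cj j v u) by have D1 := DCj j; def_auto.
  have [h|h] := fin_or_big DCjv; last by case: (n j h).
  apply: (fin_mono h) => u [t [x [[[y Ey] e] e']]]; exists x; split=> //; by exists (y, t).
have h := dimS_option (big_fibres hF1 hF2 (DCj j) hj).
by apply: dimS_dimge h; rewrite card_option card_ord.
Qed.

Lemma exchange_pow k : exchange (W := 'I_k -> R) k.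
Proof.
elim: k => [|k IH] T dT E z DE Esv Ez hb.
  have f : 'I_0 -> ri T by case.
  case: hb => y hy; exists f, y; apply: (nb_mono hy) => y' [x Ex]; exists x.
  by split; [exists y'|apply/funext; case].
have hK := card_ord k.+1.
have Dj := dfn_term (term_join hK).
have [||||f hf] := exchange_step IH (E := fun p x => E (join_pow hK p) x) (z := z).
- by def_auto.
- move=> x y y' h h'; rewrite -(join_powK hK y) -(join_powK hK y').
  by rewrite (Esv _ _ _ h h').
- by move=> y x; apply: Ez.
- exact: (big_cont_preimage (term_join hK) (split_powK hK) hb).
by exists f; apply: (big_mono hf) => y [x [[p Ep] e]]; exists x; split=> //; exists (join_pow hK p).
Qed.

(** The [Z]-coordinates are chosen as a definable function of [y], which is constant on a smaller
    box; this reduces to fixed [z]. *)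
Lemma exchange_dim k T (dT : dty T) (E : ('I_k -> R) -> T -> Prop) :
  Def (fun p => E p.1 p.2) -> (forall x y y', E y x -> E y' x -> y = y') ->
  big (fun y => exists x, E y x) -> dimge (fun x => exists y, E y x) k.
Proof.
move=> DE Esv hb.
have DC : Def (fun p : ('I_k -> R) * (zi T -> Z) => exists x, E p.1 x /\ zc x = p.2) by def_auto.
have [|s [Ds hs]] := choosable_Z (C := fun y z => exists x, E y x /\ zc x = z) DC.
  by apply: (big_mono hb) => y [x Ex]; exists (zc x), x.
have [y hy] := big_const Ds hs; have [_ hc] := nb_self hy.
have [f hf] : dimge (fun x => exists y', E y' x /\ zc x = s y) k.
  apply: (exchange_pow (E := fun y' x => E y' x /\ zc x = s y) (z := s y)).
  - by def_auto.
  - by move=> x y1 y2 [h1 _] [h2 _]; apply: Esv h1 h2.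
  - by move=> y1 x [].
  - exists y; apply: (nb_mono (nb_and hy hc)) => v [[[x [Ex e]] _] e']; exists x.
    by rewrite e.
exists f; apply: (big_mono hf) => v [x [[y' [Ey _]] e]]; exists x; split=> //; by exists y'.
Qed.

(** A projection of [h(X)] with interior, composed with [h], is a partial map from [X] onto a set
    with interior, so [exchange_dim] applies. *)
Lemma dimge_image T U (dT : dty T) (dU : dty U) (X : T -> Prop) (h : T -> U) k :
  Def X -> dfn h -> dimge (fun u => exists x, X x /\ h x = u) k -> dimge X k.
Proof.
move=> DX Dh [f hf].
pose proof (dfn_pr f) as Dpr_f.
apply: (dimge_mono _ (@exchange_dim k T dT (fun y x => X x /\ pr f (h x) = y) _ _ _)).
- by move=> x [y []].
- by def_auto.
- by move=> x y y' [_ <-] [_ <-].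
- by apply: (big_mono hf) => y [u [[x [Xx <-]] e]]; exists x.
Qed.

Lemma dimge_fibres T U (dT : dty T) (dU : dty U) (X : T -> U -> Prop) k l :
  Def (fun p => X p.1 p.2) -> dimge (fun x => dimge (X x) l) k ->
  dimge (fun p => X p.1 p.2) (k + l).
Proof.
move=> DX [f hf]; have [hF1 _ _] := tame_pow 'I_k.
pose proof (dfn_pr f) as Dpr_f.
have DA (g : {ffun 'I_l -> ri U}) : Def (fun y => exists x, dimS (X x) g /\ pr f x = y).
  by def_auto.
have [|g hg] := big_exfin hF1 DA.
  by apply: (big_mono hf) => y [x [/dimge_ffun[g hg] e]]; exists g, x.
pose C y w := exists p : T * U, X p.1 p.2 /\ (pr f p.1 = y /\ pr g p.2 = w).
have DC : Def (fun p => C p.1 p.2).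
  pose proof (dfn_pr g) as Dpr_g.
  by rewrite /C; def_auto.
have hC : big (fun p => C p.1 p.2).
  apply: (big_box_fibres DC); apply: (big_mono hg) => y [x [hx e]].
  by apply: (big_mono hx) => w [u [Xu e']]; exists (x, u).
have h := @dimS_sum (T * U) (dtyP dT dU) _ _ (fun p => X p.1 p.2)
  (fun i => inl (f i) : ri T + ri U) (fun i => inr (g i) : ri T + ri U) hC.
by apply: dimS_dimge h; rewrite card_sum !card_ord.
Qed.

(** Independent coordinates of the product separate into those of [T] and those of [U], and each
    group remains independent. *)
Lemma dimge_prod T U (dT : dty T) (dU : dty U) (X : T -> Prop) (Y : U -> Prop) p :
  dimge (fun q => X q.1 /\ Y q.2) p -> exists k l, [/\ p = (k + l)%N, dimge X k & dimge Y l].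
Proof.
move=> [f hf].
pose isl (s : @ri T dT + @ri U dU) := if s is inl _ then true else false.
pose A (i : 'I_p) := isl (f i).
have h1 : forall i : {i | A i}, exists a : @ri T dT, f (val i) = inl a.
  by move=> [i]; rewrite /A /isl /=; case: (f i) => // a _; exists a.
have h2 : forall i : {i | ~~ A i}, exists a : @ri U dU, f (val i) = inr a.
  by move=> [i]; rewrite /A /isl /=; case: (f i) => // a _; exists a.
have [f1 hf1] := choice h1; have [f2 hf2] := choice h2.
exists #|{: {i | A i}}|, #|{: {i | ~~ A i}}|; split.
- by rewrite !card_sig -[LHS](card_ord p) -(cardID A predT); congr addn; apply: eq_card => i; rewrite !inE ?andbT.
- apply: (dimS_dimge (f := f1)) => //.
  apply: (big_mono (dimS_reindex (val_inj : injective (val : {i | A i} -> 'I_p)) hf)).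
  move=> y [[x u] [[Xx _] <-]]; exists x; split=> //; apply/funext => i.
  by rewrite /pr /= hf1.
- apply: (dimS_dimge (f := f2)) => //.
  apply: (big_mono (dimS_reindex (val_inj : injective (val : {i | ~~ A i} -> 'I_p)) hf)).
  move=> y [[x u] [[_ Yu] <-]]; exists u; split=> //; apply/funext => i.
  by rewrite /pr /= hf2.
Qed.

(** * Generic continuity *)

Lemma choosable_any T (dT : dty T) : choosable (U := T).
Proof.
pose phi (p : (@zi T dT -> Z) * (@ri T dT -> R)) := @mk T dT p.1 p.2.
pose psi (x : T) := (@zc T dT x, @rc T dT x).
apply: (@choosable_onto _ _ _ _ phi psi).
- split=> i.
    exists (fun z => z (inl i)); first by left; exists (inl i).
    by move=> [u v]; rewrite /phi zcK.
  exists (fun z => z (inr i)); first by left; exists (inr i).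
  by move=> [u v]; rewrite /phi rcK.
- by move=> x; rewrite /phi /psi mkK.
- by apply: choosable_prod; [apply: choosable_Z|apply: choosable_pow].
Qed.

Lemma fin_isolate (A : R -> Prop) x : fin A ->
  exists a b, a < x < b /\ forall u, A u -> a < u < b -> u = x.
Proof.
move=> [s]; elim: s A => [|h s IH] A hA.
  have [a ax] := Rlow x; have [b xb] := Rup x.
  by exists a, b; rewrite ax xb; split=> // u /hA.
have [|a [b [/andP[ax xb] hab]]] := IH (fun u => A u /\ u <> h).
  by move=> u [/hA + /eqP/negPf ne]; rewrite in_cons ne.
have fin_ u : A u -> u <> h -> a < u < b -> u = x by move=> Au uh; apply: hab.
case: (ltgtP h x) => [hx|xh|hx].
- exists (Order.max h a), b; rewrite gt_max hx ax xb; split=> // u Au.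
  rewrite gt_max => /andP[/andP[hu au] ub]; apply: fin_ => //; last by rewrite au.
  by move=> e; rewrite e ltxx in hu.
- exists a, (Order.min h b); rewrite lt_min xh ax xb; split=> // u Au.
  rewrite lt_min => /andP[au /andP[uh ub]]; apply: fin_ => //; last by rewrite au.
  by move=> e; rewrite e ltxx in uh.
- exists a, b; rewrite ax xb; split=> // u Au hu.
  by have [->//|uh] := pselect (u = h); apply: fin_.
Qed.

(* Over a generic point of a coordinate projection of rank [dim X] the fibres of [X] are
   finite, so near such a point [X] is the graph of a continuous section. *)
Lemma dimge_discontinuity T U (dT : dty T) (dU : dty U) (X : T -> Prop) (f : T -> U) p :
  Def X -> dfn f -> dimge (fun x => X x /\ ~ contX X f x) p -> dimge X p.+1.
Proof.
move=> DX Df [g hg]; have [hF1 hF2 _] := tame_pow 'I_p.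
pose proof (dfn_pr g) as Dg.
apply: contrapT => ndim.
have DC : Def (fun q : ('I_p -> R) * T => (X q.2 /\ ~ contX X f q.2) /\ pr g q.2 = q.1) by def_auto.
(* A definable section through the discontinuity points; on a box both [s] and [f] composed with [s]
   are continuous. *)
have [s [Ds hs]] := @choosable_any T dT _ (fun y x => (X x /\ ~ contX X f x) /\ pr g x = y) DC hg.
have Dfs : dfn (fun y => f (s y)) by dfn_auto.
have [y1 hy1] := big_cont Dfs (big_cont Ds hs).
have [D [DD nD hD]] := nb_def hy1.
(* Only points with the [Z]-coordinates of [s y] compete with it near [s y]; finiteness of each of
   their real coordinates then isolates [s y] in its fibre. *)
pose F j y u := exists x, X x /\ (@zc T dT x = @zc T dT (s y) /\ (pr g x = y /\ @rc T dT x j = u)).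
have DF j : Def (fun q : ('I_p -> R) * R => F j q.1 q.2) by rewrite /F; def_auto.
have DbF j : Def (fun y => big (F j y)) by have D1 := DF j; def_auto.
have nbad : ~ big (fun y => exists j, big (F j y)).
  move=> h; have [j hj] := big_exfin hF1 DbF h; apply: ndim.
  have hjj : big (fun q => F j q.1 q.2) by apply: (big_fibres hF1 hF2 (DF j) hj).
  have := @dimS_option T dT _ X g j (big_mono hjj _).
  move=> h2; apply: (dimS_dimge (k := p.+1) _ (h2 _)); first by rewrite card_option card_ord.
  by move=> q [x [Xx [_ [e1 e2]]]]; exists x.
pose E y := D y /\ ~ exists j, @big R dtyR (F j y).
have DE : Def E.
  by apply: def_and => //; apply: def_not; apply: def_exfin.
have DB : Def (fun y => exists j, big (F j y)) by apply: def_exfin.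
have [|hE|//] := hF1 _ _ DE DB.
  exists y1; apply: (nb_mono nD) => y Dy.
  by have [?|?] := pselect (exists j, big (F j y)); [right|left].
(* An isolating box around [s y]. Choosing it as a continuous function of [y] keeps it from
   shrinking away at neighbouring points. *)
pose Q y (ab : (@ri T dT -> R) * (@ri T dT -> R)) := E y /\
  forall j, ab.1 j < @rc T dT (s y) j < ab.2 j /\
    forall u, F j y u -> ab.1 j < u < ab.2 j -> u = @rc T dT (s y) j.
have DQ : Def (fun q => Q q.1 q.2).
  apply: def_and; first by def_auto.
  apply: def_allfin => j; have D2' := DF j; by def_auto.
have [ab [Dab hab]] : exists s, dfn s /\ big (fun y => Q y (s y)).
  apply: (choosable_any DQ); apply: (big_mono hE) => y [Dy nF].
  have h j : exists q : R * R, q.1 < rc (s y) j < q.2 /\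
      forall u, F j y u -> q.1 < u < q.2 -> u = rc (s y) j.
    have DFy : Def (fun u => F j y u) by have D1 := DF j; def_auto.
    have [fF|bF] := fin_or_big DFy; last by case: nF; exists j.
    by have [a [b h]] := fin_isolate (rc (s y) j) fF; exists (a, b).
  have [q hq] := choice h.
  by exists (fun j => (q j).1, fun j => (q j).2); split.
have [y hy] := big_cont Dab hab; have [[[Dy _] hj] cab] := nb_self hy.
have [[[[Xs nc] gs] cs] cfs] := hD _ Dy.
apply: nc => N hN.
have [a ha] := choice (fun j => Rdense (andP (hj j).1).1).
have [b hb] := choice (fun j => Rdense (andP (hj j).1).2).
have n1 j : nb y (fun v => (ab v).1 j < a j).
  apply: (@cont_lt _ _ (fun v => (ab v).1 j)); last by case/andP: (ha j).
  apply: (cont_dfn_comp (g := fun u => u.1 j) cab); apply: cont_term.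
  by apply: (term_app (f := fun u => u.1)); apply: term_fst; apply: term_id.
have n2 j : nb y (fun v => b j < (ab v).2 j).
  apply: (@cont_gt _ _ (fun v => (ab v).2 j)); last by case/andP: (hb j).
  apply: (cont_dfn_comp (g := fun u => u.2 j) cab); apply: cont_term.
  by apply: (term_app (f := fun u => u.2)); apply: term_snd; apply: term_id.
have n3 : nb y (fun v => zc (s v) = zc (s y)) by apply: (cs (fun x => zc x = zc (s y))); apply: nb_zc.
have n4 : nb y (fun v => N (f (s v))) by apply: cfs.
have nM := nb_and hy (nb_and (nb_and (nb_all n1) (nb_all n2)) (nb_and n3 n4)).
rewrite -gs in nM; have nM' := cont_term (term_pr g) nM.
have nx : nb (s y) (fun x => zc x = zc (s y) /\ forall j, a j < rc x j < b j).
  exists a, b; split=> // j.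
  by have /andP[_ ->] := ha j; have /andP[-> _] := hb j.
apply: (nb_mono (nb_and nM' nx)) => x [[[[[Dv _] hv] _] [[hl hr] [e3 N4]]] [ez hx]] Xx.
rewrite gs in e3.
(* Near [s y] every point of [X] lies on the section, so there [f] is the continuous map [f] after
   [s] after [pr g], against the choice of [s y]. *)
suff -> : x = s (pr g x) by [].
apply: coord_ext => [|j]; first by rewrite e3 ez.
have /andP[h1 h2] := hx j; apply: (hv j).2; last by rewrite (lt_trans (hl j) h1) (lt_trans h2 (hr j)).
by exists x; split=> //; split=> //; rewrite e3.
Qed.

(** The indicator function of [Y], with two values [c0 < c1] in [R], is discontinuous on [X] at each
    point of [Y] that is not interior relative to [X]. *)
Lemma dimge_boundary T (dT : dty T) (X Y : T -> Prop) p : Def X -> Def Y ->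
  (forall x, Y x -> X x) ->
  dimge (fun x => Y x /\ ~ nb x (fun y => X y -> Y y)) p -> dimge X p.+1.
Proof.
move=> DX DY YX h.
have [c0] : inhabited R by case: HR.
have [c1 c01] := Rup c0.
pose f x := if pselect (Y x) then c1 else c0.
have Df : dfn f.
  have D : Def (fun q : T * R => Y q.1 /\ q.2 = c1 \/ ~ Y q.1 /\ q.2 = c0) by def_auto.
  by apply: (def_ext D) => -[x r] /=; rewrite /f; case: pselect => /= ?; tauto.
apply: (dimge_discontinuity DX Df); apply: dimge_mono h => x [Yx nY].
split; first exact: YX.
move=> hc; apply: nY.
have fx : f x = c1 by rewrite /f; case: pselect.
have : nb (f x) (fun r => c0 < r).
  have [c2 c12] := Rup c1; apply: (nb_mono (@nb_itv c0 c2 _ _)) => [|r /andP[]//].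
  by rewrite fx c01.
move=> hN; apply: (nb_mono (hc _ hN)) => y hy Xy; move: (hy Xy); rewrite /f.
by case: pselect => //= _; rewrite ltxx.
Qed.

(** * Definable groups *)

Section DefinableGroup.
Context {T : Type} {dT : dty T}.
Variables (G : T -> Prop) (mul : T -> T -> T) (e : T) (inv : T -> T).
Hypotheses (DG : Def G) (Dmul : dfn (fun p => mul p.1 p.2)) (Dinv : dfn inv)
  (grp : is_group G mul e inv).

Lemma grp_mem1 : G e. Proof. by case: grp => -[]. Qed.
Lemma grp_memM x y : G x -> G y -> G (mul x y). Proof. by case: grp => -[_ h] *; apply: h. Qed.
Lemma grp_memV x : G x -> G (inv x). Proof. by case: grp => _ h *; apply: h. Qed.
Hint Resolve grp_mem1 grp_memM grp_memV : core.
Lemma grp_mulA x y z : G x -> G y -> G z -> mul (mul x y) z = mul x (mul y z).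
Proof. by case: grp => _ _ h *; apply: h. Qed.
Lemma grp_mul1g x : G x -> mul e x = x. Proof. by case: grp => _ _ _ h _ /h[]. Qed.
Lemma grp_mulg1 x : G x -> mul x e = x. Proof. by case: grp => _ _ _ h _ /h[]. Qed.
Lemma grp_mulVg x : G x -> mul (inv x) x = e. Proof. by case: grp => _ _ _ _ h /h[]. Qed.
Lemma grp_mulgV x : G x -> mul x (inv x) = e. Proof. by case: grp => _ _ _ _ h /h[]. Qed.
Lemma grp_mulKg x y : G x -> G y -> mul (inv x) (mul x y) = y.
Proof. by move=> Gx Gy; rewrite -grp_mulA ?grp_mulVg ?grp_mul1g //; auto. Qed.
Lemma grp_mulVKg x y : G x -> G y -> mul x (mul (inv x) y) = y.
Proof. by move=> Gx Gy; rewrite -grp_mulA ?grp_mulgV ?grp_mul1g //; auto. Qed.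
Lemma grp_mulgK x y : G x -> G y -> mul (mul x y) (inv y) = x.
Proof. by move=> Gx Gy; rewrite grp_mulA ?grp_mulgV ?grp_mulg1 //; auto. Qed.
Lemma grp_mulgKV x y : G x -> G y -> mul (mul x (inv y)) y = x.
Proof. by move=> Gx Gy; rewrite grp_mulA ?grp_mulVg ?grp_mulg1 //; auto. Qed.
Lemma grp_invK x : G x -> inv (inv x) = x.
Proof. by move=> Gx; rewrite -[RHS](grp_mulKg (grp_memV Gx)) // grp_mulVg // grp_mulg1; auto. Qed.
Lemma grp_invM x y : G x -> G y -> inv (mul x y) = mul (inv y) (inv x).
Proof.
move=> Gx Gy; have Gxy := grp_memM Gx Gy.
by rewrite -[RHS](grp_mulgK (y := mul x y)) ?[mul (mul (inv y) _) _]grp_mulA ?grp_mulKg ?grp_mulVg ?grp_mul1g; auto.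
Qed.

Lemma locally_open tau S : is_topology_on G tau ->
  (forall x, S x -> exists U, [/\ tau U, U x & forall y, U y -> S y]) -> tau S.
Proof.
move=> [_ _ hU _] h.
have -> : S = (fun x => exists U, (tau U /\ (forall y, U y -> S y)) /\ U x).
  apply/funext => x; apply/propext; split=> [/h[U [tU Ux US]]|[U [[_ US] /US]]] //.
  by exists U.
by apply: hU => U [].
Qed.

Lemma left_translate_open tau g S : group_topology G mul inv tau -> G g -> tau S ->
  tau (fun x => G x /\ S (mul g x)).
Proof.
move=> [top hm _] Gg tS; apply: (locally_open top) => x [Gx Sx].
have [U [V [tU tV Ug Vx hUV]]] := hm g x S Gg Gx tS Sx.
case: (top) => sub _ _ _.
by exists V; split=> // y Vy; split; [apply: sub tV _ Vy|apply: hUV].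
Qed.

Definition relopen (W : T -> Prop) := forall w, W w -> nb w (fun y => G y -> W y).

Variable k : nat.
Hypotheses (dimG : dimge G k) (dimG' : ~ dimge G k.+1).
Notation small A := (~ dimge A k).

Lemma small_sub (A B : T -> Prop) : (forall x, A x -> B x) -> small B -> small A.
Proof. by move=> AB nB /(dimge_mono AB). Qed.

Lemma small_or (A B : T -> Prop) : Def A -> Def B -> small A -> small B ->
  small (fun x => A x \/ B x).
Proof. by move=> DA DB nA nB /(dimge_or DA DB)[]. Qed.

Lemma small_image (A B : T -> Prop) h : Def A -> dfn h -> small A ->
  (forall x, B x -> exists y, A y /\ h y = x) -> small B.
Proof.
by move=> DA Dh nA BA hB; apply: nA; apply: (dimge_image DA Dh); apply: dimge_mono hB.
Qed.

Lemma generic (A : T -> Prop) : small A -> exists x, G x /\ ~ A x.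
Proof.
move=> nA; apply: contrapT => /forallNP n; apply: nA; apply: dimge_mono dimG => x Gx.
by apply: contrapT => nAx; apply: (n x).
Qed.

Lemma contX_comp (f g : T -> T) x : (forall x, G x -> G (f x)) -> contX G f x ->
  contX G g (f x) -> contX G (fun y => g (f y)) x.
Proof.
move=> Gf cf cg N hN; apply: (nb_mono (cf _ (cg _ hN))) => y h Gy; apply: h => //; exact: Gf.
Qed.

Lemma contX_eq (f g : T -> T) x : G x -> (forall x, G x -> f x = g x) -> contX G f x ->
  contX G g x.
Proof.
by move=> Gx fg cf N; rewrite -fg // => hN; apply: (nb_mono (cf _ hN)) => y h Gy; rewrite -fg; auto.
Qed.

(** * Generic continuity of translations *)

Definition pairs (p : T * T) := G p.1 /\ G p.2.
Definition discont (p : T * T) := pairs p /\ ~ contX pairs (fun p => mul p.1 p.2) p.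

Lemma def_pairs : Def pairs. Proof. by rewrite /pairs; def_auto. Qed.
Lemma def_discont : Def discont.
Proof. by have := def_pairs => D; rewrite /discont; def_auto. Qed.

(** Otherwise [G] times [G] would have [2k + 1] independent coordinates, more than [k] of them in
    one factor. *)
Lemma dim_discont : ~ dimge discont (k + k).
Proof.
move=> /(dimge_discontinuity def_pairs Dmul)/dimge_prod[k1 [k2 [ek h1 h2]]].
have h1k : (k1 <= k)%N by rewrite leqNgt; apply/negP => lt; apply: dimG'; apply: dimge_le h1.
have h2k : (k2 <= k)%N by rewrite leqNgt; apply/negP => lt; apply: dimG'; apply: dimge_le h2.
by have := leq_add h1k h2k; rewrite -ek ltnn.
Qed.

(** [h] changes coordinates so that the fibres of interest become vertical. If [k]-dimensional
    fibres occurred over a [k]-dimensional base, [X] would have dimension at least [2k], while it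
    lies in the image of [discont]. *)
Lemma discont_fibres (X : T -> T -> Prop) (h : T * T -> T * T) : Def (fun p => X p.1 p.2) -> dfn h ->
  (forall x y, X x y -> exists q, discont q /\ h q = (x, y)) -> small (fun x => dimge (X x) k).
Proof.
move=> DX Dh hX /(dimge_fibres DX) hd; apply: dim_discont.
apply: (dimge_image def_discont Dh); apply: dimge_mono hd => -[x y]; exact: hX.
Qed.

(** [bad_left1] concerns [v] as the point where a left translation starts, [bad_left2] as the point
    where it ends; the [right] versions mirror them. The conditions [G v /\ G c] ensure that
    [mul c (mul (inv c) v)] gives back [v]. *)
Definition bad_left1 v := dimge (fun c => discont (c, v)) k.
Definition bad_left2 v := dimge (fun c => (G v /\ G c) /\ discont (c, mul (inv c) v)) k.
Definition bad_right1 v := dimge (fun c => discont (v, c)) k.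
Definition bad_right2 v := dimge (fun c => (G v /\ G c) /\ discont (mul v (inv c), c)) k.
Definition good v := G v /\ ~ (bad_left1 v \/ bad_left2 v \/ bad_right1 v \/ bad_right2 v).
(** The interior of [good] relative to [G]: large because the boundary of [good] has smaller
    dimension, and relatively open by construction. *)
Definition chart v := good v /\ nb v (fun y => G y -> good y).

Lemma def_bad_left1 : Def bad_left1. Proof. by have D := def_discont; rewrite /bad_left1; def_auto. Qed.
Lemma def_bad_left2 : Def bad_left2. Proof. by have D := def_discont; rewrite /bad_left2; def_auto. Qed.
Lemma def_bad_right1 : Def bad_right1. Proof. by have D := def_discont; rewrite /bad_right1; def_auto. Qed.
Lemma def_bad_right2 : Def bad_right2. Proof. by have D := def_discont; rewrite /bad_right2; def_auto. Qed.
Lemma def_good : Def good.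
Proof.
by have D1 := def_bad_left1; have D2 := def_bad_left2; have D3 := def_bad_right1; have D4 := def_bad_right2; rewrite /good; def_auto.
Qed.
Lemma def_chart : Def chart. Proof. by have D := def_good; rewrite /chart; def_auto. Qed.

Lemma small_bad_left1 : small bad_left1.
Proof.
have D := def_discont; apply: (discont_fibres (X := fun v c => discont (c, v)) (h := fun q => (q.2, q.1))).
- by def_auto.
- by dfn_auto.
- by move=> x y h; exists (y, x).
Qed.

Lemma small_bad_left2 : small bad_left2.
Proof.
have D := def_discont.
apply: (discont_fibres (X := fun v c => (G v /\ G c) /\ discont (c, mul (inv c) v))
                   (h := fun q => (mul q.1 q.2, q.1))).
- by def_auto.
- by dfn_auto.
- by move=> x y [[Gx Gy] h]; exists (y, mul (inv y) x); rewrite /= grp_mulVKg.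
Qed.

Lemma small_bad_right1 : small bad_right1.
Proof.
have D := def_discont; apply: (discont_fibres (X := fun v c => discont (v, c)) (h := fun q => q)).
- by def_auto.
- by dfn_auto.
- by move=> x y h; exists (x, y).
Qed.

Lemma small_bad_right2 : small bad_right2.
Proof.
have D := def_discont.
apply: (discont_fibres (X := fun v c => (G v /\ G c) /\ discont (mul v (inv c), c))
                   (h := fun q => (mul q.1 q.2, q.2))).
- by def_auto.
- by dfn_auto.
- by move=> x y [[Gx Gy] h]; exists (mul x (inv y), y); rewrite /= grp_mulgKV.
Qed.

Lemma small_not_good : small (fun x => G x /\ ~ good x).
Proof.
have D1 := def_bad_left1; have D2 := def_bad_left2; have D3 := def_bad_right1; have D4 := def_bad_right2.
have h1 : small (fun x => bad_left1 x \/ (bad_left2 x \/ (bad_right1 x \/ bad_right2 x))).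
  apply: small_or => //; first by def_auto.
    exact: small_bad_left1.
  apply: small_or => //; first by def_auto.
    exact: small_bad_left2.
  by apply: small_or => //; [exact: small_bad_right1|exact: small_bad_right2].
apply: small_sub h1 => x [Gx n]; apply: contrapT => h; apply: n; split=> //.
Qed.

Lemma small_not_chart : small (fun x => G x /\ ~ chart x).
Proof.
have D := def_good.
have h : small (fun x => (G x /\ ~ good x) \/ (good x /\ ~ nb x (fun y => G y -> good y))).
  apply: small_or; [by def_auto|by def_auto|exact: small_not_good|].
  move=> h; apply: dimG'; apply: (dimge_boundary DG def_good _ h).
  by move=> x [].
apply: small_sub h => x [Gx nV]; have [V1x|] := pselect (good x); last by auto.
by right; split=> // h; apply: nV.
Qed.

Lemma chart_sub v : chart v -> G v. Proof. by case=> -[]. Qed.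
Hint Resolve chart_sub : core.

Lemma chart_relopen : relopen chart.
Proof.
by move=> v [_ hv]; apply: (nb_mono (nb_and hv (nb_open hv))) => y [h1 h2] /h1.
Qed.

Lemma contX_slice_r x y : pairs (x, y) -> ~ discont (x, y) -> contX G (fun y => mul x y) y.
Proof.
move=> Gxy nB; have c : contX pairs (fun p => mul p.1 p.2) (x, y).
  by apply: contrapT => n; apply: nB.
move=> N /c/nb_pair[N1 [N2 [h1 h2 h]]]; apply: (nb_mono h2) => z N2z Gz.
by apply: (h x z (nb_self h1) N2z); split=> //; case: Gxy.
Qed.

Lemma contX_slice_l x y : pairs (x, y) -> ~ discont (x, y) -> contX G (fun x => mul x y) x.
Proof.
move=> Gxy nB; have c : contX pairs (fun p => mul p.1 p.2) (x, y).
  by apply: contrapT => n; apply: nB.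
move=> N /c/nb_pair[N1 [N2 [h1 h2 h]]]; apply: (nb_mono h1) => z N1z Gz.
by apply: (h z y N1z (nb_self h2)); split=> //; case: Gxy.
Qed.

(* Write [a = c d] with [d], [c] generic: left translation by [a] factors as [x |-> d x] and
   [u |-> c u], which are continuous at [x0] and at [d x0 = c^-1 v0]. *)
Lemma left_cont a x : G a -> chart x -> chart (mul a x) -> contX G (fun y => mul a y) x.
Proof.
move=> Ga Vx Vax; have Gx := chart_sub Vx; have Gax := chart_sub Vax.
have D := def_discont.
have n1 : small (fun c => discont (c, x)) by case: Vx => -[_ n] _ h; apply: n; left.
have n2 : small (fun c => (G (mul a x) /\ G c) /\ discont (c, mul (inv c) (mul a x))).
  by case: Vax => -[_ n] _ h; apply: n; right; left.
(* The [d] for which [c = a d^-1] is bad for the end point [a x]; they form a small set because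
   [c |-> c^-1 a] is definable. Thus one generic [d] makes both factors good. *)
pose B2 d := G d /\ discont (mul a (inv d), mul (inv (mul a (inv d))) (mul a x)).
have n3 : small B2.
  apply: (small_image (h := fun c => mul (inv c) a) _ _ n2); [by def_auto|by dfn_auto|].
  move=> d [Gd h]; exists (mul a (inv d)); split; first by split=> //; auto.
  by rewrite grp_invM ?grp_invK ?grp_mulgKV //; auto.
have DB2 : Def B2 by rewrite /B2; def_auto.
have Dn1 : Def (fun c => discont (c, x)) by def_auto.
have [d [Gd nd]] := generic (small_or Dn1 DB2 n1 n3).
pose c := mul a (inv d); have Gc : G c by rewrite /c; auto.
have c1 : contX G (fun y => mul d y) x by apply: contX_slice_r => [|h]; [split|apply: nd; left].
have e1 : mul (inv c) (mul a x) = mul d x.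
  by rewrite /c grp_invM ?grp_invK ?grp_mulA ?grp_mulKg //; auto.
have c2 : contX G (fun y => mul c y) (mul d x).
  rewrite -e1; apply: contX_slice_r => [|h]; first by split=> /=; auto.
  by apply: nd; right.
apply: (contX_eq Gx _ (contX_comp _ c1 c2)) => y Gy; last by auto.
by rewrite /c grp_mulA ?grp_mulKg //; auto.
Qed.

(** The mirror image, with [b = d c]: right multiplication first by a generic [d], then by
    [c = d^-1 b]. *)
Lemma right_cont b x : G b -> chart x -> chart (mul x b) -> contX G (fun y => mul y b) x.
Proof.
move=> Gb Vx Vxb; have Gx := chart_sub Vx; have Gxb := chart_sub Vxb.
have D := def_discont.
have n1 : small (fun c => discont (x, c)) by case: Vx => -[_ n] _ h; apply: n; do 2!right; left.
have n2 : small (fun c => (G (mul x b) /\ G c) /\ discont (mul (mul x b) (inv c), c)).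
  by case: Vxb => -[_ n] _ h; apply: n; do 3!right.
pose B2 d := G d /\ discont (mul (mul x b) (inv (mul (inv d) b)), mul (inv d) b).
have n3 : small B2.
  apply: (small_image (h := fun c => mul b (inv c)) _ _ n2); [by def_auto|by dfn_auto|].
  move=> d [Gd h]; exists (mul (inv d) b); split; first by split=> //; auto.
  by rewrite grp_invM ?grp_invK ?grp_mulVKg //; auto.
have DB2 : Def B2 by rewrite /B2; def_auto.
have Dn1 : Def (fun c => discont (x, c)) by def_auto.
have [d [Gd nd]] := generic (small_or Dn1 DB2 n1 n3).
pose c := mul (inv d) b; have Gc : G c by rewrite /c; auto.
have c1 : contX G (fun y => mul y d) x by apply: contX_slice_l => [|h]; [split|apply: nd; left].
have e1 : mul (mul x b) (inv c) = mul x d.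
  by rewrite /c grp_invM ?grp_invK ?grp_mulA ?grp_mulVKg //; auto.
have c2 : contX G (fun y => mul y c) (mul x d).
  rewrite -e1; apply: contX_slice_l => [|h]; first by split=> /=; auto.
  by apply: nd; right.
apply: (contX_eq Gx _ (contX_comp _ c1 c2)) => y Gy; last by auto.
by rewrite /c grp_mulA ?grp_mulVKg //; auto.
Qed.

(** * The t-topology *)

(** Every translate of [chart] acts as a coordinate patch. With all [g] allowed, invariance under
    left translations needs no continuity. *)
Definition t_open (U : T -> Prop) := (forall x, U x -> G x) /\
  forall g v, G g -> chart v -> U (mul g v) -> nb v (fun y => chart y -> U (mul g y)).

Lemma t_open_topology : is_topology_on G t_open.
Proof.
split.
- by move=> U [].
- by split=> // g v Gg Vv _; apply: (nb_mono (nb_T v)) => y _ Vy; auto.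
- move=> F FU; split=> [x [U [/FU[h _] /h]] //|g v Gg Vv [U [FUU Uv]]].
  by apply: (nb_mono ((FU _ FUU).2 g v Gg Vv Uv)) => y h Vy; exists U; auto.
- move=> U W [hU1 hU2] [hW1 hW2]; split=> [x []|g v Gg Vv [h1 h2]]; first by auto.
  by apply: (nb_mono (nb_and (hU2 _ _ Gg Vv h1) (hW2 _ _ Gg Vv h2))) => y [] *; auto.
Qed.

Lemma t_open_left h U : G h -> t_open U -> t_open (fun x => G x /\ U (mul h x)).
Proof.
move=> Gh [hU1 hU2]; split=> [x []//|g v Gg Vv [_]]; rewrite -grp_mulA //; last by auto.
move=> Uv; apply: (nb_mono (hU2 _ _ (grp_memM Gh Gg) Vv Uv)) => y hy Vy.
by split; [auto|rewrite -grp_mulA; auto].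
Qed.

(** Compatibility of two patches: when [v] and [g v] both lie in [chart], translation by [g] is
    continuous at [v]. With the converse [t_open_nb], both topologies agree on [chart]. *)
Lemma t_open_relopen W : (forall x, W x -> chart x) -> relopen W -> t_open W.
Proof.
move=> WV oW; split=> [x /WV/chart_sub//|g v Gg Vv Wgv].
apply: (nb_mono (left_cont Gg Vv (WV _ Wgv) (oW _ Wgv))) => y hy Vy.
by apply: hy; auto.
Qed.

Lemma t_open_nb U v : t_open U -> chart v -> U v -> nb v (fun y => G y -> U y).
Proof.
move=> [hU1 hU2] Vv Uv; have := hU2 e v grp_mem1 Vv; rewrite grp_mul1g; last by auto.
move=> /(_ Uv) h; apply: (nb_mono (nb_and h (chart_relopen Vv))) => y [h1 h2] Gy.
by have := h1 (h2 Gy); rewrite grp_mul1g.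
Qed.

(** For generic [h], both [h v] and [h v b] lie in [chart], so [y |-> h y b] is continuous at [v] by
    [left_cont] followed by [right_cont]. The remaining factor [g h^-1] is a left translation and is
    absorbed into [U]. *)
Lemma t_open_right b U : G b -> t_open U -> t_open (fun x => G x /\ U (mul x b)).
Proof.
move=> Gb tU; split=> [x []//|g v Gg Vv [_ Uv]]; have Gv := chart_sub Vv.
have D := def_chart.
have n1 : small (fun h => G h /\ ~ chart (mul h v)).
  apply: (small_image (h := fun z => mul z (inv v)) _ _ small_not_chart); [by def_auto|by dfn_auto|].
  by move=> h [Gh nV]; exists (mul h v); rewrite grp_mulgK //; auto.
have n2 : small (fun h => G h /\ ~ chart (mul (mul h v) b)).
  apply: (small_image (h := fun z => mul z (inv (mul v b))) _ _ small_not_chart); [by def_auto|by dfn_auto|].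
  by move=> h [Gh nV]; exists (mul (mul h v) b); split; [split=> //|rewrite [mul (mul h v) b]grp_mulA // grp_mulgK]; auto.
have Dn1 : Def (fun h => G h /\ ~ chart (mul h v)) by def_auto.
have Dn2 : Def (fun h => G h /\ ~ chart (mul (mul h v) b)) by def_auto.
have [h [Gh nh]] := generic (small_or Dn1 Dn2 n1 n2).
have Vhv : chart (mul h v) by apply: contrapT => n; apply: nh; left.
have Vhvb : chart (mul (mul h v) b) by apply: contrapT => n; apply: nh; right.
have c : contX G (fun y => mul (mul h y) b) v.
  by apply: (contX_comp (f := fun y => mul h y) (g := fun y => mul y b));
    [auto|apply: left_cont|apply: right_cont].
have tU' := t_open_left (grp_memM Gg (grp_memV Gh)) tU.
have eq y : G y -> mul (mul g (inv h)) (mul (mul h y) b) = mul (mul g y) b.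
  by move=> Gy; rewrite grp_mulA ?[mul (mul h y) b]grp_mulA ?grp_mulKg -?grp_mulA //; auto.
have := t_open_nb tU' Vhvb; rewrite eq //= => /(_ (conj (grp_memM (grp_memM Gh Gv) Gb) Uv)) hN.
apply: (nb_mono (c _ hN)) => y hy Vy; have Gy := chart_sub Vy.
by split; [auto|have [_] := hy Gy (grp_memM (grp_memM Gh Gy) Gb); rewrite eq].
Qed.

(** The question is moved from [(x, y)] to a generic continuity point [(x0, y0)] of multiplication
    by [u v = a ((a^-1 u) (v b^-1)) b], with [a = x x0^-1] and [b = y0^-1 y]; translations on either
    side preserve open sets. *)
Lemma t_open_mul x y W : G x -> G y -> t_open W -> W (mul x y) ->
  exists U1 U2, [/\ t_open U1, t_open U2, U1 x, U2 y & forall u v, U1 u -> U2 v -> W (mul u v)].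
Proof.
move=> Gx Gy tW Wxy; have D := def_chart; have D' := def_discont.
have [y0 [Gy0 nV]] := generic small_not_chart.
have Vy0 : chart y0 by apply: contrapT => n; apply: nV.
have n1 : small (fun c => discont (c, y0)) by case: Vy0 => -[_ n] _ h; apply: n; left.
have n2 : small (fun c => G c /\ ~ chart (mul c y0)).
  apply: (small_image (h := fun z => mul z (inv y0)) _ _ small_not_chart); [by def_auto|by dfn_auto|].
  by move=> h [Gh n]; exists (mul h y0); rewrite grp_mulgK //; auto.
have Dn0 : Def (fun c => G c /\ ~ chart c) by def_auto.
have Dn1 : Def (fun c => discont (c, y0)) by def_auto.
have Dn2 : Def (fun c => G c /\ ~ chart (mul c y0)) by def_auto.
have [x0 [Gx0 nx0]] := generic (small_or Dn0 (def_or Dn1 Dn2) small_not_chart (small_or Dn1 Dn2 n1 n2)).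
have Vx0 : chart x0 by apply: contrapT => n; apply: nx0; left.
have Vxy0 : chart (mul x0 y0) by apply: contrapT => n; apply: nx0; right; right.
have c : contX pairs (fun p => mul p.1 p.2) (x0, y0).
  by apply: contrapT => n; apply: nx0; right; left.
pose a := mul x (inv x0); pose b := mul (inv y0) y.
have Ga : G a by rewrite /a; auto.
have Gb : G b by rewrite /b; auto.
have tW' := t_open_right Gb (t_open_left Ga tW).
have W0 : G (mul x0 y0) /\ (G (mul (mul x0 y0) b) /\ W (mul a (mul (mul x0 y0) b))).
  split; first by auto.
  split; first by auto.
  by rewrite /b grp_mulA ?grp_mulVKg -?grp_mulA /a ?grp_mulgKV //; auto.
have := c _ (t_open_nb tW' Vxy0 W0) => /nb_pair[N1 [N2 [h1 h2 h]]].
have tU N u : chart u -> nb u N -> t_open (fun u => chart u /\ nb u N).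
  move=> _ _; apply: t_open_relopen => [z []//|z [Vz Nz]].
  by apply: (nb_mono (nb_and (nb_open Nz) (chart_relopen Vz))) => w [? h'] Gw; auto.
have t1 := t_open_left (grp_memV Ga) (tU _ _ Vx0 h1).
have t2 := t_open_right (grp_memV Gb) (tU _ _ Vy0 h2).
eexists; eexists; split; [exact: t1|exact: t2| | |] => /=.
- split=> //; have -> : mul (inv a) x = x0; last by split.
  by rewrite /a grp_invM ?grp_invK ?grp_mulgKV //; auto.
- split=> //; have -> : mul y (inv b) = y0; last by split.
  by rewrite /b grp_invM ?grp_invK ?grp_mulVKg //; auto.
- move=> u v [Gu [Vu Nu]] [Gv [Vv Nv]].
  have Guv : pairs (mul (inv a) u, mul v (inv b)) by split=> /=; auto.
  have [_ [_]] := h _ _ (nb_self Nu) (nb_self Nv) Guv (grp_memM Guv.1 Guv.2).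
  have -> : mul a (mul (mul (mul (inv a) u) (mul v (inv b))) b) = mul u v => //.
  rewrite (@grp_mulA (mul (inv a) u)) ?grp_mulgKV; auto.
  by rewrite (@grp_mulA (inv a)) ?grp_mulVKg; auto.
Qed.

(** Inversion is continuous at generic [x0]; the identity [y^-1 = (a^-1 y)^-1 a^-1] with
    [a = x x0^-1] carries this to [x]. *)
Lemma t_open_inv W : t_open W -> t_open (fun x => G x /\ W (inv x)).
Proof.
move=> tW; have D := def_chart; apply: (locally_open t_open_topology) => x [Gx Wx].
have n1 : small (fun x => G x /\ ~ contX G inv x).
  by move=> h; apply: dimG'; apply: (dimge_discontinuity DG Dinv h).
have n2 : small (fun c => G c /\ ~ chart (inv c)).
  apply: (small_image (h := inv) _ Dinv small_not_chart); first by def_auto.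
  by move=> h [Gh n]; exists (inv h); rewrite grp_invK //; auto.
have Dn0 : Def (fun c => G c /\ ~ chart c) by def_auto.
have Dn1 : Def (fun c => G c /\ ~ contX G inv c) by def_auto.
have Dn2 : Def (fun c => G c /\ ~ chart (inv c)) by def_auto.
have [x0 [Gx0 nx0]] := generic (small_or Dn0 (def_or Dn1 Dn2) small_not_chart (small_or Dn1 Dn2 n1 n2)).
have Vx0 : chart x0 by apply: contrapT => n; apply: nx0; left.
have Vix0 : chart (inv x0) by apply: contrapT => n; apply: nx0; right; right.
have c : contX G inv x0 by apply: contrapT => n; apply: nx0; right; left.
pose a := mul x (inv x0); have Ga : G a by rewrite /a; auto.
have tW' := t_open_right (grp_memV Ga) tW.
have W0 : G (inv x0) /\ W (mul (inv x0) (inv a)).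
  split; first by auto.
  by rewrite /a grp_invM ?grp_invK ?grp_mulKg //; auto.
have hN := c _ (t_open_nb tW' Vix0 W0).
have tU : t_open (fun u => chart u /\ nb u (fun y => G y -> G (inv y) -> G (inv y) /\ W (mul (inv y) (inv a)))).
  apply: t_open_relopen => [z []//|z [Vz Nz]].
  by apply: (nb_mono (nb_and (nb_open Nz) (chart_relopen Vz))) => w [? h'] Gw; auto.
eexists; split; first exact: (t_open_left (grp_memV Ga) tU).
- split=> //; have -> : mul (inv a) x = x0; last by split.
  by rewrite /a grp_invM ?grp_invK ?grp_mulgKV //; auto.
- move=> y [Gy [Vy Ny]]; have [_] := nb_self Ny (chart_sub Vy) (grp_memV (chart_sub Vy)).
  by rewrite grp_invM ?grp_invK ?grp_mulgK //; auto.
Qed.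

Lemma t_open_group_topology : group_topology G mul inv t_open.
Proof. by split; [exact: t_open_topology|exact: t_open_mul|exact: t_open_inv]. Qed.

(** A tau1-open set is compared with tau2 only at [w0]: left translation by [h = w0 x^-1] brings any
    [x] there. The hypotheses are one-sided so that exchanging the two topologies gives the other
    inclusion. *)
Lemma topology_unique (W : T -> Prop) tau1 tau2 w0 :
  group_topology G mul inv tau1 -> group_topology G mul inv tau2 ->
  (forall x, W x -> G x) -> relopen W -> W w0 ->
  (forall U x, tau1 U -> W x -> U x -> nb x (fun y => G y -> U y)) ->
  (forall A, (forall x, A x -> W x) -> relopen A -> tau2 A) ->
  forall U, tau1 U -> tau2 U.
Proof.
move=> gt1 gt2 WG oW Ww0 h1 h2 U tU.
have [top1 _ _] := gt1; have [top2 _ _] := gt2.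
have UG : forall x, U x -> G x by case: top1 => sub _ _ _; apply: sub.
have Gw0 := WG _ Ww0.
apply: (locally_open top2) => x Ux; have Gx := UG _ Ux.
pose h := mul w0 (inv x); have Gh : G h by rewrite /h; auto.
have t1 := left_translate_open gt1 (grp_memV Gh) tU.
pose A z := W z /\ @nb T dT z (fun y => G y -> G y /\ U (mul (inv h) y)).
have tA : tau2 A.
  apply: h2 => [z []//|z [Wz Nz]].
  by apply: (nb_mono (nb_and (nb_open Nz) (oW _ Wz))) => y [h3 h4] Gy; split; auto.
exists (fun y => G y /\ A (mul h y)); split; first exact: left_translate_open.
- split=> //; have -> : mul h x = w0 by rewrite /h grp_mulgKV.
  split=> //; apply: h1 => //; split=> //.
  by rewrite /h grp_invM ?grp_invK ?grp_mulgKV //; auto.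
- move=> y [Gy [_ Ny]]; have [_] := nb_self Ny (grp_memM Gh Gy).
  by rewrite grp_mulKg.
Qed.

End DefinableGroup.

(** * Translation to the ambient notions *)

Section Points.

(** The product instance of [dty] uses the indices [I + void] and [void + J]; the proof removes and
    restores the empty summands. *)
Lemma Def_DefZR (I J : finType) (X : (I -> Z) * (J -> R) -> Prop) : Def X <-> DZR X.
Proof.
split=> [DX|DX].
  pose s (i : I + void) (z : I -> Z) := match i with inl i => z i | inr v => match v with end end.
  pose t (j : void + J) (r : J -> R) := match j with inl v => match v with end | inr j => r j end.
  have hs i : simple (s i) by case: i => [i|[]]; left; exists i.
  have ht j : simple (t j) by case: j => [[]|j]; left; exists j.
  by apply: (DefZR_ext (DefZR_simple DX hs ht)) => -[].
pose s (i : I) (z : I + void -> Z) := z (inl i).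
pose t (j : J) (r : void + J -> R) := r (inr j).
have hs i : simple (s i) by left; exists (inl i).
have ht j : simple (t j) by left; exists (inr j).
by have D := DefZR_simple DX hs ht; apply: (DefZR_ext D).
Qed.

(** A repeated coordinate would confine the projection to a diagonal, and moving one entry inside
    the box leaves it. This bounds the dimension by the number of coordinates. *)
Lemma dimS_injective T (dT : dty T) (K : finType) (X : T -> Prop) (f : K -> ri T) :
  dimS X f -> injective f.
Proof.
move=> [y hy] i j fij; apply/eqP; apply: contraT => nij.
have eqij (y' : K -> R) : (exists x, X x /\ pr f x = y') -> y' i = y' j.
  by move=> [x [_ <-]]; rewrite /pr fij.
have yij := eqij _ (nb_self hy).
have [a [b [h1 h2]]] := hy.
have /andP[h3 h4] := h1 i; have [c /andP[ac cy]] := Rdense h3.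
suff : c = y j by move=> e; rewrite -yij in e; rewrite e ltxx in cy.
have := eqij (fun l => if l == i then c else y l); rewrite eqxx eq_sym (negPf nij); apply.
apply: h2 => [|l /=]; first exact: void_fun.
by case: eqP => [->|_]; [rewrite ac (lt_trans cy)|apply: h1].
Qed.

Lemma dim_exists T (dT : dty T) (X : T -> Prop) x : X x ->
  exists k, dimge X k /\ ~ dimge X k.+1.
Proof.
move=> Xx.
have h0 : dimge X 0.
  have f : 'I_0 -> ri T by case.
  have y : 'I_0 -> R by case.
  exists f, y; apply: (nb_mono (nb_T y)) => y' _; exists x; split=> //.
  by apply/funext; case.
have hb k : `[<dimge X k>] -> (k <= #|ri T|)%N.
  by move=> /asboolP[f /dimS_injective/leq_card]; rewrite card_ord.
have ex : exists k, `[<dimge X k>] by exists 0%N; apply/asboolP.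
case: (ex_maxnP ex hb) => k /asboolP hk kmax; exists k; split=> // /asboolP/kmax.
by rewrite ltnn.
Qed.

Variables m n : nat.
Notation T := (pt Z R m n).

#[local] Instance dtyPt : dty T := dtyP (dtyZI 'I_m) (dtyRJ 'I_n).

Lemma nbPt (p : T) (U : T -> Prop) : nb p U <-> exists a b : 'I_n -> R,
  (forall j, a j < p.2 j < b j) /\
  (forall q : T, q.1 = p.1 -> (forall j, a j < q.2 j < b j) -> U q).
Proof.
split=> [[a [b [h1 h2]]]|[a [b [h1 h2]]]].
  exists (fun j => a (inr j)), (fun j => b (inr j)); split=> [j|q e hq].
    exact: (h1 (inr j)).
  apply: h2; last by case.
  by apply/funext; case=> //= i; rewrite e.
exists (fun j : void + 'I_n => match j with inl v => match v with end | inr j => a j end),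
       (fun j : void + 'I_n => match j with inl v => match v with end | inr j => b j end).
split=> [[[]|j]|q e hq]; first exact: h1.
apply: h2 => [|j]; last exact: (hq (inr j)).
by apply/funext => i; have := congr1 (fun f => f (inl i)) e.
Qed.

Lemma ambient_openP (U : T -> Prop) : ambient_open U <-> forall p, U p -> nb p U.
Proof. by split=> h p /h/nbPt. Qed.

Lemma dim_geP (X : T -> Prop) k : dim_ge (projR X) k <-> dimge X k.
Proof.
split=> [[f [finj [a [b [ab h]]]]]|[f hf]].
  have [y hy] := choice (fun i => Rdense (ab i)).
  exists (fun i => inr (f i) : void + 'I_n), y, a, b; split=> // y' _ hy'.
  by have [r [[z Xzr] e]] := h y' hy'; exists (z, r).
have finj := dimS_injective hf.
have h i : exists j : 'I_n, f i = inr j by case: (f i) => [[]|j]; exists j.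
have [g hg] := choice h.
exists g; split=> [i j e|]; first by apply: finj; rewrite !hg e.
have [y [a [b [h1 h2]]]] := hf; exists a, b; split=> [i|y' hy'].
  by have /andP[] := h1 i; apply: lt_trans.
have [|[z r] [Xzr e]] := h2 y' _ hy'; first exact: void_fun.
exists r; split; first by exists z.
by rewrite -e; apply/funext => i; rewrite /pr /= hg.
Qed.

Lemma trip_inj (x y w x' y' w' : T) : trip x y w = trip x' y' w' ->
  [/\ x = x', y = y' & w = w'].
Proof.
move=> E.
have e1 (i : 'I_3) j : (sel3 x y w i).1 j = (sel3 x' y' w' i).1 j.
  by have := congr1 (fun t => t.1 (i, j)) E.
have e2 (i : 'I_3) j : (sel3 x y w i).2 j = (sel3 x' y' w' i).2 j.
  by have := congr1 (fun t => t.2 (i, j)) E.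
have e3 i : sel3 x y w i = sel3 x' y' w' i.
  by apply: injective_projections; apply/funext => j.
by split; [apply: (e3 (@Ordinal 3 0 isT))|apply: (e3 (@Ordinal 3 1 isT))
          |apply: (e3 (@Ordinal 3 2 isT))].
Qed.

Lemma term_trip : term (fun q : T * T * T => trip q.1.1 q.1.2 q.2).
Proof.
split; case=> // -[a i].
- case: a => -[|[|a]] ha.
  + by exists (fun u => u (inl (inl (inl i)))) => //; left; eexists.
  + by exists (fun u => u (inl (inr (inl i)))) => //; left; eexists.
  + by exists (fun u => u (inr (inl i))) => //; left; eexists.
- case: a => -[|[|a]] ha.
  + by exists (fun u => u (inl (inl (inr i)))) => //; left; eexists.
  + by exists (fun u => u (inl (inr (inr i)))) => //; left; eexists.
  + by exists (fun u => u (inr (inr i))) => //; left; eexists.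
Qed.

Lemma def_mul_graph (G : T -> Prop) mul : DZR (mul_graph G mul) ->
  Def (fun q : T * T * T => [/\ G q.1.1, G q.1.2 & q.2 = mul q.1.1 q.1.2]).
Proof.
move=> /Def_DefZR D; apply: (def_ext (def_term D term_trip)) => -[[x y] w] /=.
split=> [[x' [y' [Gx [Gy /trip_inj[-> -> ->]]]]]|[Gx Gy ->]]; first by split.
by exists x, y.
Qed.

End Points.

(** * Existence and uniqueness *)

Lemma is_group_ext (T : Type) (G : T -> Prop) mul mul' e inv inv' :
  (forall x y, G x -> G y -> mul x y = mul' x y) -> (forall x, G x -> inv x = inv' x) ->
  is_group G mul e inv -> is_group G mul' e inv'.
Proof.
move=> hm hi [[Ge GM_] GV_ hA h1 hV]; split.
- by split=> // x y Gx Gy; rewrite -hm //; apply: GM_.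
- by move=> x Gx; rewrite -hi //; apply: GV_.
- by move=> x y z Gx Gy Gz; rewrite -!hm ?hA //; do ?[apply: GM_ => //]; rewrite -hm //; apply: GM_.
- by move=> x Gx; rewrite -!hm //; apply: h1.
- by move=> x Gx; rewrite -!hi // -!hm //; [apply: hV|apply: GV_|apply: GV_].
Qed.

Lemma group_topology_ext (T : Type) (G : T -> Prop) mul mul' inv inv' tau0 :
  (forall x y, G x -> G y -> mul x y = mul' x y) -> (forall x, G x -> inv x = inv' x) ->
  group_topology G mul inv tau0 -> group_topology G mul' inv' tau0.
Proof.
move=> hm hi [top hM hI]; have [sub _ _ _] := top; split=> // [x y W Gx Gy tW|W tW].
  rewrite -hm // => Wxy; have [U [V' [tU tV Ux Vy h]]] := hM x y W Gx Gy tW Wxy.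
  exists U, V'; split=> // u v Uu Vv; rewrite -hm; [exact: h|exact: sub tU _ Uu|exact: sub tV _ Vv].
have -> : (fun x => G x /\ W (inv' x)) = (fun x => G x /\ W (inv x)); last exact: hI.
by apply/funext => x; apply/propext; split=> -[Gx]; rewrite hi.
Qed.

Lemma t_topology_exists_unique (m n : nat) (G : pt Z R m n -> Prop)
    (mul : pt Z R m n -> pt Z R m n -> pt Z R m n)
    (e : pt Z R m n) (inv : pt Z R m n -> pt Z R m n) :
  DefZR DZ DR G -> is_group G mul e inv -> DefZR DZ DR (mul_graph G mul) ->
  exists tau0 : (pt Z R m n -> Prop) -> Prop, t_topology DZ DR G mul inv tau0 /\
    forall tau', t_topology DZ DR G mul inv tau' -> tau' = tau0.
Proof.
move=> DG0 grp0 Dmul0; pose dP := dtyPt m n.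
have DG : @Def _ dP G by apply/Def_DefZR.
pose GT q w := [/\ G q.1, G q.2 & w = mul q.1 q.2].
(* Outside [G] the function [mul] is arbitrary; [mu] is a total definable function that agrees with
   it on [G]. *)
have [|mu [Dmu hmu]] := @dfn_of_graph _ _ (dtyP dP dP) dP GT e (def_mul_graph Dmul0).
  by move=> q u v [_ _ ->] [_ _ ->].
have hm x y : G x -> G y -> mul x y = mu (x, y).
  by move=> Gx Gy; rewrite (hmu (x, y) (mul x y)).
(* Definability of inversion is derived: on [G] the inverse of [x] is the unique solution of
   [x w = e]. *)
pose IT x w := (G x /\ G w) /\ mu (x, w) = e.
have DIT : @Def _ (dtyP dP dP) (fun q => IT q.1 q.2) by rewrite /IT; def_auto.
have grp1 := is_group_ext hm (fun x _ => erefl (inv x)) grp0.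
have invE x w : IT x w -> w = inv x.
  move=> [[Gx Gw] h]; rewrite -(grp_mulKg grp1 Gx Gw) h (grp_mulg1 grp1) //.
  exact: (grp_memV grp1).
have [|iv [Div hiv]] := @dfn_of_graph _ _ dP dP IT e DIT.
  by move=> x u v /invE -> /invE ->.
have hi x : G x -> inv x = iv x.
  move=> Gx; rewrite (hiv x (inv x)) //; split; last exact: (grp_mulgV grp1).
  by split=> //; apply: (grp_memV grp1).
have grp := is_group_ext hm hi grp0.
have [k [dimG dimG']] := @dim_exists _ dP G e (grp_mem1 grp).
have gt_to := group_topology_ext hm hi.
have gt_from := group_topology_ext (fun x y Gx Gy => esym (hm x y Gx Gy)) (fun x Gx => esym (hi x Gx)).
have Dmu' : @dfn _ _ (dtyP dP dP) dP (fun p => mu (p.1, p.2)) by dfn_auto.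
(* The rank [k'] that witnesses largeness satisfies [k' <= k], so a complement without rank [k'] has
   no rank [k] either. *)
have large_small V' : DefZR DZ DR V' -> R_large G V' -> ~ @dimge _ dP (fun x => G x /\ ~ V' x) k.
  move=> _ [h|[k' [h1 h2]]].
    move=> [f [y hy]]; have [x [[Gx nV] _]] := nb_self hy; apply: nV; exact: h.
  move=> h; apply: h2; apply/dim_geP; apply: dimge_le h.
  by rewrite leqNgt; apply/negP => lt; apply: dimG'; apply: (dimge_le lt); apply/dim_geP.
have incl tau1 tau2 : t_topology DZ DR G mul inv tau1 -> t_topology DZ DR G mul inv tau2 ->
    forall U, tau1 U -> tau2 U.
  move=> [gt1 [V1_ [DV1_ sV1 lV1 tV1 cV1]]] [gt2 [V2_ [DV2_ sV2 lV2 tV2 cV2]]].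
  have D1 : @Def _ dP V1_ by apply/Def_DefZR.
  have D2' : @Def _ dP V2_ by apply/Def_DefZR.
  pose Y x := V1_ x /\ V2_ x.
  have DY : @Def _ dP Y by rewrite /Y; def_auto.
  have n1 : ~ @dimge _ dP (fun x => G x /\ ~ Y x) k.
    have Da : @Def _ dP (fun x => G x /\ ~ V1_ x) by def_auto.
    have Db : @Def _ dP (fun x => G x /\ ~ V2_ x) by def_auto.
    apply: small_sub (small_or Da Db (large_small _ DV1_ lV1) (large_small _ DV2_ lV2)).
    move=> x [Gx nY]; have [?|?] := pselect (V1_ x); last by left.
    by right; split=> // ?; apply: nY.
  (* The interior of the two charts' intersection relative to [G]. It has a point, since the
     complement of [Y] in [G] and the boundary of [Y] are both small. *)
  pose W x := Y x /\ @nb _ dP x (fun y => G y -> Y y).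
  have DW' : @Def _ dP (fun x => Y x /\ ~ @nb _ dP x (fun y => G y -> Y y)) by def_auto.
  have n2 : ~ @dimge _ dP (fun x => Y x /\ ~ @nb _ dP x (fun y => G y -> Y y)) k.
    by move=> h; apply: dimG'; apply: (dimge_boundary DG DY _ h) => x [/sV1].
  have DnY : @Def _ dP (fun x => G x /\ ~ Y x) by def_auto.
  have [w0 [Gw0 nw0]] := generic dimG (small_or DnY DW' n1 n2).
  have Ww0 : W w0.
    have Yw0 : Y w0 by apply: contrapT => h; apply: nw0; left.
    by split=> //; apply: contrapT => h; apply: nw0; right.
  apply: (topology_unique grp (gt_to _ gt1) (gt_to _ gt2) (W := W) (w0 := w0)) => //.
  - by move=> x [[/sV1]].
  - by move=> x [_ hx]; apply: (nb_mono (nb_and hx (nb_open hx))) => y [h1 h2] Gy; split; auto.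
  - move=> U x tU [[V1x _] hx] Ux.
    have [[U' [/ambient_openP oU' hU']] _] : (exists U', ambient_open U' /\
        forall x, (U x /\ V1_ x) <-> U' x /\ V1_ x) /\ True.
      by split=> //; apply/cV1; exists U.
    have [U'x _] : U' x /\ V1_ x by apply/hU'.
    apply: (nb_mono (nb_and hx (oU' _ U'x))) => y [h1 U'y] Gy.
    by have [V1y _] := h1 Gy; have [] : U y /\ V1_ y by apply/hU'.
  - move=> A AW oA.
    have [U1 [tU1 hU1]] : exists U1, tau2 U1 /\ forall x, A x <-> U1 x /\ V2_ x.
      (* An ambient open set whose trace on [V2_] is the relatively open set [A]: the interior of
         the set where [G] implies [A]. *)
      apply/cV2; exists (fun p => @nb _ dP p (fun y => G y -> A y)); split.
        by apply/ambient_openP => p; apply: nb_open.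
      move=> x; split=> [Ax|[hx /sV2 Gx]]; last exact: (nb_self hx Gx).
      by split; [exact: oA|have [[_]] := AW _ Ax].
    have -> : A = (fun x => U1 x /\ V2_ x) by apply/funext => x; apply/propext.
    by case: gt2 => -[_ _ _ hI] _ _; apply: hI.
pose tau0 := @t_open _ dP G (fun x y => mu (x, y)) iv k.
have ht : t_topology DZ DR G mul inv tau0.
  split; first exact/gt_from/(t_open_group_topology DG Dmu' Div grp dimG dimG').
  pose C0 := @chart _ dP G (fun x y => mu (x, y)) iv k.
  have C0G x : C0 x -> G x by apply: chart_sub.
  have oC0 : @relopen _ dP G C0 by apply: chart_relopen.
  exists C0; split=> //.
  - apply/Def_DefZR; exact: (def_chart DG Dmu' Div).
  - right; exists k; split; first by apply/dim_geP.
    by move/dim_geP; apply: (small_not_chart DG Dmu' Div grp dimG').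
  - by apply: (t_open_relopen DG Dmu' Div grp dimG).
  - move=> W; split=> [[U [tU hW]]|[U [/ambient_openP oU hW]]].
      (* Again an interior: the largest ambient open set whose trace on the chart lies in [U]. *)
      exists (fun p => @nb _ dP p (fun y => C0 y -> U y)); split.
        by apply/ambient_openP => p; apply: nb_open.
      move=> x; rewrite hW; split=> [[Ux Vx]|[hx Vx]]; split=> //; last exact: (nb_self hx).
      by apply: (nb_mono (t_open_nb grp tU Vx Ux)) => y h /C0G; apply: h.
    exists W; split; last first.
      by move=> x; split=> [h|[]//]; split=> //; move/hW: h => [].
    apply: (t_open_relopen DG Dmu' Div grp dimG) => [x /hW[]//|x /hW[Ux Vx]].
    apply: (nb_mono (nb_and (oU _ Ux) (oC0 _ Vx))) => y [Uy h] Gy; apply/hW; auto.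
exists tau0; split=> // tau' ht'; apply/funext => U; apply/propext.
by split; apply: incl.
Qed.

End TwoSorted.

Theorem theorem9p7 (Z : Type) (d : Order.disp_t) (R : orderType d)
  (DZ : defsys Z) (DR : defsys R) (m n : nat)
  (G : pt Z R m n -> Prop) (mul : pt Z R m n -> pt Z R m n -> pt Z R m n)
  (e : pt Z R m n) (inv : pt Z R m n -> pt Z R m n) :
  is_structure DZ -> o_minimal DR ->
  DefZR DZ DR G -> is_group G mul e inv -> DefZR DZ DR (mul_graph G mul) ->
  exists tau : (pt Z R m n -> Prop) -> Prop,
    t_topology DZ DR G mul inv tau /\
    forall tau', t_topology DZ DR G mul inv tau' -> tau' = tau.
Proof. by move=> HZ HR; apply: t_topology_exists_unique. Qed.
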